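(* For any $t\in\mathbb N_+$, there exists a constant $\widetilde W_t$ such that for any integer $d\geq 2$ and any real $\widetilde W\geq\widetilde W_t d^{t-1}$, there exists a weighted $t$-design curve on $S^d$ of length $\widetilde W$ with weight function strictly positive except at finitely many points.
   Context: $\mathbb N_+=\{1,2,\dots\}$. $S^d\subset\mathbb R^{d+1}$ is the unit sphere. $P_t(S^d)$ is the space of restrictions to $S^d$ of real-valued polynomials on $\mathbb R^{d+1}$ of degree at most $t$. $\sigma$ is the uniform measure on $S^d$, normalized so that $\sigma(S^d)=1$. The length of a curve $\gamma:[0,1]\to S^d$ is $\ell(\gamma)=\int_0^1|\gamma'(s)|\,ds$. For a continuous, piecewise smooth, closed curve $\gamma:[0,1]\to S^d$ with finitely many self-intersections and a function $w:[0,1]\to\mathbb R$ (the weight function), the pair $(\gamma,w)$ is a weighted $t$-design curve on $S^d$ if $\int_0^1f(\gamma(s))w(s)|\gamma'(s)|\,ds=\int_{S^d}f\,d\sigma$ for all $f\in P_t(S^d)$. Convention: a pair $(\gamma,w)$ for which the speed $|\gamma'|$ is unbounded is also called a weighted $t$-design curve if it can be reparameterized to produce a weighted $t$-design curve in this sense. *)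

(* Defs.v *)
From mathcomp Require Import all_boot all_order all_algebra.
From mathcomp Require Import -(notations) mpoly.
From mathcomp Require Import all_classical all_reals all_analysis.

Set Implicit Arguments.
Unset Strict Implicit.
Unset Printing Implicit Defensive.

Import Order.TTheory GRing.Theory Num.Theory.
Import numFieldNormedType.Exports.

Local Open Scope classical_set_scope.
Local Open Scope ring_scope.

(* The library's norm on row vectors is the sup norm, hence this definition;
   both norms induce the same topology, and so the same notions of
   continuity, derivative and Borel set. *)
Definition enorm (R : realType) (n : nat) (x : 'rV[R]_n) : R :=
  Num.sqrt (\sum_(i < n) x ord0 i ^+ 2).

Definition sphere (R : realType) (d : nat) : set 'rV[R]_d.+1 :=
  [set x | enorm x = 1].
Arguments sphere : clear implicits.

Definition borel_rV (R : realType) (n : nat) :=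
  g_sigma_algebraType (@open 'rV[R]_n).

(* The uniform measure on S^d, seen as a Borel measure on R^(d+1) carried by
   S^d, is the unique such probability measure invariant under O(d+1). *)
Definition uniform_on_sphere (R : realType) (d : nat)
    (sigma : probability (borel_rV R d.+1) R) : Prop :=
  sigma (sphere R d) = 1%E /\
  forall A : 'M[R]_d.+1, A *m A^T = 1%:M ->
  forall B : set (borel_rV R d.+1), measurable B ->
    sigma ((fun x : 'rV[R]_d.+1 => x *m A) @^-1` B) = sigma B.

Definition polyfun (R : realType) (n : nat) (p : mpoly n R)
    (x : 'rV[R]_n) : R :=
  meval (fun i => x ord0 i) p.

Definition smooth_at (R : realType) (V : normedModType R) (g : R -> V)
    (x : R) : Prop :=
  forall k : nat, derivable (derive1n k g) x 1.

(* Smoothness up to the end points of the compact interval [a, b]; in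
   particular the derivative is bounded there. *)
Definition smooth_on_segment (R : realType) (V : normedModType R)
    (g : R -> V) (a b : R) : Prop :=
  exists h : R -> V, (forall x, smooth_at h x) /\ {in `[a, b], g =1 h}.

Definition piecewise_smooth (R : realType) (V : normedModType R)
    (g : R -> V) : Prop :=
  exists2 s : seq R, itv_partition 0 1 s &
  forall i : nat, (i < size s)%N ->
    smooth_on_segment g (nth 0 (0 :: s) i) (nth 0 (0 :: s) i.+1).

(* The junk value of the derivative at the finitely many break points, and at
   0 and 1 where it depends on values of gamma off [0, 1], does not affect the
   integrals below. *)
Definition speed (R : realType) (n : nat) (gamma : R -> 'rV[R]_n.+1)
    (s : R) : R :=
  enorm (derive1 gamma s).

Definition curve_length (R : realType) (n : nat)
    (gamma : R -> 'rV[R]_n.+1) : \bar R :=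
  (\int[lebesgue_measure]_(s in `[0%R, 1%R]) (speed gamma s)%:E)%E.

(* Parameters are taken in [0, 1[, so that gamma 0 = gamma 1 does not count. *)
Definition self_intersections (R : realType) (n : nat)
    (gamma : R -> 'rV[R]_n.+1) : set (R * R) :=
  [set st | [/\ 0 <= st.1, st.1 < st.2, st.2 < 1 & gamma st.1 = gamma st.2]].

Definition strict_weighted_design_curve (R : realType) (d t : nat)
    (sigma : probability (borel_rV R d.+1) R)
    (gamma : R -> 'rV[R]_d.+1) (w : R -> R) : Prop :=
  [/\ {in `[0, 1], forall s, sphere R d (gamma s)},
      {within `[0, 1], continuous gamma} /\ piecewise_smooth gamma,
      gamma 0 = gamma 1,
      finite_set (self_intersections gamma) &
      forall p : mpoly d.+1 R, (msize p <= t.+1)%N ->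
        (@lebesgue_measure R).-integrable `[0, 1]
          (fun s => (polyfun p (gamma s) * w s * speed gamma s)%:E) /\
        (\int[lebesgue_measure]_(s in `[0%R, 1%R])
            (polyfun p (gamma s) * w s * speed gamma s)%:E =
         \int[sigma]_(x in sphere R d) (polyfun p x)%:E)%E].

(* Increasing homeomorphism of [0, 1], diffeomorphic off finitely many points;
   its derivative may tend to 0 or be unbounded at those points. *)
Definition reparameterization (R : realType) (phi : R -> R) : Prop :=
  [/\ {within `[0, 1], continuous phi}, phi 0 = 0, phi 1 = 1 &
      exists2 s : seq R, itv_partition 0 1 s &
      forall i : nat, (i < size s)%N ->
        {in `]nth 0 (0 :: s) i, nth 0 (0 :: s) i.+1[,
          forall x : R, smooth_at (phi : R -> R^o) x /\
                        0 < derive1 (phi : R -> R^o) x}].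

(* The second case admits curves of unbounded speed. That gamma is continuous,
   closed, etc. follows, since gamma is the reparameterized curve composed
   with the inverse of phi. *)
Definition weighted_design_curve (R : realType) (d t : nat)
    (sigma : probability (borel_rV R d.+1) R)
    (gamma : R -> 'rV[R]_d.+1) (w : R -> R) : Prop :=
  strict_weighted_design_curve t sigma gamma w \/
  (~ (exists M : R, {in `[0, 1], forall s, speed gamma s <= M}) /\
   exists phi : R -> R, reparameterization phi /\
     strict_weighted_design_curve t sigma (gamma \o phi) (w \o phi)).

(* Main.v *)
Require Import Defs.
From mathcomp Require Import all_boot all_order all_fingroup all_algebra all_field.
From mathcomp Require Import polyrcf zify.
From mathcomp Require Import -(notations) mpoly.
From mathcomp Require Import all_classical all_reals all_analysis.
From mathcomp Require Import measurable_realfun ring lra.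
Import Order.TTheory GRing.Theory Num.Theory.
Import numFieldNormedType.Exports.
Local Open Scope ring_scope.

Set Implicit Arguments.
Unset Strict Implicit.
Unset Printing Implicit Defensive.

(* Sums of scaled dyadic Bernoulli variables can be arranged to have
   the moments of a Gaussian up to order 2s. Independent copies of such a
   variable satisfy E <x, Y>^(2s) = kappa |x|^(2s), and so do 2s-wise independent
   copies, which live on a probability space with O(n^(2s-1)) points. This is a
   Hilbert identity, and yields a positively weighted t-design on S^d with
   O(d^(t-1)) points and their antipodes.

   Averaging such a design over finitely many reflections close to a fixed one
   replaces each point by a small cluster, so that a polygon through all points
   still has length O(d^(t-1)), while one of the clusters now determines the
   polynomials of degree t. Hence, if the points are moved a little and the point
   masses are smeared along the curve, the error is compensated by solving a
   linear system close to the identity, and the masses stay positive.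

   Moving the points to general position makes the closed polygon of great circle
   arcs cross itself finitely often. Small circles through its first vertex use
   up the remaining length, and a small constant added to the weight makes it
   positive everywhere. *)

(** * A Hilbert identity with few terms *)

(** For fixed [t] the polynomials of degree at most [t] form a space of dimension of order d^t,
    while a curve of length of order d^(t-1) has room for only O(d^(t-1)) points far from each
    other. Such points alone do not determine the polynomials, so an error made by moving them or by
    smearing their masses could not be repaired by changing the masses. Clusters remove this
    obstacle: one cluster can have as many points as the dimension, because steps inside it cost
    almost no length. The Hilbert identity is used with s = floor(t/2). It settles the even degrees
    up to 2s, and antipodes cancel the odd ones, so the design is exact up to degree 2s + 1, which
    is at least [t], while the exponent 2s - 1 of the point count is at most t - 1. Dyadic variables
    are used because they are functions of a uniform element of a finite field of characteristic 2,
    over which a linear code provides the limited independence. The curve has constant speed, equal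
    to its length, apart from its break points, so it is a design curve without any change of
    parameter. *)

Lemma exists_root (R : rcfType) (a : nat) (x : R) :
  0 <= x -> exists2 y : R, 0 <= y & y ^+ a.+1 = x.
Proof.
move=> x0; have x1 : 0 <= x + 1 by rewrite addr_ge0.
have [||y /andP[y0 _] /rootP] := @poly_ivt R ('X^(a.+1) - x%:P) 0 (x + 1).
- exact: x1.
- rewrite !hornerE expr0n /= sub0r oppr_le0 x0 /= subr_ge0.
  have h1 : 1 <= x + 1 by rewrite lerDr.
  by rewrite exprS (le_trans (y := x + 1)) ?lerDl// ler_peMr ?exprn_ege1.
by rewrite !hornerE => /eqP; rewrite subr_eq0 => /eqP yx; exists y.
Qed.

(* Killing the coordinates one after the other: a vector with prescribed sign
   at [a] and zero before is rescaled by a small [nu] and added many times, so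
   that its effect on the coordinates past [a] is negligible. *)
Lemma cone_elimination (R : realType) (s : nat) (P : (nat -> R) -> Prop)
    (Padd : forall k l, P k -> P l -> P (fun a => k a + l a))
    (Pscale : forall k (nu : R), 0 <= nu -> P k -> P (fun a => nu ^+ a.+1 * k a))
    (Ppos : forall a, (0 < a < s)%N -> exists2 k, P k & 0 < k a)
    (Pneg : forall a, (0 < a < s)%N -> exists2 k, P k & k a < 0)
    (a : nat) (k : nat -> R) (e : R) : P k -> 0 < e ->
  exists2 l, P l & (forall b, (0 < b <= a)%N -> (b < s)%N -> k b + l b = 0) /\
                   (forall b, (a < b < s)%N -> `|l b| <= e).
Proof.
have Pmul n k' : P k' -> P (fun b => n.+1%:R * k' b).
  elim: n => [|n IH] Pk'.
    by have := Pscale k' 1 ler01 Pk'; congr P; apply/funext => b; rewrite expr1n.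
  have := Padd _ _ Pk' (IH Pk'); congr P; apply/funext => b.
  by rewrite [in RHS]mulrSr mulrDl mul1r addrC.
elim: a k e => [|a IH] k e Pk e0.
  (* Scaling by zero provides the zero sequence. *)
  exists (fun b => 0 ^+ b.+1 * k b); first exact: Pscale.
  split => [b|b _]; first by case: b.
  by rewrite exprS !mul0r normr0 ltW.
have [sa|as_] := leqP s a.+1.
  have [l Pl [l1 l2]] := IH k e Pk e0.
  exists l => //; split=> b.
    move=> /andP[b0 ba] bs; apply: l1 => //; rewrite b0 /=; lia.
  by lia.
have e20 : 0 < e / 2 by rewrite divr_gt0.
have [l Pl [l1 l2]] := IH k _ Pk e20.
pose c := k a.+1 + l a.+1.
(* [U] vanishes on the coordinates already killed and has at [a.+1] the sign that can cancel [c].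
   Clearing its earlier coordinates with tolerance half of the value at [a.+1] does not destroy that
   sign. *)
have [U PU [U1 [U20 U2]]] : exists2 U, P U &
    (forall b, (0 < b <= a)%N -> (b < s)%N -> U b = 0) /\
    (U a.+1 != 0 /\ 0 <= - c / U a.+1).
  have [cle|cge] := leP c 0.
    have [B PB Ba] := Ppos a.+1 as_.
    have Ba' : 0 < B a.+1 / 2 by rewrite divr_gt0.
    have [B' PB' [B1 B2]] := IH B _ PB Ba'.
    exists (fun b => B b + B' b); first exact: Padd.
    split => //.
    have : `|B' a.+1| <= B a.+1 / 2 by apply: B2; rewrite ltnSn.
    move=> /ler_normlP[h _].
    have h2 : 0 < B a.+1 + B' a.+1 by lra.
    by split; [rewrite /= gt_eqF | rewrite divr_ge0 ?oppr_ge0 // ltW].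
  have [B PB Ba] := Pneg a.+1 as_.
  have Ba' : 0 < - B a.+1 / 2 by lra.
  have [B' PB' [B1 B2]] := IH B _ PB Ba'.
  exists (fun b => B b + B' b); first exact: Padd.
  split => //.
  have : `|B' a.+1| <= - B a.+1 / 2 by apply: B2; rewrite ltnSn.
  move=> /ler_normlP[h1 h].
  have h2 : B a.+1 + B' a.+1 < 0 by lra.
  split; first by rewrite /= lt_eqF.
  by rewrite mulNr -mulrN mulr_ge0 ?ltW // oppr_gt0 invr_lt0.
have [d d0 dE] : exists2 d, 0 <= d & d * U a.+1 = - c.
  by exists (- c / U a.+1); rewrite // divfK.
pose M := \sum_(b < s) `|U b| + 1.
have M0 : 0 < M by rewrite ltr_wpDl // sumr_ge0.
have MU b : (b < s)%N -> `|U b| <= M.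
  move=> bs; rewrite /M (bigD1 (Ordinal bs)) //= -addrA lerDl addr_ge0 //.
  by rewrite sumr_ge0.
pose dl := Num.min 1 (e / 2 / ((d + 1) * M)).
have d10 : 0 < d + 1 by rewrite ltr_wpDl.
have dl0 : 0 < dl.
  by rewrite lt_min ltr01 /= divr_gt0 // mulr_gt0.
have dln0 : 0 < dl ^+ a.+2 by rewrite exprn_gt0.
have [n nP] : exists n : nat, d / dl ^+ a.+2 < n.+1%:R.
  exists (Num.Def.truncn (d / dl ^+ a.+2)).
  by rewrite truncnS_gt.
(* [n.+1] copies of [U] scaled by [nu] contribute exactly [d * U a.+1 = - c] at [a.+1]. Past it they
   carry a further power of [nu], and [nu] is at most [dl] because [n] is large. *)
have [nu nu0 nuE] := @exists_root R a.+1 (d / n.+1%:R) (divr_ge0 d0 (ler0n _ _)).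
have nule : nu <= dl.
  rewrite -(@ler_pXn2r _ a.+2) ?nnegrE ?(ltW dl0) // nuE.
  rewrite ler_pdivrMr ?ltr0Sn // mulrC -ler_pdivrMr // ltW //.
exists (fun b => l b + n.+1%:R * (nu ^+ b.+1 * U b)).
  by apply: Padd => //; apply: (Pmul n (fun b => nu ^+ b.+1 * U b)); exact: Pscale.
have nuE' : n.+1%:R * nu ^+ a.+2 = d.
  by rewrite nuE mulrC divfK // pnatr_eq0.
split => b.
  move=> /andP[b0]; rewrite leq_eqVlt => /orP[/eqP -> _|ba bs].
    by rewrite addrA mulrA nuE' dE -/c subrr.
  have b1 : (0 < b <= a)%N by rewrite b0.
  by rewrite U1 // !mulr0 addr0 l1.
move=> /andP[ab bs].
have -> : n.+1%:R * (nu ^+ b.+1 * U b) = d * (nu ^+ (b - a.+1) * U b).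
  have -> : b.+1 = (a.+2 + (b - a.+1))%N by rewrite addSn subnKC // ltnW.
  by rewrite exprD -nuE' !mulrA.
rewrite (le_trans (ler_normD _ _)) // (splitr e) lerD ?l2 //; first by rewrite bs ltnW.
rewrite !normrM (ger0_norm d0) (ger0_norm (exprn_ge0 _ nu0)).
have h1 : nu ^+ (b - a.+1) <= e / 2 / ((d + 1) * M).
  have h2 : nu <= e / 2 / ((d + 1) * M) by rewrite (le_trans nule) // ge_min lexx orbT.
  apply: le_trans h2; rewrite -(subnSK ab) exprS ler_piMr // exprn_ile1 //.
  by rewrite (le_trans nule) // ge_min lexx.
rewrite (le_trans (y := d * (e / 2 / ((d + 1) * M) * M))) //.
  rewrite ler_wpM2l // ler_pM ?exprn_ge0 ?MU //.
have -> : d * (e / 2 / ((d + 1) * M) * M) = e / 2 * (d / (d + 1)).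
  by field; rewrite !gt_eqF.
by rewrite ler_piMr ?(ltW e20) // ler_pdivrMr // mul1r lerDl.
Qed.

(** * Moments and cumulants of finite lists *)

Definition texp (R : realType) (T : nat) (a : R) : {poly R} :=
  \poly_(k < T) (a ^+ k / k`!%:R).

(** The truncated moment generating function of a uniformly drawn entry of [L]: lists with
    repetitions stand for random variables. *)
Definition mgf (R : realType) (T : nat) (L : seq R) : {poly R} :=
  (size L)%:R^-1 *: \sum_(x <- L) texp T x.

(* [K] is the derivative of [log F], truncated. *)
Definition is_cumulant_gf (R : realType) (T : nat) (F K : {poly R}) :=
  forall i, (i.+1 < T)%N -> (F^`())`_i = (K * F)`_i.

Lemma coefM_eq (R : nzRingType) (T : nat) (p q r : {poly R}) :
  (forall j, (j < T)%N -> p`_j = q`_j) ->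
  forall i, (i < T)%N -> (p * r)`_i = (q * r)`_i.
Proof.
move=> pq i iT; rewrite !coefM; apply: eq_bigr => j _; rewrite pq //.
by rewrite (leq_ltn_trans _ iT) // -ltnS.
Qed.

Lemma texpD (R : realType) (T : nat) (a b : R) (i : nat) :
  (i < T)%N -> (texp T a * texp T b)`_i = (texp T (a + b))`_i.
Proof.
move=> iT; rewrite coefM coef_poly iT addrC exprDn mulr_suml.
apply: eq_bigr => j _; have ji : (j <= i)%N by rewrite -ltnS.
rewrite !coef_poly (leq_ltn_trans ji iT) (leq_ltn_trans (leq_subr _ _) iT).
have /(congr1 (fun n => n%:R : R)) := bin_fact ji.
rewrite !natrM => <-.
have h m : m`!%:R != 0 :> R by rewrite pnatr_eq0 -lt0n fact_gt0.
have hb : 'C(i, j)%:R != 0 :> R by rewrite pnatr_eq0 -lt0n bin_gt0.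
by rewrite -mulr_natr; field; rewrite !h hb.
Qed.

Lemma coef_mgf (R : realType) (T : nat) (L : seq R) (i : nat) :
  (i < T)%N -> (mgf T L)`_i = (size L)%:R^-1 * ((\sum_(x <- L) x ^+ i) / i`!%:R).
Proof.
move=> iT; rewrite coefZ coef_sum mulr_suml; congr (_ * _).
by apply: eq_bigr => x _; rewrite coef_poly iT.
Qed.

(** The list of pairwise sums represents the sum of two independent variables. *)
Lemma mgf_allpairs (R : realType) (T : nat) (L M : seq R) (i : nat) :
  (i < T)%N -> (mgf T [seq x + y | x <- L, y <- M])`_i = (mgf T L * mgf T M)`_i.
Proof.
move=> iT; rewrite /mgf size_allpairs natrM invfM -scalerAl -scalerAr scalerA.
rewrite !coefZ; congr (_ * _).
rewrite big_allpairs_dep mulr_suml !coef_sum; apply: eq_bigr => x _.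
by rewrite mulr_sumr !coef_sum; apply: eq_bigr => y _; rewrite texpD.
Qed.

Lemma coef0_mgf (R : realType) (T : nat) (L : seq R) :
  (0 < T)%N -> (0 < size L)%N -> (mgf T L)`_0 = 1.
Proof.
move=> T0 L0; rewrite coef_mgf //.
under eq_bigr do rewrite expr0.
rewrite big_const_seq count_predT -[iter _ _ _]/(iter (size L) (+%R 1) 0) -Monoid.iteropE /=.
by rewrite fact0 divr1 mulVf // pnatr_eq0 -lt0n.
Qed.

(** A logarithmic derivative turns products into sums, so cumulants of independent variables add.
    [H] agrees with [F * G] only below [T], since a product of truncated series has further
    terms. *)
Lemma is_cumulant_gfM (R : realType) (T : nat) (F G H K K' : {poly R}) :
  is_cumulant_gf T F K -> is_cumulant_gf T G K' ->
  (forall i, (i < T)%N -> H`_i = (F * G)`_i) -> is_cumulant_gf T H (K + K').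
Proof.
move=> FK GK HFG i iT.
have -> : ((K + K') * H)`_i = ((K + K') * (F * G))`_i.
  by rewrite mulrC (coefM_eq _ HFG) ?(ltnW iT) // mulrC.
rewrite coef_deriv HFG // -coef_deriv derivM coefD.
rewrite (@coefM_eq _ i.+1 F^`() (K * F)) // => [|j ji]; last first.
  by rewrite FK // (leq_ltn_trans ji).
rewrite [F * _]mulrC (@coefM_eq _ i.+1 G^`() (K' * G)) // => [|j ji]; last first.
  by rewrite GK // (leq_ltn_trans ji).
have -> : (K + K') * (F * G) = K * F * G + K' * G * F by ring.
by rewrite coefD.
Qed.

Lemma is_cumulant_gf_scale (R : realType) (T : nat) (L : seq R) (c : R)
    (K : {poly R}) :
  is_cumulant_gf T (mgf T L) K ->
  is_cumulant_gf T (mgf T [seq c * x | x <- L]) (\poly_(j < T) (c ^+ j.+1 * K`_j)).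
Proof.
move=> LK i iT.
have E j : (j < T)%N -> (mgf T [seq c * x | x <- L])`_j = c ^+ j * (mgf T L)`_j.
  move=> jT; rewrite !coef_mgf // size_map big_map.
  under eq_bigr do rewrite exprMn.
  by rewrite -mulr_sumr; ring.
rewrite coef_deriv E // -mulrnAr -coef_deriv LK // !coefM mulr_sumr.
apply: eq_bigr => j _; have ji : (j <= i)%N by rewrite -ltnS.
rewrite coef_poly (leq_ltn_trans ji (ltnW iT)).
rewrite E ?(leq_ltn_trans (leq_subr _ _) (ltnW iT)) //.
have -> : c ^+ i.+1 = c ^+ j.+1 * c ^+ (i - j) by rewrite -exprD addSn subnKC.
by ring.
Qed.

(* [(bcum n).[p]] is the cumulant of order [n + 1] of a Bernoulli variable. *)
Fixpoint bcum (R : realType) (n : nat) : {poly R} :=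
  if n is n'.+1 then ('X - 'X ^+ 2) * (bcum R n')^`() else 'X.

(** This is F' = K F read off coefficientwise for F = 1 - p + p e^X. The proof goes from the
    differential recursion of [bcum] to it by induction, with Pascal's rule. *)
Lemma bcum_rec (R : realType) (i : nat) :
  bcum R i = 'X * (1 - \sum_(j < i) 'C(i, j)%:R * bcum R j).
Proof.
elim: i => [|i IH]; first by rewrite big_ord0 subr0 mulr1.
pose S := \sum_(j < i) 'C(i, j)%:R * bcum R j.
pose S' := \sum_(j < i) 'C(i, j)%:R * bcum R j.+1.
have E1 : bcum R i.+1 = (1 - 'X) * bcum R i - 'X * S'.
  rewrite /= {1}IH -/S derivM derivX mul1r derivB derivC sub0r.
  have -> : S' = ('X - 'X^2) * S^`().
    rewrite /S raddf_sum /= mulr_sumr; apply: eq_bigr => j _ /=.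
    by rewrite derivM -polyC_natr derivC mul0r add0r; ring.
  rewrite IH -/S; ring.
have -> : \sum_(j < i.+1) 'C(i.+1, j)%:R * bcum R j = S + bcum R i + S'.
  rewrite big_ord_recl /= bin0 mul1r.
  under eq_bigr do rewrite /bump /= add1n binS natrD mulrDl.
  rewrite big_split /= /S'.
  have -> : S + bcum R i = bcum R 0 + \sum_(j < i) 'C(i, j.+1)%:R * bcum R j.+1.
    have -> : bcum R i = 'C(i, i)%:R * bcum R i by rewrite binn mul1r.
    rewrite /S -(big_ord_recr i (fun j => 'C(i, j)%:R * bcum R j)) big_ord_recl.
    by rewrite bin0 mul1r.
  by rewrite -addrA.
by rewrite E1; rewrite {1}IH -/S {1}IH -/S; ring.
Qed.

Lemma bcum_horner (R : realType) (i : nat) (p : R) :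
  (bcum R i).[p] + p * (\sum_(j < i) 'C(i, j)%:R * (bcum R j).[p]) = p.
Proof.
rewrite {1}bcum_rec hornerM hornerX hornerD hornerN hornerC horner_sum.
under eq_bigr do rewrite hornerM -polyC_natr hornerC.
by rewrite mulrBr mulr1 subrK.
Qed.

Definition bernoulli_list (R : realType) (k m : nat) : seq R :=
  nseq k 1 ++ nseq (m - k) 0.

Lemma is_cumulant_gf_bernoulli (R : realType) (T k m : nat) :
  (k <= m)%N -> (0 < m)%N ->
  is_cumulant_gf T (mgf T (bernoulli_list R k m))
    (\poly_(j < T) ((bcum R j).[k%:R / m%:R] / j`!%:R)).
Proof.
move=> km m0 i iT; set p := k%:R / m%:R.
have fN n : n`!%:R != 0 :> R by rewrite pnatr_eq0 -lt0n fact_gt0.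
have sz : size (bernoulli_list R k m) = m.
  by rewrite size_cat !size_nseq subnKC.
have F0 : (mgf T (bernoulli_list R k m))`_0 = 1.
  by rewrite coef0_mgf ?sz // (leq_trans _ iT).
have FS j : (j.+1 < T)%N ->
    (mgf T (bernoulli_list R k m))`_j.+1 = p / j.+1`!%:R.
  move=> jT; rewrite coef_mgf // sz big_cat /= !big_nseq.
  by rewrite expr1n expr0n /= !iter_addr_0 mul0rn addr0 /p; ring.
rewrite coef_deriv FS // coefM big_ord_recr /= subnn F0 mulr1.
rewrite coef_poly (ltnW iT).
have -> : \sum_(j < i) (\poly_(j < T) ((bcum R j).[p] / j`!%:R))`_j *
      (mgf T (bernoulli_list R k m))`_(i - j) =
    p * (\sum_(j < i) 'C(i, j)%:R * (bcum R j).[p]) / i`!%:R.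
  rewrite mulr_sumr mulr_suml; apply: eq_bigr => j _.
  have ji : (j < i)%N by [].
  rewrite coef_poly (ltn_trans ji (ltnW iT)) -(subnSK ji) FS; last first.
    by rewrite (subnSK ji) (leq_ltn_trans (leq_subr _ _)) // ltnW.
  rewrite (subnSK ji) -(bin_fact (ltnW ji)) !natrM.
  have hb : 'C(i, j)%:R != 0 :> R by rewrite pnatr_eq0 -lt0n bin_gt0 ltnW.
  by field; rewrite !fN hb.
rewrite -[X in X = _]mulr_natr factS natrM.
have -> : p / (i.+1%:R * i`!%:R) * i.+1%:R = p / i`!%:R :> R.
  have : i.+1%:R != 0 :> R by rewrite pnatr_eq0.
  by move: (i.+1%:R : R) => a a0; field; rewrite fN a0.
by rewrite -[in LHS](bcum_horner i p); ring.
Qed.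

(* The cumulants of odd order vanish, and that of order [2a + 2] is
   [(2a + 1)! k a]. Lists of length [2 ^ b] can be indexed by a finite field. *)
Definition even_cumulants (R : realType) (T : nat) (k : nat -> R) :=
  exists b (L : seq R) (K : {poly R}), [/\ size L = (2 ^ b)%N,
    is_cumulant_gf T (mgf T L) K,
    forall j, (j < T)%N -> K`_j = if odd j then k j./2 else 0 & 0 <= k 0%N].

Lemma even_cumulantsD (R : realType) (T : nat) (k l : nat -> R) :
  even_cumulants T k -> even_cumulants T l ->
  even_cumulants T (fun a => k a + l a).
Proof.
move=> [b [L [K [sL LK Kk k0]]]] [b' [L' [K' [sL' LK' Kl l0]]]].
exists (b + b')%N, [seq x + y | x <- L, y <- L'], (K + K'); split.
- by rewrite size_allpairs sL sL' expnD.
- by apply: is_cumulant_gfM LK LK' _ => i iT; exact: mgf_allpairs.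
- by move=> j jT; rewrite coefD Kk // Kl //; case: ifP => // _; rewrite addr0.
- exact: addr_ge0.
Qed.

Lemma even_cumulants_scale (R : realType) (T : nat) (k : nat -> R) (nu : R) :
  0 <= nu -> even_cumulants T k -> even_cumulants T (fun a => nu ^+ a.+1 * k a).
Proof.
(* Multiplying the variable by [c] multiplies the cumulant of order 2a + 2 by c^(2a+2) =
   nu^(a+1). *)
move=> nu0 [b [L [K [sL LK Kk k0]]]]; pose c := Num.sqrt nu.
exists b, [seq c * x | x <- L], (\poly_(j < T) (c ^+ j.+1 * K`_j)); split.
- by rewrite size_map.
- exact: is_cumulant_gf_scale.
- move=> j jT; rewrite coef_poly jT Kk //; case: ifPn => // jo; last exact: mulr0.
  rewrite -{1}(odd_double_half j) jo add1n -doubleS -mul2n exprM sqr_sqrtr //.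
- by rewrite mulr_ge0 ?exprn_ge0.
Qed.

(** In the difference of two independent copies the cumulants of odd order cancel and those of even
    order double. *)
Lemma even_cumulants_bernoulli (R : realType) (T k b : nat) :
  (k <= 2 ^ b)%N ->
  even_cumulants T (fun a => 2 * (bcum R a.*2.+1).[k%:R / (2 ^ b)%:R] / a.*2.+1`!%:R).
Proof.
move=> kb; set p := k%:R / (2 ^ b)%:R.
have b0 : (0 < 2 ^ b)%N by rewrite expn_gt0.
have B := @is_cumulant_gf_bernoulli R T k _ kb b0.
have B' := is_cumulant_gf_scale (-1) B.
have sB : size (bernoulli_list R k (2 ^ b)) = (2 ^ b)%N.
  by rewrite size_cat !size_nseq subnKC.
have BB' := is_cumulant_gfM B B' (fun i => @mgf_allpairs R T _ _ i).
exists (b + b)%N; do 2 eexists; split; [|exact: BB'| |].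
- by rewrite size_allpairs size_map sB expnD.
- move=> j jT; rewrite coefD !coef_poly jT -/p.
  rewrite -signr_odd oddS; case: ifPn => jo.
    have <- : j = j./2.*2.+1 by rewrite -{1}(odd_double_half j) jo.
    by rewrite [~~ true]/= expr0; ring.
  by rewrite [~~ false]/= expr1; ring.
- have p0 : 0 <= p by rewrite divr_ge0.
  have p1 : p <= 1 by rewrite ler_pdivrMr ?ltr0n // mul1r ler_nat.
  rewrite double0 /= derivX mulr1 !hornerE.
  by rewrite divr_ge0 // mulr_ge0 // subr_ge0 expr2 ler_piMl.
Qed.

Lemma bcum_at01 (R : realType) (n : nat) : (0 < n)%N ->
  [/\ (bcum R n).[0] = 0, (bcum R n).[1] = 0 & (bcum R n)^`().[0] = 1].
Proof.
case: n => // n _; have h : (bcum R n)^`().[0] = 1.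
  elim: n => [|n IH] /=; first by rewrite derivX !hornerE.
  by rewrite derivM !poly.derivE !hornerE IH; ring.
by split; rewrite /= ?derivM ?poly.derivE !hornerE ?h; ring.
Qed.

(** The parameter of a Bernoulli variable has to be dyadic for its list to have length a power of
    two. *)
Lemma dyadic_near (R : realType) (p : {poly R}) (x : R) :
  0 < x < 1 -> 0 < p.[x] ->
  exists k b, (k <= 2 ^ b)%N /\ 0 < p.[k%:R / (2 ^ b)%:R].
Proof.
move=> /andP[x0 x1] px; have [d d0 dP] := poly_cont x p px.
pose b := (Num.Def.truncn d^-1).+1.
have b0 : (0 : R) < (2 ^ b)%:R by rewrite ltr0n expn_gt0.
have bd : ((2 ^ b)%:R : R)^-1 < d.
  rewrite invf_plt ?posrE // (lt_trans (truncnS_gt _)) // ltr_nat.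
  exact: ltn_expl.
pose k := Num.Def.truncn (x * (2 ^ b)%:R).
have /andP[k1 k2] : (k%:R <= x * (2 ^ b)%:R < k.+1%:R).
  by apply: truncn_itv; rewrite mulr_ge0 // ltW.
exists k, b; split.
  rewrite -(ler_nat R) (le_trans k1) // ler_piMl // ltW //.
have : `|k%:R / (2 ^ b)%:R - x| < d.
  rewrite distrC ger0_norm; last by rewrite subr_ge0 ler_pdivrMr.
  apply: lt_trans bd; rewrite ltrBlDr -[X in X + _]mul1r -mulrDl ltr_pdivlMr //.
  by rewrite nat1r.
by move=> /dP /ltr_normlP [h _]; move: h; rewrite opprB ltrBlDr ltrDl.
Qed.

(** [bcum R n] vanishes at 0 and 1 and increases at 0, so its derivative is positive near 0 and, by
    the mean value theorem, negative somewhere later. Multiplying by the positive factor x - x^2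
    gives the next cumulant, with both signs. *)
Lemma bcum_signs (R : realType) (n : nat) : (0 < n)%N ->
  (exists2 x : R, 0 < x < 1 & 0 < (bcum R n.+1).[x]) /\
  (exists2 x : R, 0 < x < 1 & (bcum R n.+1).[x] < 0).
Proof.
move=> n0; have [p0 p1 p'0] := bcum_at01 R n0.
have q01 x : 0 < x < 1 -> (0 : R) < x - x ^+ 2.
  by move=> /andP[x0 x1]; rewrite subr_gt0 expr2 gtr_pMl.
have [d d0 dP] := poly_cont 0 (bcum R n)^`() (@ltr01 R).
have p'pos x : 0 < x -> x < d -> 0 < (bcum R n)^`().[x].
  move=> x0 xd; have : `|x - 0| < d by rewrite subr0 gtr0_norm.
  by move=> /dP /ltr_normlP [h _]; move: h; rewrite p'0; lra.
pose x : R := Num.min (d / 2) 2^-1.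
have x01 : 0 < x < 1.
  rewrite lt_min divr_gt0 // invr_gt0 ltr0n /= gt_min invf_lt1 // ltr1n orbT //.
have /andP[x0 x1] := x01.
have xd : x < d by rewrite gt_min ltr_pdivrMr // ltr_pMr // ltr1n.
split.
  by exists x => //=; rewrite !hornerE mulr_gt0 ?q01 ?p'pos.
have [c /itvP cI] := poly_mvt (bcum R n) x0; rewrite p0 !subr0 => cE.
have px : 0 < (bcum R n).[x].
  rewrite cE mulr_gt0 // p'pos ?cI // (lt_trans _ xd) // cI //.
have [e /itvP eI] := poly_mvt (bcum R n) x1; rewrite p1 sub0r => eE.
have e01 : 0 < e < 1 by rewrite (lt_trans x0) ?eI.
exists e => //=; rewrite !hornerE nmulr_llt0 ?q01 //.
have : (bcum R n)^`().[e] * (1 - x) < 0 by rewrite -eE oppr_lt0.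
by rewrite pmulr_llt0 // subr_gt0.
Qed.

Lemma even_cumulants_signs (R : realType) (T a : nat) : (0 < a)%N ->
  (exists2 k : nat -> R, even_cumulants T k & 0 < k a) /\
  (exists2 k : nat -> R, even_cumulants T k & k a < 0).
Proof.
move=> a0; have a20 : (0 < a.*2)%N by rewrite double_gt0.
have f0 : 0 < (a.*2.+1)`!%:R :> R by rewrite ltr0n fact_gt0.
have [[x x01 px] [y y01 py]] := bcum_signs R a20.
split.
  have [k [b [kb kP]]] := dyadic_near x01 px.
  eexists; first exact: (even_cumulants_bernoulli R T kb).
  by rewrite /= divr_gt0 // mulr_gt0.
have py' : 0 < (- bcum R a.*2.+1).[y] by rewrite hornerN oppr_gt0.
have [k [b [kb kP]]] := dyadic_near y01 py'.
eexists; first exact: (even_cumulants_bernoulli R T kb).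
rewrite /= pmulr_llt0 ?invr_gt0 // pmulr_rlt0 // -oppr_gt0 -hornerN.
exact: kP.
Qed.

(** The cumulants of a symmetrized fair coin of orders 4 to 2s are eliminated, which leaves the
    series of a Gaussian. Adding further variables cannot make the variance vanish, which is what
    the last clause of [even_cumulants] records. *)
Lemma gaussian_list (R : realType) (s : nat) : exists b (L : seq R) (v : R),
  [/\ size L = (2 ^ b)%N, 0 < v &
    is_cumulant_gf s.*2.+1 (mgf s.*2.+1 L) (v *: 'X)].
Proof.
pose T := s.*2.+1; pose P := @even_cumulants R T.
have k12 : (1 <= 2 ^ 1)%N by [].
have Pk := even_cumulants_bernoulli R T k12; set k := (X in even_cumulants T X) in Pk.
have k0 : 0 < k 0%N.
  rewrite /k double0 /= derivX mulr1 !hornerE expn1 (_ : 1`! = 1%N) //; lra.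
(* Elimination is carried through to the index [s], so no coordinate is left for the tolerance, and
   1 is as good as any. *)
have [l Pl [lP _]] := cone_elimination (@even_cumulantsD R T)
  (fun k nu nu0 => @even_cumulants_scale R T k nu nu0)
  (fun a h => (even_cumulants_signs R T (proj1 (andP h))).1)
  (fun a (h : (0 < a < s)%N) => (even_cumulants_signs R T (proj1 (andP h))).2) s Pk ltr01.
have l0 : 0 <= l 0%N by case: Pl => b [L [K []]].
have [b [L [K [sL LK Kkl _]]]] := even_cumulantsD Pk Pl.
exists b, L, (k 0%N + l 0%N); split => //; first by rewrite ltr_wpDr.
move=> i iT; rewrite LK //; apply: coefM_eq (ltnW iT) => j jT.
rewrite Kkl // coefZ coefX; case: j jT => [|[|j]] jT /=; rewrite ?mulr0 ?mulr1 //.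
rewrite negbK; case: ifP => // jo.
have h : (j./2.+1 < s)%N.
  move: jT; rewrite /T -[X in (X.+2 < _)%N -> _]odd_double_half jo add1n ltnS.
  by rewrite -[(j./2.+1 < s)%N]ltn_double doubleS.
by apply: (lP j./2.+1 (ltnW h) h).
Qed.

Lemma coef_texp_sum (R : realType) (T n : nat) (a : 'I_n -> R) (i : nat) :
  (i < T)%N -> (\prod_(j < n) texp T (a j))`_i = (texp T (\sum_(j < n) a j))`_i.
Proof.
elim: n a i => [|n IH] a i iT.
  by rewrite !big_ord0 coef1 coef_poly iT expr0n; case: i iT => [|i] _; rewrite /= ?fact0 ?divr1 ?mul0r.
rewrite !big_ord_recl mulrC (coefM_eq _ (IH (fun j => a (lift ord0 j)))) //.
by rewrite mulrC texpD.
Qed.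

Lemma is_cumulant_gf_prod (R : realType) (T n : nat) (F K : 'I_n -> {poly R}) :
  (forall i, is_cumulant_gf T (F i) (K i)) ->
  is_cumulant_gf T (\prod_(i < n) F i) (\sum_(i < n) K i).
Proof.
elim: n F K => [|n IH] F K FK.
  by rewrite !big_ord0 => i _; rewrite derivC mul0r.
rewrite !big_ord_recl; apply: is_cumulant_gfM (FK _) _ _; last by [].
by apply: (IH (fun i => F (lift ord0 i)) (fun i => K (lift ord0 i))).
Qed.

(** F' = v X F links the coefficients of order 2a + 2 and 2a, as for exp(v X^2 / 2). *)
Lemma gaussian_gf_coef (R : realType) (s : nat) (F : {poly R}) (v : R) :
  F`_0 = 1 -> is_cumulant_gf s.*2.+1 F (v *: 'X) ->
  forall a, (a <= s)%N -> F`_a.*2 = v ^+ a / (2 ^+ a * a`!%:R).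
Proof.
move=> F0 FK; elim=> [|a IH] as_; first by rewrite double0 F0 fact0 !expr0; field.
have := FK a.*2.+1; rewrite ltnS -doubleS leq_double as_ => /(_ isT).
rewrite coef_deriv -scalerAl coefZ coefXM /= IH ?(ltnW as_) //.
have fN : a`!%:R != 0 :> R by rewrite pnatr_eq0 -lt0n fact_gt0.
have a1N : a.+1%:R != 0 :> R by rewrite pnatr_eq0.
rewrite doubleS => E.
have -> : F`_a.*2.+2 = (F`_a.*2.+2 *+ a.*2.+2) / a.*2.+2%:R.
  by rewrite -[X in _ = X / _]mulr_natr mulfK // pnatr_eq0.
rewrite E -doubleS -mul2n natrM factS natrM !exprS.
move: (a.+1%:R) a1N => c c0.
field.
by rewrite fN c0 expf_neq0 // pnatr_eq0.
Qed.

(** A sum of independent variables x_i Y_i, each Gaussian up to order 2s, is Gaussian up to that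
    order with variance v |x|^2. Hence its moment of order 2s is the Gaussian one, which depends on
    x only through |x|; the factor with exponent [n] counts the words [w]. *)
Lemma gaussian_power_sum (R : realType) (s : nat) (F : finType) (psi : F -> R)
    (v : R) :
  (0 < #|F|)%N ->
  is_cumulant_gf s.*2.+1 (mgf s.*2.+1 [seq psi a | a <- enum F]) (v *: 'X) ->
  forall n (x : 'I_n -> R),
  \sum_(w : {ffun 'I_n -> F}) (\sum_(i < n) x i * psi (w i)) ^+ s.*2 =
  #|F|%:R ^+ n * (s.*2`!%:R * v ^+ s / (2 ^+ s * s`!%:R)) *
    (\sum_(i < n) x i ^+ 2) ^+ s.
Proof.
set T := s.*2.+1; set L := [seq psi a | a <- enum F] => F0 LK n x.
have sL : size L = #|F| by rewrite size_map -cardT.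
pose G i := mgf T [seq x i * y | y <- L].
pose P := \prod_(i < n) G i.
have G0 i : (G i)`_0 = 1 by rewrite coef0_mgf // size_map sL.
have P0 : P`_0 = 1.
  rewrite -horner_coef0 horner_prod big1 // => i _.
  by rewrite horner_coef0 G0.
have PK : is_cumulant_gf T P ((v * \sum_(i < n) x i ^+ 2) *: 'X).
  have := is_cumulant_gf_prod (fun i => is_cumulant_gf_scale (x i) LK).
  move=> h i iT; rewrite h //; apply: coefM_eq (ltnW iT) => j jT.
  rewrite coef_sum mulr_sumr coefZ coefX mulr_suml; apply: eq_bigr => k _.
  rewrite coef_poly jT coefZ coefX; case: j jT => [|[|j]] _ /=; rewrite ?mulr0 //.
  by ring.
have := gaussian_gf_coef P0 PK (leqnn s).
have -> : P`_s.*2 = #|F|%:R ^- n *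
    ((\sum_(w : {ffun 'I_n -> F}) (\sum_(i < n) x i * psi (w i)) ^+ s.*2) / s.*2`!%:R).
  have GE i : G i = #|F|%:R^-1 *: \sum_(a : F) texp T (x i * psi a).
    by rewrite /G /mgf size_map sL /L 2!big_map big_enum.
  rewrite /P; under eq_bigr do rewrite GE.
  rewrite scaler_prod prodr_const card_ord exprVn coefZ; congr (_ * _).
  rewrite bigA_distr_bigA /= coef_sum mulr_suml; apply: eq_bigr => w _.
  by rewrite coef_texp_sum // coef_poly leqnn.
have fN : s.*2`!%:R != 0 :> R by rewrite pnatr_eq0 -lt0n fact_gt0.
have fN' : s`!%:R != 0 :> R by rewrite pnatr_eq0 -lt0n fact_gt0.
have cN : #|F|%:R ^+ n != 0 :> R by rewrite expf_neq0 // pnatr_eq0 -lt0n.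
set S := \sum_(w : _) _ => E.
have -> : S = (#|F|%:R ^- n * (S / s.*2`!%:R)) * s.*2`!%:R * #|F|%:R ^+ n.
  by field; rewrite fN cN.
rewrite E exprMn; field.
by rewrite fN' expf_neq0 // pnatr_eq0.
Qed.

(* Gilbert-Varshamov: each choice has fewer than [#|F| ^ u] vectors to avoid. *)
Lemma greedy_independent (F : finFieldType) (n tau u : nat) :
  ((n * #|F|) ^ tau < #|F| ^ u)%N ->
  exists h : nat -> 'rV[F]_u, forall i, (i < n)%N ->
  forall (g : {ffun 'I_tau -> 'I_n}) (c : {ffun 'I_tau -> F}),
    h i != \sum_k c k *: (if (g k < i)%N then h (g k) else 0).
Proof.
move=> lt_u.
suff [h hP] : exists h : nat -> 'rV[F]_u, forall i, (i < n)%N -> (i < n)%N ->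
  forall (g : {ffun 'I_tau -> 'I_n}) (c : {ffun 'I_tau -> F}),
    h i != \sum_k c k *: (if (g k < i)%N then h (g k) else 0).
  by exists h => i iltn; exact: hP.
elim: {1}n => [|m [h hP]]; first by exists (fun => 0).
pose X := ({ffun 'I_tau -> 'I_n} * {ffun 'I_tau -> F})%type.
pose q (p : X) := \sum_k p.2 k *: (if (p.1 k < m)%N then h (p.1 k) else 0).
have [v vP] : exists v, v \notin [set q p | p in [set: X]].
  apply/existsP; rewrite -negb_forall; apply/negP => /forallP all_q.
  have : (#|[set: 'rV[F]_u]| <= #|[set q p | p in [set: X]]|)%N.
    by apply: subset_leq_card; apply/fintype.subsetP => v _; exact: all_q.
  move=> /leq_trans /(_ (leq_imset_card _ _)).
  rewrite !cardsT card_mx mul1n card_prod !card_ffun !card_ord -expnMn.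
  by rewrite leqNgt lt_u.
exists (fun i => if i == m then v else h i) => i im iltn g c.
have E (k : 'I_tau) : (g k < i)%N -> (g k == m :> nat) = false.
  by move=> gk; apply/negbTE; rewrite neq_ltn (leq_trans gk).
have -> : \sum_k c k *: (if (g k < i)%N then if g k == m :> nat then v else h (g k) else 0) =
   \sum_k c k *: (if (g k < i)%N then h (g k) else 0).
  by apply: eq_bigr => k _; case: ifP => // /E ->.
case: (i =P m) => [im'|/eqP im']; last first.
  have im2 : (i < m)%N by rewrite ltn_neqAle im' -ltnS.
  exact: hP.
apply: contra vP => /eqP ->; apply/imsetP; exists (g, c) => //.
by rewrite /q im'.
Qed.

(** Any [tau.+1] of the vectors are linearly independent, since the last of them is no combination
    of [tau] earlier ones. After interpolation at the others, the value at the last index [i0] is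
    corrected along a vector [y] orthogonal to all the others but not to [h i0]. *)
Lemma independent_interpolation (F : finFieldType) (n tau u : nat)
    (h : nat -> 'rV[F]_u) :
  (forall i, (i < n)%N -> forall (g : {ffun 'I_tau -> 'I_n}) (c : {ffun 'I_tau -> F}),
    h i != \sum_k c k *: (if (g k < i)%N then h (g k) else 0)) ->
  forall T : {set 'I_n}, (#|T| <= tau.+1)%N ->
  forall w : 'I_n -> F, exists z : 'cV[F]_u,
    forall i, i \in T -> (h i *m z) 0 0 = w i.
Proof.
move=> hP T; move: {2}#|T| (leqnn #|T|) => m; elim: m T => [|m IH] T Tm Tt w.
  exists 0 => i iT; move: Tm; rewrite leqn0 cards_eq0 => /eqP T0.
  by rewrite T0 inE in iT.
have [->|[i0' i0'T]] := set_0Vmem T; first by exists 0 => i; rewrite inE.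
have [i0 i0T i0max] := @arg_maxnP _ i0' (mem T) (fun i => i) i0'T.
have {}i0T : i0 \in T by [].
have cT : #|T| = #|T :\ i0|.+1 by rewrite (cardsD1 i0) i0T.
have [||z zP] := IH (T :\ i0) _ _ w.
- by rewrite -ltnS -cT.
- by rewrite ltnW // -cT.
have i0n : (i0 < n)%N by [].
(* The default [i0] pads the enumeration: it is not below [i0], so it gives a zero row of [M]. *)
pose g := [ffun k : 'I_tau => nth i0 (enum (T :\ i0)) k].
pose M := \matrix_(k < tau) (if (g k < i0)%N then h (g k) else 0).
have [j jP] : exists j, (h i0 *m cokermx M) 0 j != 0.
  have : ~~ (h i0 <= M)%MS.
    apply/negP => /submxP [c cE]; have := hP _ i0n g [ffun k => c 0 k].
    rewrite cE mulmx_sum_row => /negP; apply; apply/eqP; apply: eq_bigr => k _.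
    by rewrite ffunE rowK.
  rewrite submxE => /eqP nz.
  have [j jP|z0] := pickP (fun j => (h i0 *m cokermx M) 0 j != 0); first by exists j.
  case: nz; apply/rowP => j; rewrite [RHS]mxE.
  by apply/eqP; have := z0 j; move/negbFE.
pose y := col j (cokermx M).
have hy i : (h i *m y) 0 0 = (h i *m cokermx M) 0 j by rewrite /y colE mulmxA -colE mxE.
have y0 i : i \in T -> i != i0 -> (h i *m y) 0 0 = 0.
  move=> iT ii0; have iT' : i \in enum (T :\ i0) by rewrite mem_enum !inE ii0.
  have kt : (index i (enum (T :\ i0)) < tau)%N.
    by rewrite (leq_trans (n := #|T :\ i0|)) // ?cardE ?index_mem // -cardE -ltnS -cT.
  have -> : h i = row (Ordinal kt) M.
    rewrite rowK ffunE /= nth_index // ltn_neqAle.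
    by have -> : (i <= i0)%N := i0max i iT; rewrite (inj_eq val_inj) ii0.
  by rewrite /y colE mulmxA -row_mul mulmx_coker row0 mul0mx mxE.
exists (z + ((w i0 - (h i0 *m z) 0 0) / (h i0 *m y) 0 0) *: y) => i iT.
have DE c : (h i *m (z + c *: y)) 0 0 = (h i *m z) 0 0 + c * (h i *m y) 0 0.
  by rewrite mulmxDr -scalemxAr [LHS]mxE [X in _ + X]mxE.
rewrite {}DE.
have [->|ii0] := eqVneq i i0; first by rewrite divfK ?hy // subrKC.
by rewrite (y0 i) // mulr0 addr0 zP // !inE ii0.
Qed.

(* If [phi] matches every [w] on the coordinates that [f] reads, then by
   translation the average of [prod_k psi (phi j (f k))] is the average over
   all functions. *)
Lemma independent_average (R : realType) (F : finFieldType) (n m u : nat)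
    (h : nat -> 'rV[F]_u) (psi : F -> R) (f : 'I_m -> 'I_n) :
  (forall w : 'I_n -> F, exists z : 'cV[F]_u,
    forall i, i \in [set f k | k : 'I_m] -> (h i *m z) 0 0 = w i) ->
  #|{: {ffun 'I_n -> F}}|%:R * (\sum_(z : 'cV[F]_u) \prod_(k < m) psi ((h (f k) *m z) 0 0)) =
  #|{: 'cV[F]_u}|%:R * (\sum_(w : {ffun 'I_n -> F}) \prod_(k < m) psi (w (f k))).
Proof.
move=> H.
have E (w : {ffun 'I_n -> F}) :
    \sum_(z : 'cV[F]_u) \prod_(k < m) psi ((h (f k) *m z) 0 0) =
    \sum_(z : 'cV[F]_u) \prod_(k < m) psi ((h (f k) *m z) 0 0 + w (f k)).
  have [zw zwP] := H w.
  rewrite (reindex_inj (addIr zw)) /=; apply: eq_bigr => z _; apply: eq_bigr => k _.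
  by rewrite mulmxDr mxE zwP // imset_f.
transitivity (\sum_(w : {ffun 'I_n -> F})
    \sum_(z : 'cV[F]_u) \prod_(k < m) psi ((h (f k) *m z) 0 0)).
  by rewrite sumr_const mulr_natl.
rewrite (eq_bigr _ (fun w _ => E w)).
rewrite exchange_big /= mulr_natl -sumr_const; apply: eq_bigr => z _.
pose wz := [ffun i : 'I_n => (h i *m z) 0 0].
rewrite [RHS](reindex_inj (addrI wz)) /=; apply: eq_bigr => w _.
by apply: eq_bigr => k _; rewrite !ffunE.
Qed.

Lemma hilbert_identity (R : realType) (s : nat) : exists C : nat,
  forall n : nat, (0 < n)%N -> exists (J : finType) (Y : J -> 'rV[R]_n) (kappa : R),
  [/\ (#|J| <= C * n ^ s.*2.-1)%N, 0 < kappa, exists j, Y j != 0 &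
  forall x : 'rV[R]_n, \sum_j (\sum_(i < n) x 0 i * Y j 0 i) ^+ s.*2 =
    kappa * (\sum_(i < n) x 0 i ^+ 2) ^+ s].
Proof.
case: s => [|s].
  exists 1%N => -[//|n] _; exists unit, (fun=> const_mx 1), 1; split => //.
  - by rewrite card_unit.
  - exists tt; apply/eqP => /matrixP /(_ 0 0); rewrite !mxE; apply/eqP.
    exact: oner_neq0.
  - by move=> x; rewrite big_const card_unit /= !expr0 addr0 mulr1.
have [b [L [v [sL v0 LK]]]] := gaussian_list R s.+1.
have [F F2 cF] := PrimePowerField (isT : prime 2) (ltn0Sn b).
(* [L] is doubled because a field has at least two elements. *)
pose psi (a : F) := nth 0 (L ++ L) (enum_rank a).
have psiE : [seq psi a | a <- enum F] = L ++ L.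
  apply: (@eq_from_nth _ 0).
    by rewrite size_map -cardT cF size_cat sL addnn expnS mul2n.
  move=> i; rewrite size_map -cardT => iF; rewrite (nth_map (enum_val (Ordinal iF))) -?cardT //.
  by rewrite /psi -(@enum_val_nth _ _ _ (Ordinal iF)) enum_valK.
pose Q := #|F|.
have Q2 : (1 < Q)%N by rewrite /Q cF -{1}(expn0 2) ltn_exp2l.
have psiK : is_cumulant_gf s.+1.*2.+1
    (mgf s.+1.*2.+1 [seq psi a | a <- enum F]) (v *: 'X).
  have szN : (size L)%:R != 0 :> R by rewrite sL pnatr_eq0 -lt0n expn_gt0.
  rewrite psiE; have -> // : mgf s.+1.*2.+1 (L ++ L) = mgf s.+1.*2.+1 L.
  rewrite /mgf big_cat /= size_cat natrD -mulr2n -[(\sum_(_ <- L) _) *+ 2]scaler_nat scalerA; congr (_ *: _).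
  by move: (_%:R) szN => c c0; field; rewrite -mulr2n mulrn_eq0 negb_or c0.
have P := gaussian_power_sum (ltnW Q2) psiK.
pose tau := s.+1.*2.-1.
exists (Q * Q ^ tau)%N => n n0.
(* [u] is the least exponent with (nQ)^tau < Q^u, hence Q^u is at most Q (nQ)^tau. This bounds the
   number of points by a constant times n^tau. *)
pose A := ((n * Q) ^ tau)%N; pose u := (trunc_log Q A).+1.
have A0 : (0 < A)%N by rewrite expn_gt0 muln_gt0 n0 (ltnW Q2).
have [h hP] := @greedy_independent F n tau u (trunc_log_ltn _ Q2).
have IP := independent_interpolation hP.
pose kappa := Q%:R ^+ u * ((s.+1.*2)`!%:R * v ^+ s.+1 / (2 ^+ s.+1 * s.+1`!%:R)).
have fN k : 0 < k`!%:R :> R by rewrite ltr0n fact_gt0.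
have kappa0 : 0 < kappa.
  by rewrite mulr_gt0 ?exprn_gt0 ?ltr0n ?(ltnW Q2) // divr_gt0 // mulr_gt0 ?exprn_gt0.
pose Y (z : 'cV[F]_u) : 'rV[R]_n := \row_i psi ((h i *m z) 0 0).
have YP (x : 'rV[R]_n) : \sum_z (\sum_(i < n) x 0 i * Y z 0 i) ^+ s.+1.*2 =
    kappa * (\sum_(i < n) x 0 i ^+ 2) ^+ s.+1.
  (* Each product in the expansion reads at most [s.+1.*2 = tau.+1] coordinates, on which the code
     words behave like independent letters. *)
  have expand (a : 'I_n -> R) : (\sum_i a i) ^+ s.+1.*2 =
      \sum_(f : {ffun 'I_(s.+1.*2) -> 'I_n}) \prod_k a (f k).
    by rewrite -[in LHS](card_ord s.+1.*2) -prodr_const bigA_distr_bigA.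
  apply: (@mulfI _ (Q%:R ^+ n)); first by rewrite expf_neq0 // pnatr_eq0 -lt0n ltnW.
  have -> : Q%:R ^+ n * (kappa * (\sum_(i < n) x 0 i ^+ 2) ^+ s.+1) = Q%:R ^+ u *
      (\sum_(w : {ffun 'I_n -> F}) (\sum_(i < n) x 0 i * psi (w i)) ^+ s.+1.*2).
    by rewrite (P n (fun i => x 0 i)) /kappa /Q; ring.
  transitivity (\sum_(f : {ffun 'I_(s.+1.*2) -> 'I_n}) (\prod_k x 0 (f k)) *
      (#|{: {ffun 'I_n -> F}}|%:R * \sum_(z : 'cV[F]_u) \prod_k psi ((h (f k) *m z) 0 0))).
    rewrite card_ffun card_ord natrX.
    under eq_bigr do rewrite expand.
    rewrite exchange_big /= mulr_sumr; apply: eq_bigr => f _.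
    rewrite mulrCA; congr (_ * _); rewrite mulr_sumr; apply: eq_bigr => z _.
    by rewrite -big_split /=; apply: eq_bigr => k _; rewrite mxE.
  transitivity (\sum_(f : {ffun 'I_(s.+1.*2) -> 'I_n}) (\prod_k x 0 (f k)) *
      (#|{: 'cV[F]_u}|%:R * \sum_(w : {ffun 'I_n -> F}) \prod_k psi (w (f k)))).
    apply: eq_bigr => f _; congr (_ * _); apply: independent_average => w.
    apply: IP; rewrite (leq_trans (leq_imset_card _ _)) // card_ord.
    by rewrite /tau doubleS.
  rewrite card_mx muln1 natrX.
  under [in RHS]eq_bigr do rewrite expand.
  rewrite [in RHS]exchange_big /= [RHS]mulr_sumr; apply: eq_bigr => f _.
  rewrite mulrCA; congr (_ * _); rewrite mulr_sumr; apply: eq_bigr => w _.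
  by rewrite -big_split.
exists 'cV[F]_u, Y, kappa; split => //.
- rewrite card_mx muln1 -/Q /u expnS -mulnA leq_mul2l; apply/orP; right.
  by rewrite (leq_trans (trunc_logP Q2 A0)) // /A expnMn mulnC.
- have [Y0|[z Yz]] : (forall z, Y z = 0) \/ (exists z, Y z != 0).
    case: (pickP (fun z => Y z != 0)) => [z Yz|Y0]; first by right; exists z.
    by left => z; apply/eqP; have := Y0 z; move/negbFE.
    have := YP (const_mx 1); rewrite big1 => [|z _]; last first.
      by rewrite Y0 big1 ?expr0n // => i _; rewrite [X in _ * X]mxE mulr0.
    move=> /esym/eqP; rewrite mulf_eq0 gt_eqF //= expf_eq0 /= => /eqP.
    under eq_bigr do rewrite mxE expr1n.
    by rewrite sumr_const card_ord => /eqP; rewrite pnatr_eq0 eqn0Ngt n0.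
  by exists z.
Qed.

Local Open Scope classical_set_scope.
Local Open Scope ring_scope.

(** * Weighted designs on the sphere *)

Definition dot (R : realType) (n : nat) (u v : 'rV[R]_n) : R :=
  \sum_(i < n) u ord0 i * v ord0 i.

Lemma dotC (R : realType) (n : nat) (u v : 'rV[R]_n) : dot u v = dot v u.
Proof. by apply: eq_bigr => i _; rewrite mulrC. Qed.

Lemma dotDl (R : realType) (n : nat) (u v w : 'rV[R]_n) :
  dot (u + v) w = dot u w + dot v w.
Proof. by rewrite -big_split; apply: eq_bigr => i _; rewrite mxE mulrDl. Qed.

Lemma dotZl (R : realType) (n : nat) (c : R) (u w : 'rV[R]_n) :
  dot (c *: u) w = c * dot u w.
Proof. by rewrite mulr_sumr; apply: eq_bigr => i _; rewrite mxE mulrA. Qed.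

Lemma dotDr (R : realType) (n : nat) (u v w : 'rV[R]_n) :
  dot w (u + v) = dot w u + dot w v.
Proof. by rewrite dotC dotDl !(dotC w). Qed.

Lemma dotZr (R : realType) (n : nat) (c : R) (u w : 'rV[R]_n) :
  dot w (c *: u) = c * dot w u.
Proof. by rewrite dotC dotZl (dotC w). Qed.

Lemma dotNl (R : realType) (n : nat) (u w : 'rV[R]_n) : dot (- u) w = - dot u w.
Proof. by rewrite -scaleN1r dotZl mulN1r. Qed.

Lemma dotNr (R : realType) (n : nat) (u w : 'rV[R]_n) : dot w (- u) = - dot w u.
Proof. by rewrite dotC dotNl (dotC w). Qed.

Lemma dotM (R : realType) (n : nat) (u v : 'rV[R]_n) (A : 'M[R]_n) :
  dot u (v *m A) = dot (u *m A^T) v.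
Proof.
have E (a b : 'rV[R]_n) : dot a b = (a *m b^T) ord0 ord0.
  by rewrite mxE; apply: eq_bigr => i _; rewrite mxE.
by rewrite !E trmx_mul mulmxA.
Qed.

Lemma dot_delta (R : realType) (n : nat) (u : 'rV[R]_n) i :
  dot u (delta_mx ord0 i) = u ord0 i.
Proof.
rewrite /dot (bigD1 i) //= big1 => [|j ji]; first by rewrite mxE !eqxx mulr1 addr0.
by rewrite mxE (negbTE ji) andbF mulr0.
Qed.

Lemma dot_ge0 (R : realType) (n : nat) (u : 'rV[R]_n) : 0 <= dot u u.
Proof. by apply: sumr_ge0 => i _; rewrite -expr2 sqr_ge0. Qed.

Lemma dot_eq0 (R : realType) (n : nat) (u : 'rV[R]_n) : (dot u u == 0) = (u == 0).
Proof.
rewrite psumr_eq0 => [|i _]; last by rewrite -expr2 sqr_ge0.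
apply/allP/eqP => [h|-> i _]; last by rewrite mxE mulr0 eqxx implybT.
by apply/rowP => i; have := h i (mem_index_enum i); rewrite -expr2 expf_eq0 /= mxE => /eqP.
Qed.

Lemma dot_unit_bound (R : realType) (n : nat) (a b : 'rV[R]_n) :
  dot a a = 1 -> dot b b = 1 -> -1 <= dot a b <= 1.
Proof.
move=> aa bb; have := dot_ge0 (b - a); have := dot_ge0 (b + a).
rewrite !(dotDl, dotDr, dotNl, dotNr) aa bb (dotC b) => h1 h2.
by apply/andP; split; lra.
Qed.

Lemma sphereE (R : realType) (d : nat) (x : 'rV[R]_d.+1) :
  sphere R d x <-> dot x x = 1.
Proof.
have -> : dot x x = \sum_(i < d.+1) x ord0 i ^+ 2.
  by apply: eq_bigr => i _; rewrite expr2.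
rewrite /sphere /enorm /=; split => [h|->]; last exact: sqrtr1.
rewrite -[LHS]sqr_sqrtr ?h ?expr1n //.
by apply: sumr_ge0 => i _; rewrite sqr_ge0.
Qed.

Lemma sphere_coord_le1 (R : realType) (d : nat) (x : 'rV[R]_d.+1) i :
  sphere R d x -> `|x ord0 i| <= 1.
Proof.
move=> /sphereE x1; rewrite -(@expr_le1 _ 2) // real_normK ?num_real // -x1 /dot.
by rewrite (bigD1 i) //= expr2 lerDl sumr_ge0 // => j _; rewrite -expr2 sqr_ge0.
Qed.

Definition refl (R : realType) (n : nat) (v : 'rV[R]_n) : 'M[R]_n :=
  1%:M - (2 / dot v v) *: (v^T *m v).

Lemma mul_refl (R : realType) (n : nat) (v x : 'rV[R]_n) :
  x *m refl v = x - (2 * dot x v / dot v v) *: v.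
Proof.
rewrite /refl mulmxBr mulmx1 -scalemxAr mulmxA; congr (_ - _).
have -> : x *m v^T = (dot x v)%:M.
  by apply/matrixP => i j; rewrite !ord1 !mxE eqxx; apply: eq_bigr => k _; rewrite mxE.
by rewrite mul_scalar_mx scalerA; congr (_ *: _); ring.
Qed.

Lemma refl_orthogonal (R : realType) (n : nat) (v : 'rV[R]_n) : v != 0 ->
  refl v *m (refl v)^T = 1%:M.
Proof.
move=> v0; have vv : dot v v != 0 by rewrite dot_eq0.
have -> : (refl v)^T = refl v.
  by rewrite /refl linearB linearZ /= trmx1 trmx_mul trmxK.
apply/row_matrixP => i; rewrite row_mul row1 mul_refl.
set x := row i _.
have -> : x = delta_mx 0 i *m refl v by rewrite /x rowE.
rewrite mul_refl; set e := delta_mx _ _.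
rewrite dotDl dotNl dotZl -[RHS]addr0 -addrA; congr (_ + _).
by rewrite -opprD -scalerDl; apply/eqP; rewrite oppr_eq0 scaler_eq0; apply/orP; left; apply/eqP; field.
Qed.

Lemma refl_swap (R : realType) (n : nat) (x y : 'rV[R]_n) :
  dot x x = dot y y -> x != y -> x *m refl (x - y) = y.
Proof.
move=> xy neq; rewrite mul_refl.
have d0 : dot (x - y) (x - y) != 0 by rewrite dot_eq0 subr_eq0.
have -> : 2 * dot x (x - y) = dot (x - y) (x - y).
  by rewrite !(dotDl, dotDr, dotNl, dotNr) xy (dotC y x); ring.
by rewrite divff // scale1r opprB subrKC.
Qed.

Lemma exists_rotation (R : realType) (d : nat) (x : 'rV[R]_d.+1) :
  exists2 A : 'M[R]_d.+1, A *m A^T = 1%:M &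
    x *m A^T = Num.sqrt (dot x x) *: delta_mx 0 0.
Proof.
set y := _ *: _.
have [->|neq] := eqVneq x y; first by exists 1%:M; rewrite trmx1 mulmx1.
exists (refl (x - y))^T; rewrite ?trmxK.
  by rewrite mulmx1C // refl_orthogonal // subr_eq0.
apply: refl_swap => //; rewrite /y dotZl dotZr mulrA -expr2 sqr_sqrtr ?dot_ge0 //.
by rewrite dot_delta mxE !eqxx mulr1.
Qed.

Lemma poly_eq0_roots (R : realType) (p : {poly R}) (f : nat -> R) :
  injective f -> (forall k, p.[f k] = 0) -> p = 0.
Proof.
move=> finj pf; apply/eqP; case: eqVneq => // p0.
have := max_poly_roots p0 (rs := [seq f i | i <- iota 0 (size p)]).
rewrite size_map size_iota ltnn => ->//.
  by apply/allP => _ /mapP[k _ ->]; apply/rootP.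
by rewrite map_inj_uniq ?iota_uniq.
Qed.

Definition linform (R : realType) (n : nat) (x : 'rV[R]_n) : mpoly n R :=
  \sum_(i < n) x ord0 i *: mpolyX R (mnm1 i).

Lemma polyfun_linform (R : realType) (n : nat) (x y : 'rV[R]_n) :
  polyfun (linform x) y = dot x y.
Proof.
by rewrite /polyfun raddf_sum /=; apply: eq_bigr => i _; rewrite mevalZ mevalXU.
Qed.

(** The coefficient of c in L ((x + c z)^(a+1) p) is (a + 1) L (x^a z p), and it is zero because the
    polynomial in c vanishes identically. *)
Lemma polarization_step (R : realType) (A : comAlgType R) (L : A -> R)
    (a : nat) (x z p : A) :
  (forall p q, L (p + q) = L p + L q) -> (forall c p, L (c *: p) = c * L p) ->
  (forall c : R, L ((x + c *: z) ^+ a.+1 * p) = 0) -> L (x ^+ a * z * p) = 0.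
Proof.
move=> LD LZ Lx.
have Lsum (I : Type) (r : seq I) (F : I -> A) :
    L (\sum_(i <- r) F i) = \sum_(i <- r) L (F i).
  elim: r => [|i r IHr]; last by rewrite !big_cons LD IHr.
  by rewrite !big_nil -[0 in LHS](scale0r 0) LZ mul0r.
have LMn q k : L (q *+ k) = k%:R * L q by rewrite -LZ scaler_nat.
(* The polynomial in [c] with value [L ((x + c z)^(a+1) p)] at [c]. *)
pose Q : {poly R} := \poly_(j < a.+2)
  ('C(a.+1, j)%:R * L (x ^+ (a.+1 - j) * z ^+ j * p)).
have Q0 : Q = 0.
  apply: (@poly_eq0_roots _ _ (fun k => k%:R)) => [k l /eqP|k].
    by rewrite eqr_nat => /eqP.
  rewrite horner_poly -[RHS](Lx k%:R).
  rewrite exprDn mulr_suml Lsum; apply: eq_bigr => j _.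
  rewrite [in RHS]mulrnAl [in RHS]LMn exprZn -scalerAr -(scalerAl (_ ^+ j)) LZ.
  by ring.
have := congr1 (fun q : {poly R} => q`_1) Q0; rewrite coef_poly coef0 /= bin1.
rewrite subSS subn0 expr1 => /eqP.
by rewrite mulf_eq0 pnatr_eq0 /= => /eqP.
Qed.

(** Each step frees one of the [m] equal factors; when [zs] has length [m], the functional is seen
    to vanish on a product of arbitrary linear forms. *)
Lemma polarization (R : realType) (n m : nat) (L : mpoly n R -> R) :
  (forall p q, L (p + q) = L p + L q) -> (forall c p, L (c *: p) = c * L p) ->
  (forall x, L (linform x ^+ m) = 0) ->
  forall zs : seq 'rV[R]_n, (size zs <= m)%N ->
  forall x, L (linform x ^+ (m - size zs) * \prod_(z <- zs) linform z) = 0.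
Proof.
move=> LD LZ Lm; elim=> [|z zs IH] /= szs x; first by rewrite big_nil mulr1 subn0.
rewrite big_cons mulrA; apply: polarization_step => // c.
have := IH (ltnW szs) (x + c *: z); rewrite -(subnSK szs).
have -> // : linform (x + c *: z) = linform x + c *: linform z.
rewrite /linform scaler_sumr -big_split; apply: eq_bigr => i _ /=.
by rewrite !mxE scalerDl scalerA.
Qed.

Lemma cvg_rV (R : realType) (n : nat) (T : Type) (F : set_system T)
    {FF : Filter F} (f : T -> 'rV[R]_n) (l : 'rV[R]_n) :
  (forall i, f x ord0 i @[x --> F] --> l ord0 i) -> f x @[x --> F] --> l.
Proof.
move=> fl; apply/cvg_ballP => e e0.
have : \forall x \near F, forall i, ball (l ord0 i) e (f x ord0 i).
  by apply: filter_forall => i; move/cvg_ballP : (fl i); exact.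
by apply: filterS => x h; split => // i j; rewrite ord1.
Qed.

Lemma continuous_coord (R : realType) (n : nat) (i : 'I_n) :
  continuous (fun x : 'rV[R]_n => x ord0 i).
Proof. exact: (@coord_continuous R 1 n ord0 i). Qed.

Lemma cvg_sum (R : realType) (T : Type) (F : set_system T) {FF : Filter F}
    (I : Type) (r : seq I) (f : I -> T -> R) (l : I -> R) :
  (forall i, f i x @[x --> F] --> l i) ->
  \sum_(i <- r) f i x @[x --> F] --> \sum_(i <- r) l i.
Proof. by move=> fl; apply: cvg_big => //; exact: add_continuous. Qed.

Lemma cvg_prod (R : realType) (T : Type) (F : set_system T) {FF : Filter F}
    (I : Type) (r : seq I) (f : I -> T -> R) (l : I -> R) :
  (forall i, f i x @[x --> F] --> l i) ->
  \prod_(i <- r) f i x @[x --> F] --> \prod_(i <- r) l i.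
Proof. by move=> fl; apply: cvg_big => //; exact: mul_continuous. Qed.

Lemma continuous_polyfun (R : realType) (n : nat) (p : mpoly n R) :
  continuous (polyfun p : 'rV[R]_n -> R).
Proof.
have -> : polyfun p = fun x : 'rV[R]_n =>
    \sum_(m <- msupp p) mcoeff m p * \prod_i x ord0 i ^+ m i.
  by apply/funext => x; rewrite /polyfun mevalE.
move=> x; apply: (@cvg_sum _ _ (nbhs x)) => m; apply: cvgM; first exact: cvg_cst.
apply: (@cvg_prod _ _ (nbhs x)) => i.
by apply: (@continuous_comp _ _ _ (fun x : 'rV[R]_n => x ord0 i) (fun y => y ^+ m i));
  [exact: continuous_coord|exact: exprn_continuous].
Qed.

Lemma continuous_mulmxr (R : realType) (n : nat) (A : 'M[R]_n) :
  continuous (fun x : 'rV[R]_n => x *m A).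
Proof.
move=> x; apply: (@cvg_rV _ _ _ (nbhs x)) => i; rewrite mxE.
under eq_cvg do rewrite mxE.
by apply: (@cvg_sum _ _ (nbhs x)) => j; apply: cvgMl; exact: continuous_coord.
Qed.

Lemma measurable_polyfun (R : realType) (n : nat) (p : mpoly n R)
    (D : set (borel_rV R n)) :
  measurable_fun D (polyfun p : borel_rV R n -> R).
Proof.
move=> mD; apply: (measurability _ (RGenOInfty.measurableE R)) => //.
move=> _ [_ [a ->] <-]; apply: measurableI => //; apply: sub_sigma_algebra.
by apply: open_comp => // x _; exact: continuous_polyfun.
Qed.

Definition sqnorm_poly (R : realType) (n : nat) : mpoly n R :=
  \sum_(i < n) mpolyX R (mnm1 i) * mpolyX R (mnm1 i).

Lemma polyfun_sqnorm (R : realType) (n : nat) (x : 'rV[R]_n) :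
  polyfun (sqnorm_poly R n) x = dot x x.
Proof.
by rewrite /polyfun raddf_sum /=; apply: eq_bigr => i _; rewrite mevalM !mevalXU.
Qed.

Lemma measurable_sphere (R : realType) (d : nat) :
  measurable (sphere R d : set (borel_rV R d.+1)).
Proof.
have -> : sphere R d = setT `&` polyfun (sqnorm_poly R d.+1) @^-1` [set 1].
  by rewrite setTI; apply/seteqP; split=> x /=;
    rewrite polyfun_sqnorm => /sphereE.
by apply: measurable_polyfun => //; exact: measurable_set1.
Qed.

Lemma integrable_polyfun (R : realType) (d : nat)
    (sigma : probability (borel_rV R d.+1) R) (p : mpoly d.+1 R) :
  sigma.-integrable (sphere R d) (EFin \o polyfun p).
Proof.
apply: measurable_bounded_integrable.
- exact: measurable_sphere.
- by rewrite (le_lt_trans (probability_le1 _ _)) ?ltry //; exact: measurable_sphere.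
- exact: measurable_polyfun.
exists (\sum_(m <- msupp p) `|mcoeff m p|); split; first exact: num_real.
move=> M MM x /= xS; apply: le_trans (ltW MM).
rewrite /polyfun mevalE (le_trans (ler_norm_sum _ _ _)) //.
apply: ler_sum => m _; rewrite normrM ler_piMr // normr_prod.
apply: prodr_ile1 => i _; rewrite normr_ge0 /= normrX exprn_ile1 //.
exact: sphere_coord_le1.
Qed.

(** * The mean of a polynomial over the sphere *)

Definition sphere_mean (R : realType) (d : nat)
    (sigma : probability (borel_rV R d.+1) R) (p : mpoly d.+1 R) : R :=
  Rintegral sigma (sphere R d) (polyfun p).

Lemma sphere_meanE (R : realType) (d : nat)
    (sigma : probability (borel_rV R d.+1) R) (p : mpoly d.+1 R) :
  (\int[sigma]_(x in sphere R d) (polyfun p x)%:E)%E = (sphere_mean sigma p)%:E.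
Proof.
rewrite /sphere_mean /Rintegral fineK //.
apply: integrable_fin_num; first exact: measurable_sphere.
exact: integrable_polyfun.
Qed.

Lemma sphere_meanD (R : realType) (d : nat)
    (sigma : probability (borel_rV R d.+1) R) (p q : mpoly d.+1 R) :
  sphere_mean sigma (p + q) = sphere_mean sigma p + sphere_mean sigma q.
Proof.
rewrite /sphere_mean -RintegralD; last 3 first.
- exact: measurable_sphere.
- exact: integrable_polyfun.
- exact: integrable_polyfun.
by apply: eq_Rintegral => x _; rewrite /polyfun mevalD.
Qed.

Lemma sphere_meanZ (R : realType) (d : nat)
    (sigma : probability (borel_rV R d.+1) R) (c : R) (p : mpoly d.+1 R) :
  sphere_mean sigma (c *: p) = c * sphere_mean sigma p.
Proof.
rewrite /sphere_mean -RintegralZl; last 2 first.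
- exact: measurable_sphere.
- exact: integrable_polyfun.
by apply: eq_Rintegral => x _; rewrite /polyfun mevalZ.
Qed.

Lemma eq_sphere_mean (R : realType) (d : nat)
    (sigma : probability (borel_rV R d.+1) R) (p q : mpoly d.+1 R) :
  (forall x, dot x x = 1 -> polyfun p x = polyfun q x) ->
  sphere_mean sigma p = sphere_mean sigma q.
Proof.
by move=> pq; apply: eq_Rintegral => x /set_mem /sphereE; exact: pq.
Qed.

Lemma sphere_mean1 (R : realType) (d : nat)
    (sigma : probability (borel_rV R d.+1) R) :
  uniform_on_sphere sigma -> sphere_mean sigma 1 = 1.
Proof.
move=> [s1 _]; rewrite /sphere_mean -[RHS]mulr1.
transitivity (Rintegral sigma (sphere R d) (cst 1)).
  by apply: eq_Rintegral => x _; rewrite /polyfun meval1.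
rewrite (Rintegral_cst sigma (@measurable_sphere R d)).
exact: (congr1 (fun x => 1 * fine x) s1).
Qed.

(** Stated for a second polynomial [q], so that the substitution of [x *m A] into [p] need not be
    formed as a polynomial. *)
Lemma sphere_mean_invariant (R : realType) (d : nat)
    (sigma : probability (borel_rV R d.+1) R) (A : 'M[R]_d.+1)
    (p q : mpoly d.+1 R) :
  uniform_on_sphere sigma -> A *m A^T = 1%:M ->
  (forall x, polyfun q x = polyfun p (x *m A)) ->
  sphere_mean sigma q = sphere_mean sigma p.
Proof.
move=> [_ sA] AA pq.
pose phi (x : borel_rV R d.+1) : borel_rV R d.+1 := (x : 'rV[R]_d.+1) *m A.
have mphi : measurable_fun setT phi.
  apply: (@measurability _ _ _ (borel_rV R d.+1) setT phi (@open 'rV[R]_d.+1) erefl).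
  move=> _ [B oB <-]; rewrite setTI; apply: sub_sigma_algebra.
  apply: (@open_comp _ _ (fun x : 'rV[R]_d.+1 => x *m A)) => // x _.
  exact: continuous_mulmxr.
have phiS : phi @^-1` (sphere R d) = sphere R d.
  by apply/seteqP; split => x /= /sphereE xx; apply/sphereE; move: xx;
    rewrite /phi dotM -mulmxA AA mulmx1.
rewrite /sphere_mean /Rintegral; congr fine.
transitivity (\int[pushforward sigma phi]_(x in sphere R d) (polyfun p x)%:E)%E.
  rewrite integral_pushforward //.
  - by rewrite phiS; apply: eq_integral => x _; rewrite /= pq.
  - by apply/measurable_EFinP; exact: measurable_polyfun.
  - rewrite phiS; have := integrable_polyfun sigma q; congr (_.-integrable _ _).
    by apply/funext => x /=; rewrite pq.
  - exact: measurable_sphere.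
by apply: eq_measure_integral => B mB _; exact: sA.
Qed.

Lemma polyfunX (R : realType) (n k : nat) (p : mpoly n R) (x : 'rV[R]_n) :
  polyfun (p ^+ k) x = polyfun p x ^+ k.
Proof. exact: rmorphXn. Qed.

Lemma polyfunM (R : realType) (n : nat) (p q : mpoly n R) (x : 'rV[R]_n) :
  polyfun (p * q) x = polyfun p x * polyfun q x.
Proof. exact: mevalM. Qed.

Lemma polyfunZ (R : realType) (n : nat) c (p : mpoly n R) (x : 'rV[R]_n) :
  polyfun (c *: p) x = c * polyfun p x.
Proof. exact: mevalZ. Qed.

Lemma polyfunD (R : realType) (n : nat) (p q : mpoly n R) (x : 'rV[R]_n) :
  polyfun (p + q) x = polyfun p x + polyfun q x.
Proof. exact: mevalD. Qed.

Lemma polyfun_mon (R : realType) (n : nat) (m : multinom n) (x : 'rV[R]_n) :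
  polyfun (mpolyX R m) x = \prod_(i < n) x ord0 i ^+ m i.
Proof. exact: mevalX. Qed.

Lemma polyfun_mon_scale (R : realType) (n : nat) (m : multinom n) (c : R)
    (x : 'rV[R]_n) :
  polyfun (mpolyX R m) (c *: x) = c ^+ mdeg m * polyfun (mpolyX R m) x.
Proof.
rewrite !polyfun_mon mdegE -prodrXr -big_split; apply: eq_bigr => i _ /=.
by rewrite mxE exprMn.
Qed.

(** A rotation takes [x] to |x| times the first basis vector, so the mean depends on |x| alone. *)
Lemma sphere_mean_linformX (R : realType) (d s : nat)
    (sigma : probability (borel_rV R d.+1) R) (x : 'rV[R]_d.+1) :
  uniform_on_sphere sigma ->
  sphere_mean sigma (linform x ^+ s.*2) =
  sphere_mean sigma (linform (delta_mx ord0 ord0) ^+ s.*2) * dot x x ^+ s.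
Proof.
move=> us; have [A AA xA] := exists_rotation x.
rewrite mulrC -sphere_meanZ; apply/esym.
apply: (sphere_mean_invariant (A := A) us AA) => y.
rewrite polyfunZ !polyfunX !polyfun_linform dotM xA dotZl exprMn; congr (_ * _).
by rewrite -mul2n exprM sqr_sqrtr ?dot_ge0.
Qed.

Lemma linform_delta (R : realType) (n : nat) (i : 'I_n) :
  linform (delta_mx ord0 i) = mpolyX R (mnm1 i).
Proof.
rewrite /linform (bigD1 i) //= mxE !eqxx scale1r big1 ?addr0 // => j ji.
by rewrite mxE (negbTE ji) andbF scale0r.
Qed.

(* Two linear functionals agreeing on the powers [(x . X)^(2s)] agree on all
   homogeneous polynomials of degree [2s]. *)
Lemma functional_homogeneous (R : realType) (n s : nat) (L : mpoly n R -> R) :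
  (forall p q, L (p + q) = L p + L q) -> (forall c p, L (c *: p) = c * L p) ->
  (forall x, L (linform x ^+ s.*2) = 0) ->
  forall (m : multinom n) l, (mdeg m + l.*2 = s.*2)%N ->
    L (mpolyX R m * sqnorm_poly R n ^+ l) = 0.
Proof.
move=> LD LZ Ls.
have Lsum (I : Type) (r : seq I) (F : I -> mpoly n R) :
    L (\sum_(i <- r) F i) = \sum_(i <- r) L (F i).
  elim: r => [|i r IHr]; last by rewrite !big_cons LD IHr.
  by rewrite !big_nil -[0 in LHS](scale0r 0) LZ mul0r.
(* The powers of |x|^2 lift monomials of smaller even degree to degree 2s, at no cost on the sphere.
   Expanding one factor |x|^2 lowers [l] and raises the degree of the monomial by 2. *)
suff H l (m : multinom n) : (mdeg m + l.*2 = s.*2)%N ->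
  L (mpolyX R m * sqnorm_poly R n ^+ l) = 0 by move=> m l; exact: H.
elim: l m => [|l IH] m ml; last first.
  rewrite exprS mulrA /sqnorm_poly mulr_sumr mulr_suml Lsum big1 // => i _.
  rewrite !mulrA -!mpolyXD; apply: IH.
  by rewrite !mdegD !mdeg1 -ml doubleS !addn1 !addSn !addnS.
pose zs := flatten [seq nseq (m i) (delta_mx ord0 i : 'rV[R]_n) | i <- index_enum 'I_n].
have zsE : mpolyX R m = \prod_(z <- zs) linform z.
  rewrite big_flatten big_map mpolyXE_id; apply: eq_bigr => i _.
  by rewrite big_nseq -linform_delta -Monoid.iteropE.
have szs : size zs = s.*2.
  rewrite -ml addn0 mdegE size_flatten /shape -map_comp sumnE big_map.
  by apply: eq_bigr => i _; rewrite /= size_nseq.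
rewrite expr0 mulr1 zsE.
have := polarization LD LZ Ls (zs := zs); rewrite szs leqnn => /(_ isT 0).
by rewrite subnn expr0 mul1r.
Qed.

(** The mean over the sphere and the sum over the points both send (x . X)^(2s) to a multiple of
    |x|^(2s), so they are proportional in degree 2s. Smaller even degrees reduce to that one, as |x|
    = 1 on the sphere, and odd degrees vanish on both sides by antipodal symmetry. Hence the
    exactness up to degree 2s + 1. *)
Lemma homogeneous_design (R : realType) (d s : nat)
    (sigma : probability (borel_rV R d.+1) R) (J : finType)
    (q : J -> 'rV[R]_d.+1) (r : J -> R) (kappa : R) :
  let kI := sphere_mean sigma (linform (delta_mx ord0 ord0) ^+ s.*2) in
  uniform_on_sphere sigma -> 0 < kappa -> (forall j, dot (q j) (q j) = 1) ->
  (forall x, \sum_j dot x (r j *: q j) ^+ s.*2 = kappa * dot x x ^+ s) ->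
  kI * \sum_j r j ^+ s.*2 = kappa /\
  forall p, (msize p <= s.*2.+2)%N -> sphere_mean sigma p =
    \sum_j kI / (2 * kappa) * r j ^+ s.*2 * (polyfun p (q j) + polyfun p (- q j)).
Proof.
move=> kI us k0 q1 YP.
pose I := sphere_mean sigma.
pose J0 (p : mpoly d.+1 R) := \sum_j polyfun p (r j *: q j).
pose L p := kappa * I p - kI * J0 p.
have LD p p' : L (p + p') = L p + L p'.
  rewrite /L /I /J0 sphere_meanD.
  under eq_bigr do rewrite polyfunD.
  by rewrite big_split /=; ring.
have LZ c p : L (c *: p) = c * L p.
  rewrite /L /I /J0 sphere_meanZ.
  under eq_bigr do rewrite polyfunZ.
  by rewrite -mulr_sumr; ring.
have Ls x : L (linform x ^+ s.*2) = 0.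
  rewrite /L /I sphere_mean_linformX // -/I -/kI /J0.
  under eq_bigr do rewrite polyfunX polyfun_linform.
  by rewrite -[I (linform _ ^+ _)]/kI YP; ring.
have H := functional_homogeneous LD LZ Ls.
(* Evaluating at |x|^(2s) fixes the ratio of the two functionals. *)
have kIE : kI * \sum_j r j ^+ s.*2 = kappa.
  have := H (@mnm0 _) s; rewrite mdeg0 add0n mpolyX0 mul1r => /(_ erefl).
  rewrite /L => /eqP; rewrite subr_eq0 => /eqP.
  have -> : I (sqnorm_poly R d.+1 ^+ s) = 1.
    rewrite -(sphere_mean1 us); apply: eq_sphere_mean => x x1.
    by rewrite polyfunX polyfun_sqnorm x1 expr1n /polyfun meval1.
  rewrite mulr1 => ->; congr (_ * _); apply: eq_bigr => j _.
  by rewrite polyfunX polyfun_sqnorm dotZl dotZr q1 mulr1 -expr2 -exprM mul2n.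
split => // p pt.
(* Homogeneity turns the length [r j] of a vector into a weight; the 2 shares it between [q j] and
   its antipode. *)
pose a j := kI / (2 * kappa) * r j ^+ s.*2.
pose RS p1 := \sum_j a j * (polyfun p1 (q j) + polyfun p1 (- q j)).
have RSD p1 p2 : RS (p1 + p2) = RS p1 + RS p2.
  by rewrite /RS -big_split; apply: eq_bigr => j _ /=; rewrite !polyfunD; ring.
have RSZ c p1 : RS (c *: p1) = c * RS p1.
  by rewrite /RS mulr_sumr; apply: eq_bigr => j _ /=; rewrite !polyfunZ; ring.
rewrite -[LHS]/(I p) -[RHS]/(RS p).
suff E m : (mdeg m <= s.*2.+1)%N -> I (mpolyX R m) = RS (mpolyX R m).
  rewrite [p]mpolyE; have : {subset msupp p <= msupp p} by [].
  elim: {1 3 4}(msupp p) => [|m l IH] lp.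
    rewrite big_nil -[0 in LHS](scale0r 0) -[0 in RHS](scale0r 0) RSZ.
    by rewrite /I sphere_meanZ !mul0r.
  rewrite big_cons RSD RSZ /I sphere_meanD sphere_meanZ -/I -E.
    by rewrite IH // => m' m'l; apply: lp; rewrite inE m'l orbT.
  by rewrite -ltnS (leq_trans _ pt) // msize_mdeg_lt // lp // inE eqxx.
move=> mt.
have opp x : polyfun (mpolyX R m) (- x) = (-1) ^+ mdeg m * polyfun (mpolyX R m) x.
  by rewrite -scaleN1r polyfun_mon_scale.
have [modd|meven] := boolP (odd (mdeg m)).
  have -> : RS (mpolyX R m) = 0.
    by apply: big1 => j _; rewrite opp -signr_odd modd expr1; ring.
  have : I ((-1) *: mpolyX R m) = I (mpolyX R m).
    apply: (sphere_mean_invariant (A := - 1%:M) us).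
      by rewrite linearN /= trmx1 mulNmx mulmxN mulmx1 opprK.
    by move=> x; rewrite mulmxN mulmx1 opp polyfunZ -signr_odd modd expr1.
  rewrite /I sphere_meanZ; lra.
have mE := odd_double_half (mdeg m); rewrite (negbTE meven) add0n in mE.
have ms : ((mdeg m)./2 <= s)%N.
  by rewrite -[s](half_bit_double s true) add1n half_leq.
have := H m (s - (mdeg m)./2)%N; rewrite -{1}mE -doubleD subnKC // => /(_ erefl).
rewrite /L => /eqP; rewrite subr_eq0 => /eqP.
have -> : I (mpolyX R m * sqnorm_poly R d.+1 ^+ (s - (mdeg m)./2)) = I (mpolyX R m).
  apply: eq_sphere_mean => x x1.
  by rewrite polyfunM polyfunX polyfun_sqnorm x1 expr1n mulr1.
move=> E; apply: (mulfI (lt0r_neq0 k0)); rewrite E /J0 /RS !mulr_sumr.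
apply: eq_bigr => j _; rewrite opp -signr_odd (negbTE meven) expr0.
rewrite polyfunM polyfunX polyfun_sqnorm polyfun_mon_scale dotZl dotZr q1 /a.
have -> : r j ^+ s.*2 = r j ^+ mdeg m * (r j * (r j * 1)) ^+ (s - (mdeg m)./2).
  by rewrite mulr1 -expr2 -exprM -{1}mE -exprD mul2n -doubleD subnKC.
by field; rewrite gt_eqF.
Qed.

(** A rotated set of vectors satisfies the same Hilbert identity with the same norms, so the weights
    do not depend on [A]. This is what allows averaging over reflections later. *)
Lemma sphere_design (R : realType) (t : nat) : exists C : nat,
  forall (d : nat) (sigma : probability (borel_rV R d.+1) R),
  uniform_on_sphere sigma ->
  exists (J : finType) (q : J -> 'rV[R]_d.+1) (a : J -> R),
  [/\ (#|J| <= C * d.+1 ^ t.-1)%N,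
      forall j, dot (q j) (q j) = 1,
      (forall j, 0 <= a j) /\ (exists j, 0 < a j) &
      forall A : 'M[R]_d.+1, A *m A^T = 1%:M ->
      forall p, (msize p <= t.+1)%N -> sphere_mean sigma p =
        \sum_j a j * (polyfun p (q j *m A) + polyfun p (- (q j *m A)))].
Proof.
pose s := t./2; have [C CP] := hilbert_identity R s.
exists C => d sigma us; have [J [Y [kappa [cJ k0 [j0 Yj0] YP]]]] := CP d.+1 (ltn0Sn d).
(* A zero vector gets an arbitrary direction, and norm [r j = 0]. *)
pose q j : 'rV[R]_d.+1 := if Y j == 0 then delta_mx ord0 ord0
  else (Num.sqrt (dot (Y j) (Y j)))^-1 *: Y j.
pose r j := Num.sqrt (dot (Y j) (Y j)).
have YE j : Y j = r j *: q j.
  rewrite /r /q; case: eqVneq => [->|Y0].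
    by rewrite /dot big1 ?sqrtr0 ?scale0r // => i _; rewrite mxE mul0r.
  by rewrite scalerA divff ?scale1r // sqrtr_eq0 -ltNge lt_neqAle dot_ge0 eq_sym dot_eq0 Y0.
have q1 j : dot (q j) (q j) = 1.
  rewrite /q; case: eqVneq => [_|Y0]; first by rewrite dot_delta mxE !eqxx.
  rewrite dotZl dotZr mulrA -expr2 exprVn sqr_sqrtr ?dot_ge0 //.
  by rewrite mulVf // dot_eq0.
pose kI := sphere_mean sigma (linform (delta_mx ord0 ord0) ^+ s.*2).
have main (A : 'M[R]_d.+1) (AA : A *m A^T = 1%:M) :
    kI * \sum_j r j ^+ s.*2 = kappa /\
    forall p, (msize p <= s.*2.+2)%N -> sphere_mean sigma p =
      \sum_j kI / (2 * kappa) * r j ^+ s.*2 *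
        (polyfun p (q j *m A) + polyfun p (- (q j *m A))).
  apply: (homogeneous_design us k0) => [j|x].
    by rewrite dotM -mulmxA AA mulmx1 q1.
  under eq_bigr do rewrite scalemxAl -YE dotM.
  rewrite YP; congr (_ * _ ^+ _); rewrite -[RHS](_ : dot (x *m A^T) (x *m A^T) = _).
    by apply: eq_bigr => i _; rewrite expr2.
  by rewrite dotM trmxK -mulmxA (mulmx1C AA) mulmx1.
have I1 : 1%:M *m 1%:M^T = 1%:M :> 'M[R]_d.+1 by rewrite trmx1 mulmx1.
have [kIE _] := main _ I1.
have r0 j : 0 <= r j ^+ s.*2 by rewrite exprn_ge0 // sqrtr_ge0.
have kI0 : 0 < kI.
  rewrite ltNge; apply/negP => kI_le0; move: k0; rewrite -kIE ltNge => /negP; apply.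
  by rewrite mulr_le0_ge0 // sumr_ge0.
have c0 : 0 < kI / (2 * kappa) by rewrite divr_gt0 // mulr_gt0.
exists J, q, (fun j => kI / (2 * kappa) * r j ^+ s.*2); split => //.
- rewrite (leq_trans cJ) // leq_mul2l leq_pexp2l ?orbT //.
  by rewrite -!subn1 leq_sub2r // /s -{2}(odd_double_half t) leq_addl.
- split=> [j|]; first by rewrite mulr_ge0 // ltW.
  exists j0; rewrite mulr_gt0 // exprn_gt0 // sqrtr_gt0 lt_neqAle dot_ge0.
  by rewrite eq_sym dot_eq0 Yj0.
move=> A AA p pt; apply: (main A AA).2; rewrite (leq_trans pt) // !ltnS.
by rewrite /s -{1}(odd_double_half t) -add1n leq_add2r; case: odd.
Qed.

(** * Clusters of design points *)

Lemma exists_orthogonal (R : realType) (n : nat) (u v : 'rV[R]_n) :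
  (2 < n)%N -> exists w : 'rV[R]_n, [/\ dot w w = 1, dot u w = 0 & dot v w = 0].
Proof.
move=> n3; pose K := kermx (col_mx u v)^T.
have K0 : K != 0.
  rewrite -mxrank_eq0 mxrank_ker subn_eq0 -ltnNge mxrank_tr.
  by rewrite (leq_ltn_trans (rank_leq_row _)).
pose w := nz_row K; have w0 : w != 0 by rewrite nz_row_eq0.
have : w *m (col_mx u v)^T = 0 by apply/sub_kermxP; exact: nz_row_sub.
rewrite tr_col_mx mul_mx_row => /eqP; rewrite row_mx_eq0 => /andP[/eqP wu /eqP wv].
have D (x : 'rV[R]_n) : w *m x^T = 0 -> dot x w = 0.
  move=> /matrixP /(_ ord0 ord0); rewrite !mxE dotC => <-.
  by apply: eq_bigr => i _; rewrite mxE.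
have ww : 0 < dot w w by rewrite lt_neqAle dot_ge0 eq_sym dot_eq0 w0.
exists ((Num.sqrt (dot w w))^-1 *: w); split.
- by rewrite dotZr dotZl mulrA -expr2 exprVn sqr_sqrtr ?mulVf ?gt_eqF // ltW.
- by rewrite dotZr (D _ wu) mulr0.
- by rewrite dotZr (D _ wv) mulr0.
Qed.

Lemma maximal_free_rows (F : fieldType) (D : nat) (E : set 'rV[F]_D) :
  exists r (B : 'M[F]_(r, D)), [/\ row_free B, forall i, E (row i B) &
    forall e, E e -> (e <= B)%MS].
Proof.
pose P r := `[< exists B : 'M[F]_(r, D), row_free B /\ forall i, E (row i B) >].
have P0 : exists r, P r.
  exists 0%N; apply/asboolP; exists 0; split; last by case.
  by rewrite /row_free mxrank0.
have PD r : P r -> (r <= D)%N.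
  by move=> /asboolP[B [Bf _]]; rewrite -(eqP Bf) rank_leq_col.
case: (ex_maxnP P0 PD) => r /asboolP[B [Bfree BE]] rmax.
exists r, B; split => // e Ee; apply/negPn/negP => eB.
suff /rmax : P (r + 1)%N by rewrite addn1 ltnn.
apply/asboolP; exists (col_mx B e); split.
  rewrite -row_leq_rank -addsmxE (leq_trans (n := (\rank B).+1)) //.
    by rewrite addn1 ltnS row_leq_rank.
  apply: rank_ltmx.
  by rewrite ltmxE addsmxSl addsmx_sub submx_refl.
move=> i; case: (split_ordP i) => k ->.
  by rewrite -row_usubmx col_mxKu.
rewrite -row_dsubmx col_mxKd; have -> // : row k e = e.
by apply/rowP => j; rewrite mxE ord1.
Qed.

(** The images of [q] under reflections close to a fixed one fill only a small part of the sphere.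
    Every point of the sphere is the image of [q] under some reflection, so the vanishing is
    continued along the line from [v0] to the vector [u] of that reflection. *)
Lemma eq0_on_sphere (R : realType) (d t : nat) (P : mpoly d.+1 R)
    (q v0 : 'rV[R]_d.+1) (U : set 'rV[R]_d.+1) :
  (1 < d)%N -> (msize P <= t.+1)%N -> dot q q = 1 -> v0 != 0 -> nbhs v0 U ->
  (forall v, U v -> v != 0 -> polyfun P (q *m refl v) = 0) ->
  forall x, dot x x = 1 -> polyfun P x = 0.
Proof.
move=> d2 Pt q1 v00 Uv0 PU x x1.
have [u u0 <-] : exists2 u, u != 0 & q *m refl u = x.
  (* The point [q] itself is fixed by the reflection in a vector orthogonal to it. *)
  have [<-|qx] := eqVneq q x; last first.
    by exists (q - x); rewrite ?subr_eq0 // refl_swap // q1 x1.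
  have [w [w1 qw _]] := exists_orthogonal q q d2.
  exists w; first by rewrite -dot_eq0 w1 oner_neq0.
  by rewrite mul_refl qw mulr0 mul0r scale0r subr0.
(* On a line through [v0], [|v|^(2t) P (q *m refl v)] is a polynomial in the
   parameter, with infinitely many roots. *)
pose w := u - v0; pose v (c : R) := v0 + c *: w.
pose V i : {poly R} := (v0 ord0 i)%:P + (w ord0 i) *: 'X.
have VE i c : (V i).[c] = v c ord0 i by rewrite !hornerE !mxE mulrC.
pose N : {poly R} := \sum_i V i * V i.
pose S : {poly R} := \sum_i (q ord0 i) *: V i.
(* [Y i] is |v|^2 times coordinate [i] of [q *m refl v]; in [G], the factor [N ^+ (t - mdeg m)]
   brings every monomial to the common denominator |v|^(2t). *)
pose Y i : {poly R} := q ord0 i *: N - 2 *: (S * V i).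
pose G : {poly R} := \sum_(m <- msupp P)
  mcoeff m P *: (N ^+ (t - mdeg m) * \prod_i Y i ^+ m i).
have NE c : N.[c] = dot (v c) (v c).
  by rewrite horner_sum; apply: eq_bigr => i _; rewrite hornerM !VE.
have SE c : S.[c] = dot q (v c).
  by rewrite horner_sum; apply: eq_bigr => i _; rewrite hornerZ !VE.
have GE c : v c != 0 -> G.[c] = dot (v c) (v c) ^+ t * polyfun P (q *m refl (v c)).
  move=> vc0; have vv : dot (v c) (v c) != 0 by rewrite dot_eq0.
  rewrite horner_sum /polyfun mevalE mulr_sumr [LHS]big_seq [RHS]big_seq.
  apply: eq_bigr => m mP; have mt : (mdeg m <= t)%N.
    by rewrite -ltnS (leq_trans _ Pt) // msize_mdeg_lt.
  rewrite hornerZ hornerM horner_exp NE horner_prod [RHS]mulrCA; congr (_ * _).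
  have -> : dot (v c) (v c) ^+ t = dot (v c) (v c) ^+ (t - mdeg m) * dot (v c) (v c) ^+ mdeg m.
    by rewrite -exprD subnK.
  rewrite -mulrA; congr (_ * _).
  rewrite mdegE -prodrXr -big_split; apply: eq_bigr => i _ /=.
  rewrite horner_exp -exprMn; congr (_ ^+ _).
  rewrite /Y hornerD hornerN !hornerZ hornerM NE SE VE mul_refl.
  have E (a b : 'rV[R]_d.+1) k : (a - k *: b) ord0 i = a ord0 i - k * b ord0 i.
    by rewrite !mxE.
  rewrite E.
  by field.
have [e e0 Pe] : exists2 e, 0 < e & forall c, `|c| < e -> v c != 0 /\ U (v c).
  have vcont : v c @[c --> (0 : R)] --> v0.
    rewrite -[X in _ --> X]addr0 -(scale0r w).
    apply: cvgD; first exact: cvg_cst.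
    by apply: cvgZr_tmp; exact: cvg_id.
  have : \forall c \near (0 : R), v c != 0 /\ U (v c).
    by near=> c; split; near: c; [exact: cvgr_neq0 vcont v00|exact: vcont].
  move=> /nbhs_ballP[e /= e0 eP]; exists e => // c ce; apply: eP.
  by rewrite /ball /= sub0r normrN.
have G0 : G = 0.
  apply: (@poly_eq0_roots _ _ (fun k => e / k.+2%:R)) => [k l|k].
    move=> /(mulfI (lt0r_neq0 e0)) /invr_inj /eqP.
    by rewrite eqr_nat => /eqP [].
  have [|v1 v2] := Pe (e / k.+2%:R).
    by rewrite ger0_norm ?divr_ge0 ?ltW // ltr_pdivrMr // ltr_pMr // ltr1n.
  by rewrite GE // PU // mulr0.
have v1 : v 1 = u by rewrite /v scale1r /w subrKC.
have := GE 1; rewrite v1 G0 horner0 => /(_ u0) /esym/eqP.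
by rewrite mulf_eq0 expf_eq0 dot_eq0 (negbTE u0) andbF => /eqP.
Unshelve. all: by end_near. Qed.

(** The Veronese map: on it, polynomials of degree at most [t] become linear forms, so interpolation
    becomes linear algebra. *)
Definition ev (R : realType) (n t : nat) (x : 'rV[R]_n) :
    'rV[R]_#|{: bmultinom n t.+1}| :=
  \row_i polyfun (mpolyX R (bmnm (enum_val i))) x.

Lemma polyfun_ev (R : realType) (n t : nat) (p : mpoly n R) (x : 'rV[R]_n) :
  (msize p <= t.+1)%N ->
  polyfun p x = \sum_i ev t x ord0 i * mcoeff (bmnm (enum_val i)) p.
Proof.
move=> pt; rewrite {1}(mpolywE pt) /polyfun raddf_sum /=.
rewrite (reindex_onto enum_val enum_rank) => [|m _]; last exact: enum_rankK.
apply: eq_big => [i|i _]; first by rewrite enum_valK eqxx.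
by rewrite mxE mevalZ mulrC.
Qed.

Lemma cvg_dot (R : realType) (n : nat) (T : Type) (F : set_system T)
    {FF : Filter F} (f g : T -> 'rV[R]_n) (a b : 'rV[R]_n) :
  f x @[x --> F] --> a -> g x @[x --> F] --> b ->
  dot (f x) (g x) @[x --> F] --> dot a b.
Proof.
move=> fa gb; apply: cvg_sum => i; apply: cvgM.
- exact: (cvg_comp _ _ fa (@continuous_coord R n i a)).
- exact: (cvg_comp _ _ gb (@continuous_coord R n i b)).
Qed.

Lemma continuous_refl (R : realType) (n : nat) (q v0 : 'rV[R]_n.+1) : v0 != 0 ->
  q *m refl v @[v --> v0] --> q *m refl v0.
Proof.
move=> v00; rewrite mul_refl.
have -> : (fun v => q *m refl v) = fun v => q - (2 * dot q v / dot v v) *: v.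
  by apply/funext => v; exact: mul_refl.
have dq : dot q v @[v --> v0] --> dot q v0.
  by apply: (@cvg_dot _ _ _ (nbhs v0)); [apply: cvg_cst|apply: cvg_id].
have dv : dot v v @[v --> v0] --> dot v0 v0.
  by apply: (@cvg_dot _ _ _ (nbhs v0)); apply: cvg_id.
have kc : 2 * dot q v / dot v v @[v --> v0] --> 2 * dot q v0 / dot v0 v0.
  have vv0 : dot v0 v0 != 0 by rewrite dot_eq0.
  exact: cvgM (cvgMr dq) (cvgV vv0 dv).
have qc : (q : 'rV[R]_n.+1) @[v --> v0] --> q by apply: (@cvg_cst _ q _ (nbhs v0)).
exact: cvgB qc (cvgZ kc (@cvg_id _ (nbhs v0))).
Qed.

Lemma dot_refl (R : realType) (n : nat) (q v : 'rV[R]_n) : v != 0 ->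
  dot (q *m refl v) (q *m refl v) = dot q q.
Proof. by move=> v0; rewrite dotM -mulmxA refl_orthogonal // mulmx1. Qed.

(** A linear form vanishing on [ev] of all nearby images of [q j0] is a polynomial vanishing on the
    whole sphere. Hence a basis of the whole span can be chosen among these images, with reflections
    as close to each other as desired. *)
Lemma spanning_cluster (R : realType) (d t : nat) (J : finType)
    (q : J -> 'rV[R]_d.+1) (j0 : J) (e : R) :
  (1 < d)%N -> (forall j, dot (q j) (q j) = 1) -> 0 < e ->
  exists r (B : 'M[R]_(r, #|{: bmultinom d.+1 t.+1}|)) (v : nat -> 'rV[R]_d.+1),
  [/\ row_free B, (forall l, v l != 0),
      forall l, row l B = ev t (q j0 *m refl (v l)),
      forall x, dot x x = 1 -> (ev t x <= B)%MS &
      forall j l l', 1 - e < dot (q j *m refl (v l)) (q j *m refl (v l'))].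
Proof.
move=> d1 q1 e0; pose v0 : 'rV[R]_d.+1 := delta_mx ord0 ord0.
have v00 : v0 != 0 by rewrite -dot_eq0 dot_delta mxE !eqxx oner_neq0.
pose g j v := q j *m refl v - q j *m refl v0.
pose U := [set v | v != 0 /\ forall j, dot (g j v) (g j v) < e / 2].
have Uv0 : nbhs v0 U.
  suff : \forall v \near v0, v != 0 /\ forall j, dot (g j v) (g j v) < e / 2 by [].
  near=> v; split; first by near: v; exact: (@cvgr_neq0 _ _ _ (nbhs v0) _ id v0 cvg_id v00).
  near: v; apply: filter_forall => j.
  have : dot (g j v) (g j v) @[v --> v0] --> dot (g j v0) (g j v0).
    by apply: (@cvg_dot _ _ _ (nbhs v0));
      (apply: cvgB; [exact: continuous_refl|apply: cvg_cst]).
  have -> : dot (g j v0) (g j v0) = 0 by apply/eqP; rewrite dot_eq0 /g subrr.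
  by move=> /cvgr_lt; apply; rewrite divr_gt0.
pose E := [set y | exists2 v, U v & y = ev t (q j0 *m refl v)].
have [r [B [Bfree BE EB]]] := maximal_free_rows E.
have /choice[v vP] : forall l : nat, exists v, U v /\ forall k : 'I_r,
    k = l :> nat -> row k B = ev t (q j0 *m refl v).
  move=> l.
  have [lr|rl] := ltnP l r.
    have [v Uv vE] := BE (Ordinal lr); exists v; split => // k kl.
    by rewrite -vE; congr (row _ _); apply: val_inj.
  (* Indices from [r] on get [v0], which lies in [U], so closeness holds for all indices. *)
  exists v0; split; first exact: (nbhs_singleton Uv0).
  by move=> k kl; have := ltn_ord k; rewrite kl ltnNge rl.
exists r, B, v; split => //.
- by move=> l; have [[]] := vP l.
- by move=> l; have [_ ->] := vP l.
- move=> x x1; rewrite submxE; apply/eqP/rowP => k; rewrite [RHS]mxE.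
  (* Membership in the row space of [B] means being killed by every column of [cokermx B], and each
     column is the coefficient list of a polynomial. *)
  pose P : mpoly d.+1 R := \sum_i cokermx B i k *: mpolyX R (bmnm (enum_val i)).
  have PE y : polyfun P y = (ev t y *m cokermx B) ord0 k.
    rewrite mxE /polyfun raddf_sum /=; apply: eq_bigr => i _.
    by rewrite mevalZ mulrC; congr (_ * _); rewrite /ev mxE.
  rewrite -PE; apply: (@eq0_on_sphere R d t P (q j0) v0 U) => //.
    rewrite /P; elim/big_ind: _ => [|p p' ps ps'|i _].
    - by rewrite msize0.
    - by rewrite (leq_trans (msizeD_le _ _)) // geq_max ps.
    - rewrite (leq_trans (msizeZ_le _ _)) // msizeX.
      by case: (enum_val i) => m /=.
  move=> v' Uv' _; rewrite PE.
  have /submxP[c ->] : (ev t (q j0 *m refl v') <= B)%MS by apply: EB; exists v'.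
  by rewrite -mulmxA mulmx_coker mulmx0 mxE.
- move=> j l l'; set a := _ *m _; set b := _ *m _.
  have [[vl0 /(_ j) gl] _] := vP l; have [[vl'0 /(_ j) gl'] _] := vP l'.
  have aa : dot a a = 1 by rewrite dot_refl // q1.
  have bb : dot b b = 1 by rewrite dot_refl // q1.
  have : a - b = g j (v l) - g j (v l') by rewrite /g opprB addrA subrK.
  move: (g j (v l)) (g j (v l')) gl gl' => x y xe ye ab.
  (* For unit vectors 2 - 2 a.b = |x - y|^2 <= 2 |x|^2 + 2 |y|^2 < 2e. *)
  have := dot_ge0 (x + y); have : dot (a - b) (a - b) = dot (x - y) (x - y) by rewrite ab.
  move: xe ye; rewrite !(dotDl, dotDr, dotNl, dotNr) aa bb (dotC b a) (dotC y x); lra.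
Unshelve. all: by end_near. Qed.

Lemma sum_blocks (R : realType) (m r : nat) (F : nat -> R) :
  \sum_(i < m * r) F i = \sum_(b < m) \sum_(l < r) F (b * r + l)%N.
Proof.
rewrite -(big_mkord xpredT F) big_nat_mul big_mkord; apply: eq_bigr => b _.
rewrite -{1}[(b * r)%N]add0n big_addn mulSn addnK big_mkord.
by apply: eq_bigr => l _; rewrite addnC.
Qed.

(** [Q] lists the points in the order in which the polygon visits them. The points [Q (beta l)] form
    the cluster that determines the polynomials, with [c l] as Lagrange functions; their positive
    masses leave room for corrections. [bad] marks the steps that may be long, the closing one
    included. *)
Lemma robust_design (R : realType) (t : nat) : exists C : nat,
  forall (d : nat) (sigma : probability (borel_rV R d.+1) R),
  (1 < d)%N -> uniform_on_sphere sigma ->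
  exists (M r : nat) (Q : nat -> 'rV[R]_d.+1) (alpha : nat -> R)
    (beta : 'I_r -> nat) (c : 'I_r -> 'rV[R]_d.+1 -> R) (bad : pred nat),
  [/\ [/\ (3 <= M)%N, forall i, dot (Q i) (Q i) = 1 & forall i, 0 <= alpha i],
      [/\ forall l, (beta l < M)%N, injective beta & forall l, 0 < alpha (beta l)],
      [/\ forall l, continuous (c l),
          forall l k, c l (Q (beta k)) = (l == k)%:R &
          forall p x, (msize p <= t.+1)%N -> dot x x = 1 ->
            polyfun p x = \sum_l c l x * polyfun p (Q (beta l))],
      forall p, (msize p <= t.+1)%N ->
        sphere_mean sigma p = \sum_(i < M) alpha i * polyfun p (Q i) &
      [/\ \sum_(i < M) (bad i)%:R <= (C * d.+1 ^ t.-1)%:R :> R, bad M.-1 &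
          forall i, ~~ bad i -> cos (M.+1%:R^-1) < dot (Q i) (Q i.+1)]].
Proof.
have [C CP] := sphere_design R t.
exists (4 * C)%N => d sigma d1 us.
have [J [q [a [cJ q1 [a0 [j0 aj0]] qD]]]] := CP d sigma us.
pose D := #|{: bmultinom d.+1 t.+1}|.
(* Each point and its antipode are both visited twice: two visits would do for exactness, but four
   guarantee the three vertices that a polygon needs. *)
pose m := (4 * #|J|)%N.
(* The closeness inside clusters must be fixed before [r] is known, so the number [m * r] of points
   is replaced by this upper bound. *)
pose M' := (m * D)%N.
have J0 : (0 < #|J|)%N by apply/card_gt0P; exists j0.
have e0 : 0 < 1 - cos (M'.+1%:R^-1) :> R.
  have M0 : (0 : R) < M'.+1%:R^-1 by rewrite invr_gt0 ltr0Sn.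
  have M1' : M'.+1%:R^-1 <= 1 :> R by rewrite invf_le1 ?ltr0Sn // ler1n.
  have M2 : M'.+1%:R^-1 <= pi :> R by rewrite (le_trans M1') // (le_trans _ (pi_ge2 R)) // ler1n.
  by rewrite subr_gt0 -[X in _ < X]cos0 ltr_cos ?in_itv /= ?lexx ?pi_ge0 ?M2 ?(ltW M0).
have [r [B [v [Bfree v0 BE spanB close]]]] := spanning_cluster t j0 d1 q1 e0.
(* The constant monomial makes [ev] nonzero at every point. *)
have r0 : (0 < r)%N.
  rewrite lt0n; apply/eqP => r0.
  have B0 : B = 0 by apply/eqP; rewrite -mxrank_eq0 -leqn0 -[X in (_ <= X)%N]r0 rank_leq_row.
  have m0P : (mdeg (@mnm0 d.+1) < t.+1)%N by rewrite mdeg0.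
  have /submxP[c] := spanB _ (q1 j0); rewrite B0 mulmx0 => /rowP /(_ (enum_rank (BMultinom m0P))).
  rewrite !mxE enum_rankK /= mpolyX0.
  by rewrite /polyfun meval1 => /eqP; rewrite oner_eq0.
have rD : (r <= D)%N by rewrite -(eqP Bfree) rank_leq_col.
pose M := (m * r)%N.
(* Point [i] is the [i %% r]-th point of the cluster [i %/ r], and only the
   steps from one cluster to the next are long. *)
pose jb b := nth j0 (enum J) (b %/ 4).
pose Q i := (-1) ^+ (i %/ r) *: (q (jb (i %/ r)%N) *m refl (v (i %% r)%N)).
pose alpha i := a (jb (i %/ r)%N) / (2 * r%:R).
pose beta (l : 'I_r) := ((4 * index j0 (enum J)) * r + l)%N.
(* The coordinates of [ev t x] in the basis given by the rows of [B]. *)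
pose c (l : 'I_r) x := (ev t x *m pinvmx B) ord0 l.
pose bad i := ((i.+1 %% r)%N == 0%N).
have div_beta l : (beta l %/ r = 4 * index j0 (enum J))%N.
  by rewrite /beta divnMDl // divn_small ?addn0.
have mod_beta (l : 'I_r) : (beta l %% r = l)%N.
  by rewrite /beta modnMDl modn_small.
have Qbeta (l : 'I_r) : Q (beta l) = q j0 *m refl (v l).
  rewrite /Q div_beta mod_beta /jb mulKn // nth_index ?mem_enum //.
  by rewrite -signr_odd oddM expr0 scale1r.
exists M, r, Q, alpha, beta, c, bad; split.
- split.
  + by rewrite /M /m (leq_trans (n := 4)) // -mulnA leq_pmulr // muln_gt0 J0.
  + move=> i; rewrite /Q dotZl dotZr dot_refl // q1 mulr1 -expr2 -exprM mulnC.
    by rewrite exprM sqrrN expr1n expr1n.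
  + by move=> i; rewrite divr_ge0 ?a0.
- split.
  + move=> l; apply: (@leq_trans ((4 * index j0 (enum J)).+1 * r)).
      by rewrite mulSn addnC ltn_add2l.
    by rewrite leq_mul2r ltn_pmul2l // cardE index_mem mem_enum orbT.
  + by move=> l k; rewrite /beta => /addnI /val_inj.
  + by move=> l; rewrite /alpha div_beta /jb mulKn // nth_index ?mem_enum // divr_gt0 // mulr_gt0 ?ltr0n.
- split.
  + move=> l; have -> : c l = fun x => \sum_i
        polyfun (mpolyX R (bmnm (enum_val i))) x * pinvmx B i l.
      by apply/funext => x; rewrite /c mxE; apply: eq_bigr => i _; rewrite mxE.
    move=> x; apply: (@cvg_sum _ _ (nbhs x)) => i.
    by apply: cvgMr_tmp; exact: continuous_polyfun.
  + move=> l k; rewrite Qbeta /c -BE -row_mul.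
    have -> : B *m pinvmx B = 1%:M by apply: mulmxVp.
    by rewrite !mxE eq_sym.
  + move=> p x pt x1; rewrite (polyfun_ev _ pt).
    have := mulmxKpV (spanB x x1) => xE.
    rewrite -xE.
    under eq_bigr do rewrite mxE mulr_suml.
    rewrite exchange_big /=; apply: eq_bigr => l _.
    rewrite Qbeta (polyfun_ev _ pt) mulr_sumr; apply: eq_bigr => i _.
    by rewrite -BE [row _ _ _ _]mxE mulrA.
- move=> p pt.
  have r0' : r%:R != 0 :> R by rewrite pnatr_eq0 -lt0n.
  rewrite /M (sum_blocks m r (fun i => alpha i * polyfun p (Q i))).
  pose G b := \sum_(l < r) a (jb b) / (2 * r%:R) *
    polyfun p ((-1) ^+ b *: (q (jb b) *m refl (v l))).
  have -> : \sum_(b < m) \sum_(l < r) alpha (b * r + l)%N * polyfun p (Q (b * r + l)%N) =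
      \sum_(b < m) G b.
    apply: eq_bigr => b _; apply: eq_bigr => l _.
    by rewrite /alpha /Q divnMDl // divn_small // addn0 modnMDl modn_small.
  have GE (k : 'I_#|J|) : \sum_(e < 4) G (k * 4 + e)%N =
      \sum_(l < r) a (enum_val k) / r%:R *
      (polyfun p (q (enum_val k) *m refl (v l)) + polyfun p (- (q (enum_val k) *m refl (v l)))).
    have sgnE e : (-1) ^+ (k * 4 + e) = (-1) ^+ e :> R.
      by rewrite exprD -[X in X * _]signr_odd oddM andbF mul1r.
    have jbE e : (e < 4)%N -> jb (k * 4 + e)%N = enum_val k.
      by move=> e4; rewrite /jb divnMDl // divn_small // addn0 -enum_val_nth.
    rewrite !big_ord_recl big_ord0 addr0 /G -!big_split; apply: eq_bigr => l _ /=.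
    rewrite !jbE // !sgnE /bump /= !expr0 !expr1 exprS expr1 mulN1r opprK.
    rewrite exprS sqrrN expr1n mulr1 !scale1r !scaleN1r.
    by field.
  rewrite /m mulnC (sum_blocks #|J| 4 G) (eq_bigr _ (fun k _ => GE k)) exchange_big /=.
  transitivity (\sum_(l < r) r%:R^-1 * sphere_mean sigma p).
    by rewrite sumr_const card_ord -[X in _ = X]mulr_natl mulrA divff // mul1r.
  apply: eq_bigr => l _; rewrite (qD (refl (v l)) (refl_orthogonal (v0 l)) p pt) mulr_sumr.
  rewrite (big_enum_val (A := J) (fun j => r%:R^-1 * (a j * (polyfun p (q j *m refl (v l)) +
    polyfun p (- (q j *m refl (v l))))))).
  by apply: eq_bigr => k _; rewrite mulrA [r%:R^-1 * _]mulrC.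
- split.
  + rewrite /M (sum_blocks m r (fun i => (bad i)%:R)).
    apply: (@le_trans _ _ (\sum_(b < m) (1 : R))).
      apply: ler_sum => b _.
      have lr : (r.-1 < r)%N by rewrite prednK.
      rewrite (bigD1 (Ordinal lr)) //= big1 => [|l /eqP ll].
        by rewrite addr0 lern1 leq_b1.
      rewrite /bad -addnS modnMDl; case: eqP => // lr0; case: ll; apply: val_inj => /=.
      have : (l.+1 <= r)%N by [].
      rewrite leq_eqVlt => /orP[/eqP /(congr1 predn) //|l1r].
      by move: lr0; rewrite modn_small.
    by rewrite sumr_const card_ord ler_nat /m -mulnA leq_mul2l cJ orbT.
  + by rewrite /bad prednK ?modnMl // muln_gt0 /m muln_gt0 J0.
  + move=> i; rewrite /bad => ib.
    have [E1 E2] : (i.+1 %/ r = i %/ r)%N /\ (i.+1 %% r = (i %% r).+1)%N.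
      have iE : i.+1 = (i %/ r * r + (i %% r).+1)%N by rewrite addnS -divn_eq.
      have := ltn_pmod i r0; rewrite leq_eqVlt => /orP[/eqP lr|lr].
        by move: ib; rewrite iE lr -mulSnr modnMl.
      by split; rewrite iE; [rewrite divnMDl // (divn_small lr) addn0|rewrite modnMDl (modn_small lr)].
    rewrite /Q E1 E2 dotZl dotZr mulrA -expr2 -exprM mulnC exprM sqrrN !expr1n mul1r.
    apply: le_lt_trans (close _ _ _).
    rewrite opprB subrKC.
    have Mi (k : nat) : (0 : R) < k.+1%:R^-1 by rewrite invr_gt0 ltr0Sn.
    have Mpi (k : nat) : k.+1%:R^-1 <= pi :> R.
      apply: (@le_trans _ _ 1); first by rewrite invf_le1 ?ltr0Sn // ler1n.
      by apply: le_trans (pi_ge2 R); rewrite ler1n.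
    rewrite leNgt ltr_cos ?in_itv /= ?Mpi ?(ltW (Mi _)) // -leNgt.
    by rewrite lef_pV2 ?posrE ?ltr0Sn // ler_nat ltnS leq_mul2l rD orbT.
Qed.

(* The cross product of the first three coordinates. *)
Definition cross (R : realType) (d : nat) (a b : 'rV[R]_d.+1) : 'rV[R]_d.+1 :=
  let e k : 'I_d.+1 := inord k in
  (a ord0 (e 1) * b ord0 (e 2) - a ord0 (e 2) * b ord0 (e 1)) *: delta_mx ord0 (e 0) +
  (a ord0 (e 2) * b ord0 (e 0) - a ord0 (e 0) * b ord0 (e 2)) *: delta_mx ord0 (e 1) +
  (a ord0 (e 0) * b ord0 (e 1) - a ord0 (e 1) * b ord0 (e 0)) *: delta_mx ord0 (e 2).

Lemma dot_cross (R : realType) (d : nat) (a b c : 'rV[R]_d.+1) :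
  let e k : 'I_d.+1 := inord k in
  dot (cross a b) c =
    (a ord0 (e 1) * b ord0 (e 2) - a ord0 (e 2) * b ord0 (e 1)) * c ord0 (e 0) +
    (a ord0 (e 2) * b ord0 (e 0) - a ord0 (e 0) * b ord0 (e 2)) * c ord0 (e 1) +
    (a ord0 (e 0) * b ord0 (e 1) - a ord0 (e 1) * b ord0 (e 0)) * c ord0 (e 2).
Proof. by rewrite /= /cross !dotDl !dotZl !(dotC (delta_mx _ _)) !dot_delta. Qed.

Lemma dot_crossl (R : realType) (d : nat) (a b : 'rV[R]_d.+1) :
  dot (cross a b) a = 0.
Proof. by rewrite dot_cross; ring. Qed.

Lemma dot_crossr (R : realType) (d : nat) (a b : 'rV[R]_d.+1) :
  dot (cross a b) b = 0.
Proof. by rewrite dot_cross; ring. Qed.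

Lemma dot_crossZ (R : realType) (d : nat) (a b c : 'rV[R]_d.+1) (x y z : R) :
  dot (cross (x *: a) (y *: b)) (z *: c) = x * y * z * dot (cross a b) c.
Proof. by rewrite !dot_cross !mxE; ring. Qed.

Definition normalize (R : realType) (n : nat) (x : 'rV[R]_n) : 'rV[R]_n :=
  (Num.sqrt (dot x x))^-1 *: x.

Lemma dot_normalize (R : realType) (n : nat) (x : 'rV[R]_n) : x != 0 ->
  dot (normalize x) (normalize x) = 1.
Proof.
move=> x0; rewrite /normalize dotZl dotZr mulrA -expr2 exprVn sqr_sqrtr ?dot_ge0 //.
by rewrite mulVf // dot_eq0.
Qed.

(* The points [z i] of the moment curve are in general position, hence so are
   the perturbations [mu Q i + z i] for all but finitely many [mu]. *)
Lemma generic_family (R : realType) (d M : nat) (Q : nat -> 'rV[R]_d.+1) :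
  (1 < d)%N -> (3 <= M)%N -> (forall i, dot (Q i) (Q i) = 1) ->
  exists x : R -> nat -> 'rV[R]_d.+1,
    (forall i, x mu i @[mu --> +oo] --> Q i) /\
    forall E : set R, (\forall mu \near +oo, E mu) -> exists mu, [/\ E mu,
      forall i, (i < M)%N -> dot (x mu i) (x mu i) = 1 &
      forall i j k, (i < M)%N -> (j < M)%N -> (k < M)%N -> uniq [:: i; j; k] ->
        dot (cross (x mu i) (x mu j)) (x mu k) != 0].
Proof.
move=> d1 M3 Q1; pose e k : 'I_d.+1 := inord k.
pose z (i : nat) : 'rV[R]_d.+1 := \row_k i%:R ^+ k.
have zE i k : (k < 3)%N -> z i ord0 (e k) = i%:R ^+ k.
  by move=> k3; rewrite mxE inordK // (leq_trans k3).
exists (fun mu i => normalize (Q i + mu^-1 *: z i)); split.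
  move=> i.
  have y : Q i + mu^-1 *: z i @[mu --> +oo] --> Q i.
    rewrite -[X in _ --> X]addr0 -(scale0r (z i)).
    apply: cvgD; first by apply: (@cvg_cst _ (Q i) _ +oo).
    apply: cvgZr_tmp; apply/(@gtr0_cvgV0 R R +oo _ id); last exact: cvg_id.
    exact: nbhs_pinfty_gt.
  have n : (Num.sqrt (dot (Q i + mu^-1 *: z i) (Q i + mu^-1 *: z i)))^-1 @[mu --> +oo] --> (1 : R).
    rewrite -[X in _ --> X]invr1; apply: cvgV; first exact: oner_neq0.
    rewrite -[X in _ --> X]sqrtr1 -(Q1 i).
    apply: (@cvg_comp _ _ _ _ Num.sqrt _ _ _ (cvg_dot y y)).
    exact: sqrt_continuous.
  by rewrite -[X in _ --> X]scale1r; exact: cvgZ n y.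
move=> E [N [_ EN]].
have [V VE] : exists V : nat -> nat -> {poly R}, forall i k mu, (k < 3)%N ->
    (V i k).[mu] = (mu *: Q i + z i) ord0 (e k).
  exists (fun i k => Q i ord0 (e k) *: 'X + (i%:R ^+ k)%:P) => i k mu k3.
  by rewrite !hornerE -(zE i) // !mxE mulrC.
pose D i j l : {poly R} :=
  (V i 1 * V j 2 - V i 2 * V j 1) * V l 0 + (V i 2 * V j 0 - V i 0 * V j 2) * V l 1 +
  (V i 0 * V j 1 - V i 1 * V j 0) * V l 2.
pose P : {poly R} := \prod_(i < M) \prod_(j < M)
  \prod_(l < M | uniq [:: nat_of_ord i; nat_of_ord j; nat_of_ord l]) D i j l.
have DE i j l mu : (D i j l).[mu] =
    dot (cross (mu *: Q i + z i) (mu *: Q j + z j)) (mu *: Q l + z l).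
  by rewrite dot_cross /D !(hornerD, hornerN, hornerM) !VE.
have P0 : P != 0.
  apply/prodf_neq0 => i _; apply/prodf_neq0 => j _; apply/prodf_neq0 => l ijl.
  (* At mu = 0 the determinant is the Vandermonde determinant of i, j and l. *)
  apply/eqP => D0; have := DE i j l 0; rewrite D0 horner0 !scale0r !add0r dot_cross !zE //.
  rewrite !expr0 !expr1 => /esym H.
  have : (j%:R - i%:R) * (l%:R - i%:R) * (l%:R - j%:R) = 0 :> R by rewrite -H; ring.
  move: ijl; rewrite /= !inE negb_or -!andbA => /and4P[ij il jl _].
  move/eqP; rewrite !mulf_eq0 !subr_eq0 !eqr_nat.
  by rewrite (eq_sym _ (i : nat)) (negbTE ij) eq_sym (negbTE il) eq_sym (negbTE jl).
have [k Pk] : exists k : nat, P.[Num.max N 0 + k.+1%:R] != 0.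
  apply/not_existsP => Pk; move/eqP: P0; apply.
  apply: (@poly_eq0_roots _ _ (fun k => Num.max N 0 + k.+1%:R)) => [k l /addrI /eqP|k].
    by rewrite eqr_nat => /eqP [].
  by apply/eqP/negPn/negP; exact: Pk.
set mu := _ + _ in Pk; exists mu.
have mu0 : 0 < mu by rewrite ltr_wpDl ?le_max ?lexx ?orbT.
have gen i j l : (i < M)%N -> (j < M)%N -> (l < M)%N -> uniq [:: i; j; l] ->
    dot (cross (Q i + mu^-1 *: z i) (Q j + mu^-1 *: z j)) (Q l + mu^-1 *: z l) != 0.
  move=> iM jM lM ijl.
  have E' k' : Q k' + mu^-1 *: z k' = mu^-1 *: (mu *: Q k' + z k').
    by rewrite scalerDr scalerA mulVf ?gt_eqF // scale1r.
  have muV : mu^-1 != 0 by rewrite invr_neq0 // gt_eqF.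
  rewrite !E' dot_crossZ -DE; apply: mulf_neq0; first by rewrite !mulf_neq0.
  apply: contra Pk => /eqP Dk; rewrite /P horner_prod (bigD1 (Ordinal iM)) //=.
  rewrite horner_prod (bigD1 (Ordinal jM)) //= horner_prod (bigD1 (Ordinal lM)) //=.
  by rewrite Dk !mul0r.
(* A vector that belongs to a triple with nonzero determinant is nonzero; such a triple exists since
   [3 <= M]. *)
have nz i : (i < M)%N -> Q i + mu^-1 *: z i != 0.
  move=> iM.
  have [j [l [jM lM ijl]]] : exists j l, [/\ (j < M)%N, (l < M)%N & uniq [:: i; j; l]].
    move: M3; case: M iM {P Pk P0 gen mu mu0} => [|[|[|M']]] // _ _.
    case: i => [|[|i]].
    - by exists 1%N, 2%N.
    - by exists 0%N, 2%N.
    - by exists 0%N, 1%N.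
  apply: contra_neq (gen _ _ _ iM jM lM ijl) => ->.
  by rewrite dot_cross !mxE; ring.
split.
- by apply: EN; rewrite /mu ltr_pwDr ?ltr0Sn // le_max lexx.
- by move=> i iM; exact/dot_normalize/nz.
- move=> i j l iM jM lM ijl; rewrite /normalize dot_crossZ mulf_neq0 ?gen //.
  have s0 k' : (k' < M)%N -> (Num.sqrt (dot (Q k' + mu^-1 *: z k') (Q k' + mu^-1 *: z k')))^-1 != 0.
    by move=> kM; rewrite invr_neq0 // gt_eqF // sqrtr_gt0 lt_neqAle dot_ge0 eq_sym dot_eq0 nz.
  by rewrite !mulf_neq0 ?s0.
Qed.

(** * A closed curve made of circular arcs *)

(** Uniform motion on a circle with centre [c]. With free frequency and phase the family is closed
    under differentiation, so smoothness is immediate, and under affine changes of the parameter. *)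
Definition trig (R : realType) (n : nat) (c a b : 'rV[R]_n) (w p s : R) : 'rV[R]_n :=
  c + cos (w * s + p) *: a + sin (w * s + p) *: b.

Lemma is_derive_trig_coord (R : realType) (c a b w p x : R) :
  is_derive x (1 : R) (fun s => c + cos (w * s + p) * a + sin (w * s + p) * b)
    (cos (w * x + p) * (w * b) + sin (w * x + p) * (- w * a)).
Proof.
have dl : is_derive x (1 : R) (fun s => w * s + p) w.
  have := is_deriveD (is_deriveZ w (is_derive_id x (1 : R))) (is_derive_cst p x (1 : R)).
  by rewrite /GRing.scale /= mulr1 addr0.
have dc := @is_derive1_comp R (@cos R) (fun s => w * s + p) x _ _ (is_derive_cos _) dl.
have ds := @is_derive1_comp R (@sin R) (fun s => w * s + p) x _ _ (is_derive_sin _) dl.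
have := is_deriveD (is_deriveD (is_derive_cst c x (1 : R)) (is_deriveZ a dc)) (is_deriveZ b ds).
set f := (X in is_derive _ _ X _); set g := (X in is_derive _ _ _ X -> _).
set f' := (X in _ -> is_derive _ _ X _); set g' := (X in _ -> is_derive _ _ _ X).
have -> : f' = f.
  by apply/funext => s; rewrite /f /f' !fctE /= /GRing.scale /=; ring.
by have -> : g' = g by rewrite /g /g' /GRing.scale /=; ring.
Qed.

Lemma derivable_trig (R : realType) (n : nat) (c a b : 'rV[R]_n) (w p x : R) :
  derivable (trig c a b w p : R -> 'rV[R]_n) x 1.
Proof.
apply/derivable_mxP => i j; rewrite (ord1 i).
have -> : (fun t => trig c a b w p t ord0 j) = fun s =>
    c ord0 j + cos (w * s + p) * a ord0 j + sin (w * s + p) * b ord0 j.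
  by apply/funext => s; rewrite !mxE.
by have [] := is_derive_trig_coord (c ord0 j) (a ord0 j) (b ord0 j) w p x.
Qed.

Lemma derive1_trig (R : realType) (n : nat) (c a b : 'rV[R]_n.+1) (w p : R) :
  derive1 (trig c a b w p) = trig 0 (w *: b) (- w *: a) w p.
Proof.
apply/funext => x; rewrite derive1E derive_mx; last exact: derivable_trig.
apply/rowP => j; rewrite [LHS]mxE.
have d := is_derive_trig_coord (c ord0 j) (a ord0 j) (b ord0 j) w p x.
have -> : (fun t => trig c a b w p t ord0 j) = fun s =>
    c ord0 j + cos (w * s + p) * a ord0 j + sin (w * s + p) * b ord0 j.
  by apply/funext => s; rewrite !mxE.
by rewrite derive_val !mxE add0r.
Qed.

Lemma smooth_trig (R : realType) (n : nat) (c a b : 'rV[R]_n.+1) (w p x : R) :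
  smooth_at (trig c a b w p) x.
Proof.
move=> k; suff [c' [a' [b' ->]]] : exists c' a' b',
    derive1n k (trig c a b w p) = trig c' a' b' w p by exact: derivable_trig.
elim: k => [|k [c' [a' [b' IH]]]]; first by exists c, a, b.
by rewrite derive1nS IH derive1_trig; do 3 eexists.
Qed.

Lemma continuous_trig (R : realType) (n : nat) (c a b : 'rV[R]_n.+1) (w p : R) :
  continuous (trig c a b w p).
Proof.
move=> x; apply/differentiable_continuous/derivable1_diffP.
exact: derivable_trig.
Qed.

Lemma cos_eq1 (R : realType) (t : R) : cos t = 1 -> `|t| < pi *+ 2 -> t = 0.
Proof.
move=> ct tpi; apply/eqP; rewrite -normr_eq0 eq_le normr_ge0 andbT leNgt; apply/negP => t0.
have : sin (`|t| / 2) = 0.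
  have := cos_mulr2n (`|t| / 2); rewrite [X in cos X]mulr2n -splitr cos_norm ct => H.
  have : sin (`|t| / 2) ^+ 2 = 0 by rewrite sin2cos2; move: H; rewrite mulr2n; lra.
  by move/eqP; rewrite expf_eq0 => /andP[_ /eqP].
apply/eqP; rewrite gt_eqF // sin_gt0_pi // divr_gt0 //=.
by rewrite ltr_pdivrMr // mulr_natr.
Qed.

Lemma cos_sin_inj (R : realType) (x y : R) : 0 <= x < pi *+ 2 -> 0 <= y < pi *+ 2 ->
  cos x = cos y -> sin x = sin y -> x = y.
Proof.
move=> /andP[x0 x1] /andP[y0 y1] cxy sxy; apply/eqP; rewrite -subr_eq0; apply/eqP.
apply: cos_eq1; last by rewrite ltr_norml; apply/andP; split; lra.
by rewrite cosB cxy sxy -!expr2 cos2Dsin2.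
Qed.

Lemma finite_injective_to (T T' : pointedType) (X : set T) (Y : set T') (f : T -> T') :
  finite_set Y -> (forall x, X x -> Y (f x)) ->
  (forall x y, X x -> X y -> f x = f y -> x = y) -> finite_set X.
Proof.
move=> fY XY finj.
pose g y := xget point [set x | X x /\ f x = y].
apply: (@sub_finite_set _ _ (g @` Y)); last exact: finite_image.
move=> x Xx; exists (f x); first exact: XY.
have [Xg fg] : X (g (f x)) /\ f (g (f x)) = f x.
  by rewrite /g; case: xgetP => [y _ //|/(_ x)[]].
exact: finj.
Qed.

Lemma finite_quadratic (R : realType) (p q s : R) : p != 0 ->
  finite_set [set u : R | p * u ^+ 2 + q * u + s = 0].
Proof.
move=> p0; case: (EM (exists u, p * u ^+ 2 + q * u + s = 0)) => [[u pu]|H]; last first.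
  by rewrite (_ : [set _ | _] = set0) //; apply/seteqP; split => // u pu; apply: H; exists u.
apply: (@sub_finite_set _ _ [set u; - q / p - u]); last exact: finite_set2.
move=> v /= pv; have /eqP : (v - u) * (p * (v + u) + q) = 0.
  by transitivity ((p * v ^+ 2 + q * v + s) - (p * u ^+ 2 + q * u + s)); [ring|rewrite pv pu subrr].
rewrite mulf_eq0 subr_eq0 => /orP[/eqP ->|/eqP E]; [by left|right].
by apply: (mulfI p0); rewrite mulrBr mulrCA divff // mulr1; lra.
Qed.

(** Eliminating either of cos x and sin x by means of cos^2 + sin^2 = 1 leaves a quadratic equation
    for the other, and the pair determines x. *)
Lemma finite_line_circle (R : realType) (p q s : R) : [|| p != 0, q != 0 | s != 0] ->
  finite_set [set x : R | 0 <= x < pi *+ 2 /\ p * cos x + q * sin x + s = 0].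
Proof.
move=> pqs.
have [/andP[/eqP p0 /eqP q0]|pq] := boolP ((p == 0) && (q == 0)).
  move: pqs; rewrite p0 q0 eqxx /= => s0; rewrite (_ : [set _ | _] = set0) //.
  by apply/seteqP; split => // x [_]; rewrite !mul0r !add0r => s0'; move: s0; rewrite s0' eqxx.
have n0 : p ^+ 2 + q ^+ 2 != 0.
  rewrite paddr_eq0 ?sqr_ge0 // !expf_eq0 /=; exact: pq.
pose U := [set u : R | (p ^+ 2 + q ^+ 2) * u ^+ 2 + (2 * p * s) * u + (s ^+ 2 - q ^+ 2) = 0].
pose V := [set u : R | (p ^+ 2 + q ^+ 2) * u ^+ 2 + (2 * q * s) * u + (s ^+ 2 - p ^+ 2) = 0].
pose X := [set x : R | 0 <= x < pi *+ 2 /\ p * cos x + q * sin x + s = 0].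
have fUV : finite_set (U `*` V) by apply: finite_setX; exact: finite_quadratic.
apply: (@finite_injective_to _ _ X _ (fun x => (cos x, sin x)) fUV).
  move=> x [_ E]; have c2 := cos2Dsin2 x; split; rewrite /U /V /=.
    have -> : s = - (p * cos x + q * sin x) by lra.
    transitivity (q ^+ 2 * (cos x ^+ 2 + sin x ^+ 2 - 1)); first ring.
    by rewrite c2 subrr mulr0.
  have -> : s = - (p * cos x + q * sin x) by lra.
  transitivity (p ^+ 2 * (cos x ^+ 2 + sin x ^+ 2 - 1)); first ring.
  by rewrite c2 subrr mulr0.
by move=> x y [x0 _] [y0 _] [cxy sxy]; exact: cos_sin_inj.
Qed.

(** Piece [k] runs on the interval from [T k] to [T k.+1]; the outer pieces extend to infinity,
    which keeps the curve continuous and on the sphere for all real parameters. *)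
Fixpoint glue (R : realType) (V : Type) (g : nat -> R -> V) (T : nat -> R) (n : nat) : R -> V :=
  if n is m.+1 then fun s => if s < T n then glue g T m s else g n s else g 0%N.

Lemma glueE (R : realType) (V : Type) (g : nat -> R -> V) (T : nat -> R) (n k : nat) (s : R) :
  (forall k, T k < T k.+1) -> (forall k, (k < n)%N -> g k (T k.+1) = g k.+1 (T k.+1)) ->
  (k <= n)%N -> T k <= s <= T k.+1 -> glue g T n s = g k s.
Proof.
move=> Tlt; have Tinc : {homo T : i j / (i < j)%N >-> i < j} by apply: homo_ltn => //; exact: lt_trans.
elim: n => [|n IH] J; first by rewrite leqn0 => /eqP ->.
rewrite leq_eqVlt => /orP[/eqP -> /andP[Ts _] /=|]; first by rewrite ltNge Ts.
rewrite ltnS => kn /andP[Ts sT] /=; case: ltP => [_|sT'].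
  by apply: IH; rewrite ?Ts // => i ilt; apply: J; exact: ltnW.
move: kn; rewrite leq_eqVlt => /orP[/eqP kn|kn].
  have -> : s = T n.+1 by apply/eqP; rewrite eq_le sT' -kn sT.
  by rewrite kn; symmetry; exact: J.
by have := Tinc _ _ (kn : k.+1 < n.+1)%N; rewrite ltNge (le_trans sT').
Qed.

Lemma continuous_if (R : realType) (V : topologicalType) (f g : R -> V) (c : R) :
  continuous f -> continuous g -> f c = g c -> continuous (fun s => if s < c then f s else g s).
Proof.
move=> cf cg fg x; rewrite /prop_for /continuous_at; have [xc|xc|->] := ltgtP x c.
- rewrite /=; apply: cvg_trans (cf x); apply: (@near_eq_cvg _ _ (nbhs x)).
  by near=> y; rewrite (_ : y < c) //; near: y; exact: lt_nbhsl.
- rewrite /=; apply: cvg_trans (cg x); apply: (@near_eq_cvg _ _ (nbhs x)).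
  by near=> y; rewrite ltNge (ltW (_ : c < y)) //; near: y; exact: lt_nbhsr.
- move=> A gA; apply: (@filterS _ (nbhs c) _ [set y | A (f y) /\ A (g y)]); last first.
    by apply: (@filterI _ (nbhs c)); [apply: (cf c); rewrite fg|exact: (cg c)].
  by move=> y [fy gy] /=; case: ifP.
Unshelve. all: by end_near.
Qed.

Lemma continuous_glue (R : realType) (V : topologicalType) (g : nat -> R -> V) (T : nat -> R) (n : nat) :
  (forall k, T k < T k.+1) -> (forall k, (k < n)%N -> g k (T k.+1) = g k.+1 (T k.+1)) ->
  (forall k, continuous (g k)) -> continuous (glue g T n).
Proof.
move=> Tlt; elim: n => [|n IH] J cg; first exact: cg.
have J' k : (k < n)%N -> g k (T k.+1) = g k.+1 (T k.+1) by move=> kn; apply: J; exact: ltnW.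
apply: continuous_if => //; first exact: IH.
have E : glue g T n (T n.+1) = g n (T n.+1) by apply: glueE => //; rewrite lexx ltW.
by rewrite [LHS]E J.
Qed.

Lemma locate_subdivision (R : realType) (T : nat -> R) (n : nat) (s : R) : T 0%N <= s < T n.+1 ->
  exists k, (k <= n)%N /\ T k <= s < T k.+1.
Proof.
elim: n => [|n IH] /andP[s0 s1]; first by exists 0%N; rewrite s0.
have [sT|Ts] := ltP s (T n.+1); last by exists n.+1; rewrite Ts.
by have [|k [kn kT]] := IH; rewrite ?s0 //; exists k; split => //; exact: leqW.
Qed.

Lemma trig_inj (R : realType) (n : nat) (c a b : 'rV[R]_n) (rho u v : R) : 0 < rho ->
  dot a a = rho ^+ 2 -> dot b b = rho ^+ 2 -> dot a b = 0 ->
  0 <= u < pi *+ 2 -> 0 <= v < pi *+ 2 -> trig c a b 1 0 u = trig c a b 1 0 v -> u = v.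
Proof.
move=> rho0 aa bb ab u2 v2 uv.
have r2 : rho ^+ 2 != 0 by rewrite expf_eq0 /= gt_eqF.
apply: cos_sin_inj => //.
  have /(congr1 (fun x => dot x a)) := uv.
  rewrite /trig !dotDl !dotZl (dotC b) ab aa !mul1r !addr0 !mulr0 !addr0.
  by move/addrI/(mulIf r2).
have /(congr1 (fun x => dot x b)) := uv.
rewrite /trig !dotDl !dotZl ab bb !mul1r !addr0 !mulr0 !addr0.
by move/addrI/(mulIf r2).
Qed.

(* A meeting point is a root of a trigonometric polynomial of degree one. *)
Lemma finite_meet (R : realType) (n : nat) (cA aA bA cB aB bB u : 'rV[R]_n) (rho thA thB k : R) :
  thA <= pi *+ 2 -> thB <= pi *+ 2 -> 0 < rho ->
  dot aB aB = rho ^+ 2 -> dot bB bB = rho ^+ 2 -> dot aB bB = 0 ->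
  (forall v, dot u (trig cB aB bB 1 0 v) = k) ->
  [|| dot u aA != 0, dot u bA != 0 | dot u cA - k != 0] ->
  finite_set [set uv : R * R | [/\ 0 <= uv.1 < thA, 0 <= uv.2 < thB &
    trig cA aA bA 1 0 uv.1 = trig cB aB bB 1 0 uv.2]].
Proof.
move=> hA hB rho0 aa bb ab uk nz.
apply: (@finite_injective_to _ _ _ _ fst (finite_line_circle nz)) => /=.
  move=> [x y] [/= /andP[x0 x1] _ E]; split; first by rewrite x0 (lt_le_trans x1).
  have := uk y; rewrite -E /trig !dotDr !dotZr mul1r addr0; lra.
move=> [x y] [x' y'] [/= _ /andP[y0 y1] E] [/= _ /andP[y0' y1'] E'] xx; congr (_, _) => //.
have uv : trig cB aB bB 1 0 y = trig cB aB bB 1 0 y' by rewrite -E -E' xx.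
by apply: (trig_inj rho0 aa bb ab _ _ uv); rewrite ?y0 ?y0' ?(lt_le_trans y1) ?(lt_le_trans y1').
Qed.

(** Arc [k] has length [theta k * rho k] and takes that share of the unit interval, so the speed is
    [W] throughout. On half-open parameter intervals a single arc is injective, even a full circle,
    hence only pairs of different arcs contribute self-intersections. *)
Lemma closed_curve (R : realType) (d n : nat) (c a b : nat -> 'rV[R]_d.+1)
    (rho theta : nat -> R) (W : R) (e := fun k => trig (c k) (a k) (b k) 1 0) :
  (forall k, 0 < rho k) -> (forall k, 0 < theta k <= pi *+ 2) ->
  (forall k, [/\ dot (a k) (a k) = rho k ^+ 2, dot (b k) (b k) = rho k ^+ 2 & dot (a k) (b k) = 0]) ->
  (forall k u, dot (e k u) (e k u) = 1) ->
  (forall k, (k < n)%N -> e k (theta k) = e k.+1 0) -> e n (theta n) = e 0%N 0 ->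
  (forall j k, (j <= n)%N -> (k <= n)%N -> j != k ->
    finite_set [set uv : R * R | [/\ 0 <= uv.1 < theta j, 0 <= uv.2 < theta k & e j uv.1 = e k uv.2]]) ->
  W = \sum_(k < n.+1) theta k * rho k ->
  exists G : R -> 'rV[R]_d.+1,
    [/\ continuous G, piecewise_smooth G & forall s, dot (G s) (G s) = 1] /\
    [/\ G 0 = G 1, finite_set (self_intersections G),
        exists F : set R, finite_set F /\ forall s, 0 <= s <= 1 -> ~ F s -> speed G s = W &
        forall k, (k <= n)%N -> exists s, 0 <= s < 1 /\ G s = e k 0].
Proof.
move=> rho0 th0 orth unit J Jn fin WE.
have l0 k : 0 < theta k * rho k by rewrite mulr_gt0 //; case/andP: (th0 k).
have W0 : 0 < W by rewrite WE big_ord_recl ltr_pwDl ?l0 // sumr_ge0 // => i _; exact: ltW.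
have [T TE] : exists T : nat -> R, forall k, T k = (\sum_(i < k) theta i * rho i) / W by eexists.
have T0 : T 0%N = 0 by rewrite TE big_ord0 mul0r.
have T1 : T n.+1 = 1 by rewrite TE -WE divff // gt_eqF.
have TS k : T k.+1 = T k + theta k * rho k / W by rewrite !TE big_ord_recr /= mulrDl.
have Tlt k : T k < T k.+1 by rewrite TS ltrDl divr_gt0.
have Tinc : {homo T : i j / (i < j)%N >-> i < j} by apply: homo_ltn => //; exact: lt_trans.
have Tle : {homo T : i j / (i <= j)%N >-> i <= j}.
  by apply: homo_leq => // [x y z|k]; [exact: le_trans|exact: ltW].
have [om omE] : exists om : nat -> R, forall k, om k = W / rho k by eexists.
have om0 k : 0 < om k by rewrite omE divr_gt0.
have omT k : om k * (T k.+1 - T k) = theta k.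
  by rewrite TS omE addrC addKr; field; rewrite !gt_eqF.
have [g gE] : exists g : nat -> R -> 'rV[R]_d.+1, forall k,
    g k = trig (c k) (a k) (b k) (om k) (- (om k * T k)) by eexists.
have ge k s : g k s = e k (om k * (s - T k)).
  by rewrite gE /e /trig; congr (_ + cos _ *: _ + sin _ *: _); ring.
have gJ k : (k < n)%N -> g k (T k.+1) = g k.+1 (T k.+1).
  by move=> kn; rewrite !ge omT subrr mulr0 J.
have cg k : continuous (g k) by rewrite gE; exact: continuous_trig.
exists (glue g T n); set G := glue g T n.
have GE k s : (k <= n)%N -> T k <= s <= T k.+1 -> G s = g k s by exact: glueE.
have einj k u v : 0 <= u < theta k -> 0 <= v < theta k -> e k u = e k v -> u = v.
  move=> /andP[u0 u1] /andP[v0 v1]; have /andP[_ th2] := th0 k; have [aa bb ab] := orth k.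
  by apply: (trig_inj (rho0 k) aa bb ab); rewrite ?u0 ?v0 ?(lt_le_trans u1) ?(lt_le_trans v1).
have arg k s : T k <= s < T k.+1 -> 0 <= om k * (s - T k) < theta k.
  move=> /andP[s0 s1]; rewrite mulr_ge0 ?(ltW (om0 k)) ?subr_ge0 //=.
  by rewrite -(omT k) ltr_pM2l // ltrD2r.
split; split.
- exact: continuous_glue.
- exists [seq T k.+1 | k <- iota 0 n.+1].
    have pth m i : path <%R (T i) [seq T k.+1 | k <- iota i m] /\
        last (T i) [seq T k.+1 | k <- iota i m] = T (i + m)%N.
      elim: m i => [|m IHm] i /=; first by rewrite addn0.
      by have [p l] := IHm i.+1; rewrite Tlt p l addSnnS.
    by have [p l] := pth n.+1 0%N; split; rewrite -T0 // l T1.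
  move=> i; rewrite size_map size_iota => iN.
  have nE j : (j <= n.+1)%N -> nth 0 (0 :: [seq T k.+1 | k <- iota 0 n.+1]) j = T j.
    case: j => [|j] jn //; rewrite -[LHS]/(nth 0 [seq T k.+1 | k <- iota 0 n.+1] j).
    by rewrite (nth_map 0%N) ?size_iota // nth_iota.
  rewrite !nE ?(ltnW iN) //; exists (g i); split; first by move=> x; rewrite gE; exact: smooth_trig.
  by move=> s; rewrite in_itv /= => sT; exact: GE.
- move=> s; suff [k ->] : exists k, G s = g k s by rewrite ge.
  rewrite /G; elim: (n) => [|m [k IH]]; first by exists 0%N.
  by rewrite /=; case: ifP => _; [exists k|exists m.+1].
- rewrite (GE 0%N) ?T0 ?lexx ?(GE n 1) ?T1 ?lexx ?andbT //=; last 2 first.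
    by rewrite -T1 ltW.
    by rewrite -T0 ltW.
  by rewrite !ge -[in RHS]T1 omT T0 subrr mulr0.
- pose X j k := if (j != k) then [set uv : R * R |
    [/\ 0 <= uv.1 < theta j, 0 <= uv.2 < theta k & e j uv.1 = e k uv.2]] else set0.
  pose f j k (uv : R * R) := (T j + uv.1 / om j, T k + uv.2 / om k).
  apply: (@sub_finite_set _ _ (\bigcup_(j in `I_n.+1) \bigcup_(k in `I_n.+1) (f j k @` X j k))); last first.
    apply: bigcup_finite => [|j jn]; first exact: finite_II.
    apply: bigcup_finite => [|k kn]; first exact: finite_II.
    apply: finite_image; rewrite /X; case: ifP => // jk; exact: fin.
  move=> [s t] /= [/= s0 st t1 Gst].
  have [|j [jn js]] := @locate_subdivision _ T n s; first by rewrite T0 T1 s0 (lt_trans st).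
  have [|k [kn kt]] := @locate_subdivision _ T n t; first by rewrite T0 T1 t1 (le_trans s0) // ltW.
  have js' : T j <= s <= T j.+1 by case/andP: js => -> /ltW.
  have kt' : T k <= t <= T k.+1 by case/andP: kt => -> /ltW.
  move: Gst; rewrite (GE j) // (GE k) // !ge => E.
  have ju := arg _ _ js; have kv := arg _ _ kt.
  have jk : j != k.
    apply/eqP => jk; rewrite -jk in kv E; have := einj _ _ _ ju kv E.
    by move/(mulfI (lt0r_neq0 (om0 _)))/addIr => st'; move: st; rewrite st' ltxx.
  exists j => //; exists k => //; exists (om j * (s - T j), om k * (t - T k)).
    by rewrite /X jk; split.
  by rewrite /f /= ![om _ * _]mulrC !mulfK ?gt_eqF // ![_ + (_ - _)]addrC !subrK.
- exists (T @` `I_n.+2); split; first by apply: finite_image; exact: finite_II.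
  move=> s /andP[s0 s1] nF.
  have s1' : s < 1.
    rewrite lt_neqAle s1 andbT; apply/eqP => sE; apply: nF; exists n.+1.
    by rewrite /= ?ltnS.
    by rewrite T1 sE.
  have [|k [kn /andP[ks ks']]] := @locate_subdivision _ T n s; first by rewrite T0 T1 s0.
  have ks2 : T k < s.
    rewrite lt_neqAle ks andbT; apply/eqP => sE; apply: nF; exists k => //=.
    by rewrite ltnS; exact: leqW.
  have nG : \forall y \near s, G y = g k y.
    near=> y; apply: GE => //; apply/andP; split; apply: ltW; near: y.
      exact: lt_nbhsr.
    exact: lt_nbhsl.
  rewrite /speed derive1E (near_eq_derive _ nG) -derive1E gE derive1_trig /enorm.
  have [aa bb ab] := orth k.
  set x := trig _ _ _ _ _ _.
  have -> : \sum_i x ord0 i ^+ 2 = dot x x by apply: eq_bigr => i _; rewrite expr2.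
  have -> : dot x x = W ^+ 2.
    rewrite /x /trig !add0r !dotDl !dotDr !dotZl !dotZr aa bb ab (dotC (b k)) ab.
    set t := _ * s + _; transitivity (om k ^+ 2 * rho k ^+ 2 * (cos t ^+ 2 + sin t ^+ 2)); first ring.
    by rewrite cos2Dsin2 mulr1 omE; field; rewrite gt_eqF.
  by rewrite sqrtr_sqr gtr0_norm.
- move=> k kn; exists (T k); split.
    by rewrite -{1}T0 -{1}T1 (Tle _ _ (leq0n _)) Tinc.
  by rewrite (GE k) ?lexx ?(ltW (Tlt _)) // ge subrr mulr0.
Unshelve. all: by end_near.
Qed.

(** The nonzero determinant excludes that [a] and [b] are equal or antipodal, so the angle lies
    strictly between 0 and pi and [b'] is the unit tangent at [a] towards [b]. *)
Lemma great_circle_arc (R : realType) (d : nat) (a b z : 'rV[R]_d.+1) (th := acos (dot a b))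
    (b' := (sin th)^-1 *: (b - cos th *: a)) :
  dot a a = 1 -> dot b b = 1 -> dot (cross a b) z != 0 ->
  [/\ 0 < th < pi, dot b' b' = 1 & dot a b' = 0] /\ cos th *: a + sin th *: b' = b.
Proof.
move=> aa bb nz.
have ne (s : R) : s ^+ 2 = 1 -> dot a b != s.
  move=> s2; apply/eqP => abs; case/eqP: nz.
  have : dot (b - s *: a) (b - s *: a) = 0.
    by rewrite !(dotDl, dotDr, dotNl, dotNr, dotZl, dotZr) aa bb (dotC b) abs; ring: s2.
  move/eqP; rewrite dot_eq0 subr_eq0 => /eqP ->.
  by rewrite dot_cross !mxE; ring.
have /andP[b2 b1] := dot_unit_bound aa bb.
have b1' : dot a b < 1 by rewrite lt_neqAle b1 andbT ne // expr1n.
have b2' : -1 < dot a b by rewrite lt_neqAle b2 andbT eq_sym ne // sqrrN expr1n.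
have th0 : 0 < th by apply: acos_gt0; rewrite b2.
have th1 : th < pi by apply: acos_ltpi; rewrite b1 b2'.
have s0 : 0 < sin th by apply: sin_gt0_pi; rewrite th0.
have ct : cos th = dot a b by rewrite acosK // in_itv /= b2.
have s2 : sin th ^+ 2 = 1 - dot a b ^+ 2 by rewrite sin2cos2 ct.
split; last by rewrite /b' scalerA divff ?gt_eqF // scale1r addrC subrK.
split; first by rewrite th0.
  rewrite /b' dotZl dotZr !(dotDl, dotDr, dotNl, dotNr, dotZl, dotZr) aa bb (dotC b) ct.
  apply: (mulfI (_ : sin th ^+ 2 != 0)); first by rewrite expf_eq0 gt_eqF.
  rewrite [in RHS]s2; field; by rewrite gt_eqF.
by rewrite /b' dotZr dotDr dotNr dotZr aa ct mulr1 subrr mulr0.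
Qed.

(** Circles of radius [S] through [x], turned about [x] by [t]. Circle [t] lies in the affine
    hyperplane where the product with the unit vector [o t] equals [C], and the last formula shows
    that these hyperplanes change with [t]. *)
Lemma loop_arc (R : realType) (d : nat) (x : 'rV[R]_d.+1) (S : R) :
  (1 < d)%N -> dot x x = 1 -> 0 < S < 1 ->
  exists (o a b : R -> 'rV[R]_d.+1) (C : R), [/\ 0 < C, C ^+ 2 + S ^+ 2 = 1 &
    forall t, [/\ dot (a t) (a t) = S ^+ 2, dot (b t) (b t) = S ^+ 2 & dot (a t) (b t) = 0] /\
      [/\ trig (C *: o t) (a t) (b t) 1 0 0 = x,
        forall u, dot (o t) (trig (C *: o t) (a t) (b t) 1 0 u) = C,
        forall u, dot (trig (C *: o t) (a t) (b t) 1 0 u) (trig (C *: o t) (a t) (b t) 1 0 u) = 1 &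
        forall t', dot (o t) (o t') = C ^+ 2 + S ^+ 2 * cos (t - t')]].
Proof.
move=> d1 xx /andP[S0 S1].
have [D [DD xD _]] := @exists_orthogonal _ _ x x (d1 : (2 < d.+1)%N).
have [F [FF xF DF]] := @exists_orthogonal _ _ x D (d1 : (2 < d.+1)%N).
have S2 : S ^+ 2 < 1 by rewrite expr_lt1 // ltW.
have S20 : 0 < S ^+ 2 by rewrite exprn_gt0.
pose C := Num.sqrt (1 - S ^+ 2).
have C2 : C ^+ 2 = 1 - S ^+ 2 by rewrite sqr_sqrtr // subr_ge0 ltW.
have C0 : 0 < C by rewrite sqrtr_gt0 subr_gt0.
clearbody C.
pose dd t := cos t *: D + sin t *: F; pose ff t := (- sin t) *: D + cos t *: F.
have D1 t t' : dot (dd t) (dd t') = cos (t - t').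
  by rewrite /dd !(dotDl, dotDr, dotZl, dotZr) DD FF DF (dotC F) DF cosB; ring.
have D2 t : dot (dd t) (ff t) = 0.
  by rewrite /dd !(dotDl, dotDr, dotZl, dotZr) DD FF DF (dotC F) DF; ring.
have D3 t : dot (ff t) (ff t) = 1.
  rewrite /ff !(dotDl, dotDr, dotZl, dotZr) DD FF DF (dotC F) DF.
  by transitivity (cos t ^+ 2 + sin t ^+ 2); [ring|exact: cos2Dsin2].
have D4 t : dot x (dd t) = 0 by rewrite /dd !(dotDr, dotZr) xD xF; ring.
have D5 t : dot x (ff t) = 0 by rewrite /ff !(dotDr, dotZr) xD xF; ring.
have D6 t : dot (dd t) (dd t) = 1 by rewrite D1 subrr cos0.
clearbody dd ff.
pose o t := C *: x + S *: dd t; pose a t := S *: (S *: x - C *: dd t); pose b t := S *: ff t.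
have oo t t' : dot (o t) (o t') = C ^+ 2 + S ^+ 2 * cos (t - t').
  by rewrite /o !(dotDl, dotDr, dotZl, dotZr) xx (dotC _ x) !D4 D1; ring.
have oo1 t : dot (o t) (o t) = 1 by rewrite oo subrr cos0 C2; ring.
have oa t : dot (o t) (a t) = 0.
  by rewrite /o /a !(dotDl, dotDr, dotNr, dotZl, dotZr) xx (dotC _ x) !D4 D6; ring.
have ob t : dot (o t) (b t) = 0.
  by rewrite /o /b !(dotDl, dotZl, dotZr) D5 D2; ring.
have aa t : dot (a t) (a t) = S ^+ 2.
  rewrite /a !(dotDl, dotDr, dotNl, dotNr, dotZl, dotZr) xx (dotC _ x) !D4 D6.
  by transitivity (S ^+ 2 * (S ^+ 2 + C ^+ 2)); [ring|rewrite C2; ring].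
have bb t : dot (b t) (b t) = S ^+ 2 by rewrite /b !(dotZl, dotZr) D3; ring.
have ab t : dot (a t) (b t) = 0.
  by rewrite /a /b !(dotDl, dotNl, dotZl, dotZr) D5 D2; ring.
have oax t : C *: o t + a t = x.
  have -> : C *: o t + a t = (C ^+ 2 + S ^+ 2) *: x.
    by apply/rowP => i; rewrite !mxE; ring.
  by rewrite C2 subrK scale1r.
clearbody o a b.
exists o, a, b, C; split => //; first by rewrite C2 subrK.
move=> t; split=> //; split => //.
- by rewrite /trig mulr0 addr0 cos0 sin0 scale0r addr0 scale1r.
- by move=> u; rewrite /trig !dotDr !dotZr oo1 oa ob; ring.
- move=> u; rewrite /trig !(dotDl, dotDr, dotZl, dotZr) (dotC (a t) (o t)) (dotC (b t) (o t)).
  rewrite oo1 oa ob aa bb ab (dotC (b t)) ab.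
  transitivity (C ^+ 2 + S ^+ 2 * (cos (1 * u + 0) ^+ 2 + sin (1 * u + 0) ^+ 2)); first ring.
  by rewrite cos2Dsin2 C2; ring.
Qed.

(** Arcs with index below [M] are the edges of the polygon, the last of which returns to [x 0]; the
    later ones are full circles through [x 0]. *)
Lemma closed_polygon (R : realType) (d M : nat) (x : nat -> 'rV[R]_d.+1) (W : R)
    (y := fun i => if (i < M)%N then x i else x 0%N) :
  (1 < d)%N -> (3 <= M)%N -> (forall i, (i < M)%N -> dot (x i) (x i) = 1) ->
  (forall i j k, (i < M)%N -> (j < M)%N -> (k < M)%N -> uniq [:: i; j; k] ->
    dot (cross (x i) (x j)) (x k) != 0) ->
  \sum_(i < M) acos (dot (y i) (y i.+1)) < W ->
  exists G : R -> 'rV[R]_d.+1,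
    [/\ continuous G, piecewise_smooth G & forall s, dot (G s) (G s) = 1] /\
    [/\ G 0 = G 1, finite_set (self_intersections G),
        exists F : set R, finite_set F /\ forall s, 0 <= s <= 1 -> ~ F s -> speed G s = W &
        forall k, (k < M)%N -> exists s, 0 <= s < 1 /\ G s = x k].
Proof.
move=> d1 M3 xx gen; set L := \sum_(i < M) _ => LW.
have M0 : (0 < M)%N by apply: leq_trans M3.
pose nx i := if (i.+1 < M)%N then i.+1 else 0%N.
have nxM i : (nx i < M)%N by rewrite /nx; case: ifP.
have yE i : (i < M)%N -> y i = x i by rewrite /y => ->.
have ynx i : (i < M)%N -> y i.+1 = x (nx i) by rewrite /y /nx; case: ifP.
have yM i : (M <= i)%N -> y i = x 0%N by rewrite /y ltnNge => ->.
have M1 : (1 < M)%N by apply: leq_trans M3.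
have nx_neq i : nx i != i.
  by rewrite /nx; case: ifP => [_|]; [rewrite neq_ltn ltnSn orbT|case: i => [|//]; rewrite M1].
have nx_nx i : nx (nx i) != i.
  rewrite {2}/nx; case: ifP => [iM|]; last by case: i => [|[|i]]; rewrite ?M1 ?M3 // /nx M1.
  by rewrite /nx; case: ifP => [_|]; [rewrite gtn_eqF|move: iM => _; case: i => [|//]; rewrite M3].
have exists_third i : exists2 k, (k < M)%N & uniq [:: i; nx i; k].
  exists (nx (nx i)) => //=; rewrite !inE !negb_or (eq_sym i) nx_neq (eq_sym i) nx_nx.
  by rewrite (eq_sym (nx i)) nx_neq.
(* Sharing the remaining length among [m'.+1] circles makes their radius [S] smaller than 1, as the
   sphere requires. *)
set m' := Num.truncn ((W - L) / (pi *+ 2)).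
have pi2 : 0 < (pi : R) *+ 2 by rewrite mulrn_wgt0 // pi_gt0.
pose S := (W - L) / (pi *+ 2) / m'.+1%:R.
have S0 : 0 < S by rewrite !divr_gt0 ?ltr0n // subr_gt0.
have S1 : S < 1 by rewrite ltr_pdivrMr ?ltr0n // mul1r truncnS_gt.
have SE : pi *+ 2 * S * m'.+1%:R = W - L.
  by rewrite -mulrA /S divfK ?pnatr_eq0 // mulrC divfK // gt_eqF.
have [|o [a [b [C [C0 C1 loop]]]]] := @loop_arc R d (x 0%N) S d1 (xx _ M0); first by rewrite S0.
(* Distinct angles in [0, 1[, less than a full turn apart, so that no two circles coincide. *)
pose t (k : nat) : R := k%:R / (M + m'.+1)%:R.
pose th i := acos (dot (y i) (y i.+1)).
pose cc k := if (k < M)%N then 0 else C *: o (t k).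
pose aa k := if (k < M)%N then y k else a (t k).
pose bb k := if (k < M)%N then (sin (th k))^-1 *: (y k.+1 - cos (th k) *: y k) else b (t k).
pose rho k := if (k < M)%N then 1 else S.
pose theta k := if (k < M)%N then th k else pi *+ 2.
have edge i : (i < M)%N -> [/\ 0 < th i < pi, dot (bb i) (bb i) = 1 & dot (aa i) (bb i) = 0] /\
    cos (th i) *: aa i + sin (th i) *: bb i = y i.+1.
  move=> iM; have [k kM ku] := exists_third i.
  have := great_circle_arc (xx i iM) (xx _ (nxM i)) (gen i (nx i) k iM (nxM i) kM ku).
  by rewrite -(yE i iM) -(ynx i iM) /aa /bb iM.
have edge1 i : (i < M)%N -> dot (aa i) (aa i) = 1 by move=> iM; rewrite /aa iM yE // xx.
have [loopc loopa loopb] : [/\ forall i, (M <= i)%N -> cc i = C *: o (t i),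
    forall i, (M <= i)%N -> aa i = a (t i) & forall i, (M <= i)%N -> bb i = b (t i)].
  by split=> i; rewrite /cc /aa /bb ltnNge => ->.
have edgec i : (i < M)%N -> cc i = 0 by rewrite /cc => ->.
have edgea i : (i < M)%N -> aa i = x i by move=> iM; rewrite /aa iM yE.
have [thetae thetal] :
    (forall i, (i < M)%N -> theta i = th i) /\ (forall i, (M <= i)%N -> theta i = pi *+ 2).
  by split=> i; rewrite /theta ?ltnNge => ->.
have [rhoe rhol] : (forall i, (i < M)%N -> rho i = 1) /\ (forall i, (M <= i)%N -> rho i = S).
  by split=> i; rewrite /rho ?ltnNge => ->.
have WE : W = \sum_(k < (M + m').+1) theta k * rho k.
  rewrite -addnS big_split_ord /= (eq_bigr (fun i : 'I_M => th i)); last first.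
    by move=> i _; rewrite thetae ?rhoe // mulr1.
  rewrite [X in _ + X](eq_bigr (fun _ => pi *+ 2 * S)); last first.
    by move=> i _; rewrite thetal ?rhol ?leq_addr.
  by rewrite sumr_const card_ord -mulr_natr SE addrC subrK.
have theta_le k : 0 < theta k <= pi *+ 2.
  have [kM|Mk] := ltnP k M; last by rewrite thetal // pi2 lexx.
  have [[/andP[h0 h1] _ _] _] := edge k kM; rewrite thetae // h0 /= (le_trans (ltW h1)) //.
  by rewrite mulr2n lerDl ltW // pi_gt0.
have rho0 k : 0 < rho k by have [kM|Mk] := ltnP k M; [rewrite rhoe|rewrite rhol].
have orth k : [/\ dot (aa k) (aa k) = rho k ^+ 2, dot (bb k) (bb k) = rho k ^+ 2 & dot (aa k) (bb k) = 0].
  have [kM|Mk] := ltnP k M; last by rewrite rhol // loopa // loopb //; have [] := loop (t k).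
  by have [[_ ? ?] _] := edge k kM; rewrite rhoe // expr1n edge1.
pose e k := trig (cc k) (aa k) (bb k) 1 0.
have unit k u : dot (e k u) (e k u) = 1.
  have [kM|Mk] := ltnP k M; last by rewrite /e loopc ?loopa ?loopb //; have [_ []] := loop (t k).
  have [q1 q2 q3] := orth k; rewrite /e edgec // /trig add0r
    !(dotDl, dotDr, dotZl, dotZr) (dotC (bb k) (aa k)) q1 q2 q3.
  rewrite rhoe //.
  by rewrite -[RHS](cos2Dsin2 (1 * u + 0)); ring.
have e0 k : e k 0 = y k.
  have [kM|Mk] := ltnP k M; last by rewrite /e loopc ?loopa ?loopb // yM //; have [_ []] := loop (t k).
  by rewrite /e edgec // /trig mulr0 !addr0 add0r cos0 sin0 scale1r scale0r addr0 edgea // yE.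
have eth k : e k (theta k) = y k.+1.
  have [kM|Mk] := ltnP k M.
    by have [_ <-] := edge k kM; rewrite thetae // /e edgec // /trig mul1r addr0 add0r.
  rewrite [RHS]yM ?leqW // -(yM _ Mk) -e0 thetal // /e /trig mul1r mulr0 !addr0.
  by rewrite cos2pi sin2pi cos0 sin0.
have edge_fun k : (k < M)%N -> forall v, dot (cross (x k) (x (nx k))) (e k v) = 0.
  move=> kM v; have [_ E] := edge k kM; have [[/andP[h0 h1] _ _] _] := edge k kM.
  have ua : dot (cross (x k) (x (nx k))) (aa k) = 0 by rewrite edgea // dot_crossl.
  have ub : dot (cross (x k) (x (nx k))) (bb k) = 0.
    have : dot (cross (x k) (x (nx k))) (y k.+1) = 0 by rewrite ynx // dot_crossr.
    rewrite -E dotDr !dotZr ua mulr0 add0r => /eqP.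
    by rewrite mulf_eq0 (gt_eqF (sin_gt0_pi _)) ?h0 //= => /eqP.
  by rewrite /e edgec // /trig add0r dotDr !dotZr ua ub !mulr0 addr0.
have loop_fun k : (M <= k)%N -> forall v, dot (o (t k)) (e k v) = C.
  by move=> Mk v; rewrite /e loopc ?loopa ?loopb //; have [_ []] := loop (t k).
have meet j k (u : 'rV[R]_d.+1) (r : R) : (forall v, dot u (e k v) = r) ->
    [|| dot u (aa j) != 0, dot u (bb j) != 0 | dot u (cc j) - r != 0] ->
    finite_set [set uv : R * R | [/\ 0 <= uv.1 < theta j, 0 <= uv.2 < theta k & e j uv.1 = e k uv.2]].
  move=> uk nz; have [q1 q2 q3] := orth k.
  by apply: (finite_meet _ _ (rho0 k) q1 q2 q3 uk nz); [case/andP: (theta_le j)|case/andP: (theta_le k)].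
(* The hyperplane of circle [k] misses the origin, which is the centre of every edge. For another
   circle j its equation fails at the centre, by C S^2 (cos (t k - t j) - 1). *)
have meet_loop j k : (M <= k)%N -> [|| j < M | [&& M <= j, j <= M + m', k <= M + m' & j != k]]%N ->
    finite_set [set uv : R * R | [/\ 0 <= uv.1 < theta j, 0 <= uv.2 < theta k & e j uv.1 = e k uv.2]].
  move=> Mk h; apply: (meet j k _ _ (loop_fun k Mk)); apply/or3P; apply: Or33.
  case/orP: h => [jM|/and4P[Mj jm km jk]].
    by rewrite edgec // -[0](scale0r (x 0%N)) dotZr mul0r sub0r oppr_eq0 gt_eqF.
  rewrite loopc // dotZr; have [_ [_ _ _ ->]] := loop (t k).
  apply: contra_neq jk => E.
  have cos1 : cos (t k - t j) = 1.
    have CS : C * S ^+ 2 != 0 by rewrite mulf_neq0 ?expf_eq0 ?gt_eqF.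
    apply: (mulfI CS); rewrite mulr1; apply/eqP; rewrite -subr_eq0 -E; apply/eqP.
    transitivity (C * (C ^+ 2 + S ^+ 2 * cos (t k - t j)) - C * (C ^+ 2 + S ^+ 2)); first ring.
    by rewrite C1 mulr1.
  have t01 i : (i <= M + m')%N -> 0 <= t i < 1.
    by move=> im; rewrite /t divr_ge0 ?ler0n //= ltr_pdivrMr ?ltr0n ?addnS // mul1r ltr_nat ltnS.
  have /andP[tk0 tk1] := t01 k km; have /andP[tj0 tj1] := t01 j jm.
  have := cos_eq1 cos1; have := pi_ge2 R; rewrite mulr2n => p2 /(_ _)/eqP; rewrite subr_eq0 => H.
  have /eqP : t k = t j by apply/eqP/H; rewrite ltr_norml; apply/andP; split; lra.
  rewrite /t (can_eq (divfK _)) ?pnatr_eq0 ?addnS // eqr_nat => /eqP ->; reflexivity.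
have [|||G [H1 [H2 H3 H4 H5]]] :=
  @closed_curve R d (M + m') cc aa bb rho theta W rho0 theta_le orth unit _ _ _ WE.
- by move=> k _; rewrite -/(e k) -/(e k.+1) eth e0.
- by rewrite -/(e _) -/(e 0%N) eth e0 (yM _ (leqW (leq_addr _ _))) yE.
- move=> j k jm km jk.
  have [kM|Mk] := ltnP k M; last first.
    by apply: meet_loop => //; have [//|Mj] := ltnP j M; rewrite /= jm km jk.
  have [jM|Mj] := ltnP j M; last first.
    have f : finite_set [set uv : R * R | [/\ 0 <= uv.1 < theta k, 0 <= uv.2 < theta j & e k uv.1 = e j uv.2]].
      by apply: meet_loop; rewrite ?kM.
    apply: sub_finite_set (finite_image (fun uv => (uv.2, uv.1)) f).
    by move=> [p q] /= [h1 h2 h3]; exists (q, p).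
  (* If edge j lay in the kernel of the functional of edge k, so would both its ends, and one of
     them is a third vertex: [x j], or [x (nx j)] when j follows k. *)
  apply: (meet j k _ _ (edge_fun k kM)); rewrite orbA; apply/orP; left.
  rewrite -negb_and; apply/negP => /andP[/eqP ua /eqP ub].
  have ux : dot (cross (x k) (x (nx k))) (x (nx j)) = 0.
    by have [_ E] := edge j jM; rewrite -(ynx j jM) -E dotDr !dotZr ua ub !mulr0 addr0.
  move: ua; rewrite edgea // => ua.
  have [jE|jk'] := eqVneq j (nx k).
    rewrite jE in ux; have := gen k (nx k) (nx (nx k)) kM (nxM _) (nxM _).
    rewrite ux eqxx /= !inE !negb_or (eq_sym k) nx_neq (eq_sym k) nx_nx.
    by rewrite (eq_sym (nx k)) nx_neq => /(_ isT).
  have := gen k (nx k) j kM (nxM _) jM.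
  by rewrite ua eqxx /= !inE !negb_or (eq_sym k) nx_neq (eq_sym k) jk (eq_sym _ j) jk' => /(_ isT).
exists G; split => //; split => // k kM.
have [|s [s01 Gs]] := H5 k; first by rewrite (leq_trans (ltnW kM)) ?leq_addr.
by exists s; split => //; rewrite Gs -/(e k) e0 yE.
Qed.

(** * The weight *)

Definition bounded_measurable (R : realType) (f : R -> R) : Prop :=
  measurable_fun (`[0, 1]%classic : set R) f /\ exists B : R, forall x, 0 <= x <= 1 -> `|f x| <= B.

Definition mean01 (R : realType) (f : R -> R) : R :=
  \int[@lebesgue_measure R]_(x in (`[0, 1]%classic : set R)) f x.

Lemma lebesgue01 (R : realType) : @lebesgue_measure R (`[0, 1]%classic : set R) = 1%E.
Proof. by rewrite lebesgue_measure_itv /= lte_fin ltr01 oppr0 adde0. Qed.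

Lemma bmD (R : realType) (f g : R -> R) : bounded_measurable f -> bounded_measurable g ->
  bounded_measurable (fun x => f x + g x).
Proof.
move=> [mf [A fA]] [mg [B gB]]; split; first exact: measurable_funD.
by exists (A + B) => x x01; rewrite (le_trans (ler_normD _ _)) // lerD ?fA ?gB.
Qed.

Lemma bmM (R : realType) (f g : R -> R) : bounded_measurable f -> bounded_measurable g ->
  bounded_measurable (fun x => f x * g x).
Proof.
move=> [mf [A fA]] [mg [B gB]]; split; first exact: measurable_funM.
by exists (A * B) => x x01; rewrite normrM ler_pM ?fA ?gB.
Qed.

Lemma bm_cst (R : realType) (k : R) : bounded_measurable (fun => k).
Proof. by split; [exact: measurable_cst|exists `|k|]. Qed.

Lemma bm_sum (R : realType) (I : Type) (s : seq I) (f : I -> R -> R) :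
  (forall i, bounded_measurable (f i)) -> bounded_measurable (fun x => \sum_(i <- s) f i x).
Proof.
move=> bf; elim: s => [|i s IH].
  have -> : (fun x => \sum_(i <- [::]) f i x) = fun => 0 by apply/funext => x; rewrite big_nil.
  exact: bm_cst.
have -> : (fun x => \sum_(j <- i :: s) f j x) = fun x => f i x + \sum_(j <- s) f j x.
  by apply/funext => x; rewrite big_cons.
exact: bmD.
Qed.

Lemma bm_continuous (R : realType) (f : R -> R) : continuous f -> bounded_measurable f.
Proof.
move=> cf; split; first by apply: measurable_funTS; exact: continuous_measurable_fun.
have cw : {within `[0, 1], continuous f} by exact: continuous_subspaceT.
have [u _ fu] := @EVT_max R f 0 1 ler01 cw; have [v _ fv] := @EVT_min R f 0 1 ler01 cw.
exists (`|f u| + `|f v|) => x x01.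
have := fu x; have := fv x; rewrite in_itv /= => /(_ x01) h1 /(_ x01) h2.
have := ler_norm (f u); have := ler_norm (- f v); rewrite normrN.
have := normr_ge0 (f u); have := normr_ge0 (f v).
by move=> ? ? ? ?; rewrite ler_norml; apply/andP; split; lra.
Qed.

Lemma bm_indic (R : realType) (a b : R) : bounded_measurable (\1_`[a, b] : R -> R).
Proof.
split; first by apply: measurable_indic.
by exists 1 => x _; rewrite indicE; case: (_ \in _); rewrite ?normr0 ?normr1.
Qed.

Lemma bm_integrable (R : realType) (f : R -> R) : bounded_measurable f ->
  (@lebesgue_measure R).-integrable (`[0, 1]%classic : set R) (EFin \o f).
Proof.
move=> [mf [B fB]]; apply: measurable_bounded_integrable => //.
  by have := lebesgue01 R => /= ->; rewrite ltry.
exists B; split; first exact: num_real.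
move=> M BM x /=; rewrite in_itv /= => x01; apply: le_trans (fB x x01) (ltW BM).
Qed.

Lemma mean01D (R : realType) (f g : R -> R) : bounded_measurable f -> bounded_measurable g ->
  mean01 (fun x => f x + g x) = mean01 f + mean01 g.
Proof. by move=> bf bg; rewrite /mean01 RintegralD //; exact: bm_integrable. Qed.

Lemma mean01Z (R : realType) (k : R) (f : R -> R) : bounded_measurable f ->
  mean01 (fun x => k * f x) = k * mean01 f.
Proof. by move=> bf; rewrite /mean01 RintegralZl //; exact: bm_integrable. Qed.

Lemma mean01_sum (R : realType) (I : Type) (s : seq I) (f : I -> R -> R) :
  (forall i, bounded_measurable (f i)) ->
  mean01 (fun x => \sum_(i <- s) f i x) = \sum_(i <- s) mean01 (f i).
Proof.
move=> bf; elim: s => [|i s IH].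
  have -> : (fun x => \sum_(i <- [::]) f i x) = fun => 0 * 0.
    by apply/funext => x; rewrite big_nil mul0r.
  by rewrite big_nil mean01Z ?mul0r //; exact: bm_cst.
rewrite big_cons -IH -mean01D //; last exact: bm_sum.
by congr mean01; apply/funext => x; rewrite big_cons.
Qed.

Lemma mean01_le (R : realType) (f g : R -> R) : bounded_measurable f -> bounded_measurable g ->
  (forall x, f x <= g x) -> mean01 f <= mean01 g.
Proof.
by move=> bf bg fg; apply: le_Rintegral => //; exact: bm_integrable.
Qed.

Lemma mean01_indic (R : realType) (a b : R) : 0 <= a -> a <= b -> b <= 1 ->
  mean01 (\1_`[a, b] : R -> R) = b - a.
Proof.
move=> a0 ab b1; rewrite /mean01 /Rintegral integral_indic //.
rewrite (_ : _ `&` _ = `[a, b]%classic); last first.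
  apply/seteqP; split => x /=; rewrite !in_itv /=; first by case.
  by move=> /andP[ax xb]; rewrite ax xb (le_trans a0) // (le_trans xb).
have /= -> := @lebesgue_measure_itv R `[a, b]; rewrite lte_fin; case: ltP => //= ba.
by rewrite (@le_anti _ _ a b) ?subrr // ab.
Qed.

(** The window lies to the right of [s], so it fits into [0, 1] for [s = 0] too. *)
Lemma local_average (R : realType) (f : R -> R) (s e : R) : continuous f ->
  0 <= s < 1 -> 0 < e ->
  \forall h \near 0^'+, `|h^-1 * mean01 (fun x => f x * \1_`[s, s + h] x) - f s| <= e.
Proof.
move=> cf /andP[s0 s1] e0.
have /cvgrPdist_le/(_ e e0)/nbhs_ballP[del /= del0 H] := cf s.
near=> h.
have h0 : 0 < h by [].
have hd : h < del by near: h; exact: nbhs_right_lt.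
have h1 : h < 1 - s by near: h; apply: nbhs_right_lt; rewrite subr_gt0.
have sh1 : s + h <= 1 by lra.
have close x : s <= x <= s + h -> `|f s - f x| <= e.
  move=> /andP[sx xs]; apply: H; rewrite /ball /= ler0_norm; lra.
have bi := bm_indic s (s + h).
have bf : bounded_measurable (fun x => f x * \1_`[s, s + h] x) by apply: bmM => //; exact: bm_continuous.
have cm k : mean01 (fun x => k * \1_`[s, s + h] x) = k * h.
  by rewrite mean01Z // mean01_indic // ?lerDl ?ltW // addrAC subrr add0r.
have up : mean01 (fun x => f x * \1_`[s, s + h] x) <= (f s + e) * h.
  rewrite -cm; apply: mean01_le => //; first by apply: bmM => //; exact: bm_cst.
  move=> x; rewrite indicE; case: (boolP (_ \in _)); last by rewrite !mulr0.
  by rewrite inE /= in_itv /= => /close; rewrite ler_norml !mulr1 => /andP[]; lra.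
have lo : (f s - e) * h <= mean01 (fun x => f x * \1_`[s, s + h] x).
  rewrite -cm; apply: mean01_le => //; first by apply: bmM => //; exact: bm_cst.
  move=> x; rewrite indicE; case: (boolP (_ \in _)); last by rewrite !mulr0.
  by rewrite inE /= in_itv /= => /close; rewrite ler_norml !mulr1 => /andP[]; lra.
set m := mean01 _ in up lo *.
have -> : h^-1 * m - f s = (m - f s * h) / h by field; rewrite gt_eqF.
rewrite normrM normfV (gtr0_norm h0) ler_pdivrMr // ler_norml.
by apply/andP; split; lra.
Unshelve. all: by end_near.
Qed.

(** Meant for the speed, which is known only off the break points. Measurability of [f] itself is
    obtained from that of [g], as finite sets are measurable and null. *)
Lemma mean01_off_finite (R : realType) (f g : R -> R) (F : set R) :
  bounded_measurable g -> finite_set F -> (forall x, 0 <= x <= 1 -> ~ F x -> f x = g x) ->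
  (@lebesgue_measure R).-integrable (`[0, 1]%classic : set R) (EFin \o f) /\
  (\int[@lebesgue_measure R]_(x in `[0%R, 1%R]) (f x)%:E)%E = (mean01 g)%:E.
Proof.
move=> bg fF fg.
have mfin (A : set R) : finite_set A -> measurable A.
  by move=> fA; apply: countable_measurable => [x|]; [exact: measurable_set1|exact: finite_set_countable].
have F0 : lebesgue_measure F = 0%E by apply: countable_lebesgue_measure0; exact: finite_set_countable.
have mI : measurable (`[0, 1]%classic : set R) by [].
have mF := mfin _ fF.
have fgD : {in (`[0, 1]%classic : set R) `\` F, EFin \o g =1 EFin \o f}.
  by move=> x /set_mem[]; rewrite /= in_itv /= => x01 nF; rewrite fg.
have mf : measurable_fun (`[0, 1]%classic : set R) f.
  rewrite -(setDUK (@subIsetl _ `[0, 1]%classic F)).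
  apply/measurable_funU; [exact: measurableI|apply: measurableD => //; exact: measurableI|split].
    move=> _ Y mY; apply: mfin; apply: sub_finite_set fF; by move=> x [[]].
  apply: (@eq_measurable_fun _ _ _ _ _ g).
    by move=> x /set_mem[/=]; rewrite in_itv /= => x01 nF; rewrite fg // => Fx; apply: nF.
  by apply: measurable_funS (proj1 bg) => //; exact: subDsetl.
have ig := bm_integrable bg.
have If : (@lebesgue_measure R).-integrable (`[0, 1]%classic : set R) (EFin \o f).
  have mEf : measurable_fun (`[0, 1]%classic : set R) (EFin \o f) by apply/measurable_EFinP.
  have mEg : measurable_fun (`[0, 1]%classic : set R) (EFin \o g) by apply/measurable_EFinP; case: bg.
  apply: (proj2 (@negligible_integrable _ _ R (@lebesgue_measure R) _ _ _ mF mI mEf F0)).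
  refine (@eq_integrable _ _ R (@lebesgue_measure R) _ (measurableD mI mF) _ _ fgD _).
  exact: (proj1 (@negligible_integrable _ _ R (@lebesgue_measure R) _ _ _ mF mI mEg F0) ig).
have E1 := @negligible_integral _ _ R (@lebesgue_measure R) _ _ _ mF mI If F0.
have E2 := @negligible_integral _ _ R (@lebesgue_measure R) _ _ _ mF mI ig F0.
split => //; rewrite /mean01 /Rintegral fineK; last exact: integrable_fin_num.
rewrite [LHS]E1 [RHS]E2; apply: eq_integral => x xD; symmetry; exact: fgD.
Qed.

(** At an index [j] where |z j| is largest, row [j] gives |z j| <= B + |z j| / 2. *)
Lemma near_identity_bound (R : realType) (r : nat) (N : 'M[R]_r) (eta B : R) (z : 'I_r -> R) :
  (forall l k, `|N l k - (l == k)%:R| <= eta) -> r%:R * eta <= 2^-1 ->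
  (forall l, `|\sum_k N l k * z k| <= B) -> forall k, `|z k| <= 2 * B.
Proof.
move=> NI reta NB k.
have [j _ jmax] := @arg_maxP _ R 'I_r k xpredT (fun i => `|z i|) isT.
have {}jmax i : `|z i| <= `|z j| by exact: jmax i isT.
apply: le_trans (jmax k) _.
have E : z j = \sum_k N j k * z k - \sum_k (N j k - (j == k)%:R) * z k.
  rewrite -sumrB [RHS](bigD1 j) //= big1 => [|i ij]; first by rewrite eqxx /=; ring.
  by rewrite (eq_sym j) (negbTE ij) /=; ring.
have D : `|\sum_k (N j k - (j == k)%:R) * z k| <= 2^-1 * `|z j|.
  apply: le_trans (ler_norm_sum _ _ _) _.
  apply: (@le_trans _ _ (\sum_(i < r) eta * `|z j|)).
    by apply: ler_sum => i _; rewrite normrM ler_pM ?NI ?jmax.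
  by rewrite sumr_const card_ord -[leLHS]mulr_natl mulrA ler_wpM2r.
have := ler_normB (\sum_k N j k * z k) (\sum_k (N j k - (j == k)%:R) * z k).
by rewrite -E; have := NB j; lra.
Qed.

Lemma near_identity_solve (R : realType) (r : nat) (N : 'M[R]_r) (eta B : R) (y : 'I_r -> R) :
  (forall l k, `|N l k - (l == k)%:R| <= eta) -> r%:R * eta <= 2^-1 ->
  (forall l, `|y l| <= B) ->
  exists z : 'I_r -> R, (forall l, \sum_k N l k * z k = y l) /\ forall k, `|z k| <= 2 * B.
Proof.
move=> NI reta yB.
have uN : N \in unitmx.
  rewrite -unitmx_tr -row_free_unit; apply: inj_row_free => v vN; apply/rowP => k; rewrite mxE.
  apply/eqP; rewrite -normr_le0 -[leRHS](mulr0 2).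
  apply: (@near_identity_bound R r N eta 0 (v ord0)) => // l.
  move/rowP/(_ l): vN; rewrite !mxE => vN.
  by rewrite (eq_bigr (fun k => v ord0 k * N^T k l)) ?vN ?normr0 // => i _; rewrite mxE mulrC.
pose z k := (invmx N *m \col_l y l) k ord0.
have zE l : \sum_k N l k * z k = y l.
  have /matrixP/(_ l ord0) : N *m (invmx N *m \col_l y l) = \col_l y l by rewrite mulKVmx.
  by rewrite mxE [RHS]mxE.
exists z; split=> //; apply: near_identity_bound NI reta _ => l.
by rewrite zE.
Qed.

(** The [f l] will be the Lagrange functions along the curve and [V l i] their values at the
    original points. The tolerance [2 * delta] is one [delta] for moving the points and one for
    smearing the masses; the last hypothesis keeps corrected masses positive. *)
Lemma design_weight (R : realType) (W delta : R) (M r : nat) (f : 'I_r -> R -> R)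
    (s alpha : nat -> R) (beta : 'I_r -> nat) (V : 'I_r -> nat -> R) :
  0 < W -> 0 < delta -> (forall l, continuous (f l)) -> (forall i, 0 <= s i < 1) ->
  (forall i, 0 <= alpha i) -> (forall l, (beta l < M)%N) -> injective beta ->
  (forall l k, V l (beta k) = (l == k)%:R) ->
  (forall l i, (i < M)%N -> `|f l (s i) - V l i| <= delta) ->
  r%:R * (2 * delta) <= 2^-1 ->
  (forall l, 2 * (\sum_(i < M) alpha i * (2 * delta) + delta) < alpha (beta l)) ->
  exists w : R -> R, [/\ bounded_measurable w, forall x, 0 < w x &
    forall l, mean01 (fun x => f l x * w x * W) = \sum_(i < M) alpha i * V l i].
Proof.
move=> W0 del0 cf s01 alpha0 betaM betaI Vbeta fV rdel asmall.
pose chi h i : R -> R := \1_`[s i, s i + h].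
have [h [h0 hH]] : exists h : R, 0 < h /\ forall (l : 'I_r) (i : 'I_M),
    `|h^-1 * mean01 (fun x => f l x * chi h i x) - f l (s i)| <= delta.
  have H : \forall h \near 0^'+, 0 < h /\ forall (l : 'I_r) (i : 'I_M),
      `|h^-1 * mean01 (fun x => f l x * chi h i x) - f l (s i)| <= delta.
    near=> h; split; first by [].
    near: h; apply: filter_forall => l; apply: filter_forall => i.
    exact: local_average.
  by have [h ?] := @filter_ex _ _ _ _ H; exists h.
have bchi i : bounded_measurable (chi h i) by exact: bm_indic.
have bf l : bounded_measurable (f l) by exact: bm_continuous.
have [a aE] : exists a : 'I_r -> nat -> R, forall l i, a l i = h^-1 * mean01 (fun x => f l x * chi h i x).
  by eexists.
have aV l i : (i < M)%N -> `|a l i - V l i| <= 2 * delta.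
  move=> iM; have := hH l (Ordinal iM); have := fV l i iM; rewrite /= -aE => h1 h2.
  rewrite -(subrKA (f l (s i))) (le_trans (ler_normD _ _)) //; lra.
pose e l := W * mean01 (f l).
(* The constant part of the weight is so small that it changes each integral by at most [delta]. *)
pose eps := delta / (1 + \sum_l `|e l|).
have D0 : 0 < 1 + \sum_l `|e l| by rewrite ltr_pwDl // sumr_ge0.
have eps0 : 0 < eps by rewrite divr_gt0.
have epse l : `|eps * e l| <= delta.
  rewrite normrM gtr0_norm // /eps mulrAC ler_pdivrMr // ler_pM2l //.
  by rewrite (bigD1 l) //= addrCA lerDl addr_ge0 // sumr_ge0.
clearbody eps.
pose y l := \sum_(i < M) alpha i * (V l i - a l i) - eps * e l.
pose B := \sum_(i < M) alpha i * (2 * delta) + delta.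
have yB l : `|y l| <= B.
  rewrite /y /B (le_trans (ler_normB _ _)) // lerD //.
  rewrite (le_trans (ler_norm_sum _ _ _)) // ler_sum // => i _.
  by rewrite normrM ger0_norm // ler_wpM2l // distrC aV.
pose N := \matrix_(l < r, k < r) a l (beta k).
have NI l k : `|N l k - (l == k)%:R| <= 2 * delta by rewrite mxE -Vbeta aV.
have [z [zE zB]] := near_identity_solve NI rdel yB.
(* The masses [z] added at the interpolation points make up for the errors of
   smearing and displacement and for the constant part of the weight. *)
pose b i := alpha i + \sum_(k < r) (beta k == i)%:R * z k.
have b0 i : 0 <= b i.
  rewrite /b; case: (pickP (fun k => beta k == i)) => [k /eqP ki|none].
    rewrite (bigD1 k) //= ki eqxx mul1r big1 => [|j jk]; last first.
      by rewrite -ki (inj_eq betaI) (negbTE jk) mul0r.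
    have := zB k; have := asmall k; rewrite ki -/B ler_norml addr0 => h1 /andP[h2 _]; lra.
  by rewrite big1 ?addr0 // => k _; rewrite none mul0r.
(* Dividing by [W * h] accounts for the speed and for the width of the window. *)
pose w x := eps + \sum_(i < M) (b i / (W * h)) * chi h i x.
have bw : bounded_measurable w.
  apply: bmD; first exact: bm_cst.
  by apply: bm_sum => i; apply: bmM => //; exact: bm_cst.
exists w; split => // [x|l].
  rewrite ltr_pwDl // sumr_ge0 // => i _; apply: mulr_ge0; last by rewrite /chi indicE ler0n.
  by apply: divr_ge0 => //; apply/ltW/mulr_gt0.
have -> : (fun x => f l x * w x * W) =
    fun x => (eps * W) * f l x + \sum_(i < M) (b i / h) * (f l x * chi h i x).
  apply/funext => x; rewrite /w mulrDr mulrDl mulr_sumr mulr_suml; congr (_ + _); first ring.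
  by apply: eq_bigr => i _; field; rewrite !gt_eqF.
have bfc i : bounded_measurable (fun x => f l x * chi h i x) by apply: bmM.
rewrite mean01D; last 2 first.
- by apply: bmM => //; exact: bm_cst.
- by apply: bm_sum => i; apply: bmM => //; exact: bm_cst.
rewrite mean01Z // mean01_sum => [|i]; last by apply: bmM => //; exact: bm_cst.
have -> : \sum_(i < M) mean01 (fun x => b i / h * (f l x * chi h i x)) = \sum_(i < M) b i * a l i.
  by apply: eq_bigr => i _; rewrite mean01Z // aE mulrA.
have -> : \sum_(i < M) b i * a l i = \sum_(i < M) alpha i * a l i + \sum_k N l k * z k.
  rewrite /b; under eq_bigr do rewrite mulrDl mulr_suml.
  rewrite big_split exchange_big /=; congr (_ + _); apply: eq_bigr => k _.
  rewrite (bigD1 (Ordinal (betaM k))) //= eqxx big1 => [|i ik].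
    by rewrite mxE mul1r addr0 mulrC.
  rewrite (_ : beta k == i = false) ?mul0r //.
  by apply: contra_neqF ik => /eqP E; apply/val_inj; rewrite /= E.
rewrite zE /y.
have -> : \sum_(i < M) alpha i * (V l i - a l i) = \sum_(i < M) alpha i * V l i - \sum_(i < M) alpha i * a l i.
  by rewrite -sumrB; apply: eq_bigr => i _; rewrite mulrBr.
rewrite /e; ring.
Unshelve. all: by end_near.
Qed.

Lemma exists_tolerance (R : realType) (r : nat) (A : R) (alpha : 'I_r -> R) :
  0 <= A -> (forall l, 0 < alpha l) ->
  exists delta : R, [/\ 0 < delta, r%:R * (2 * delta) <= 2^-1 &
    forall l, 2 * (A * (2 * delta) + delta) < alpha l].
Proof.
move=> A0 al0.
(* A positive number below 1 and below every [alpha l], available even when [r] is 0. *)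
pose m := (1 + \sum_l (alpha l)^-1)^-1.
have s0 l : 0 <= (alpha l)^-1 by rewrite invr_ge0 ltW.
have D0 : 0 < 1 + \sum_l (alpha l)^-1 by rewrite ltr_pwDl // sumr_ge0.
have m0 : 0 < m by rewrite invr_gt0.
have m1 : m <= 1 by rewrite invf_le1 // lerDl sumr_ge0.
have ma l : m <= alpha l.
  rewrite -[leRHS]invrK lef_pV2 ?posrE ?invr_gt0 // (bigD1 l) //= addrCA lerDl.
  by rewrite addr_ge0 // sumr_ge0.
clearbody m.
pose q := m / (r%:R + 1).
have r1 : (0 : R) < r%:R + 1 by rewrite ltr_wpDl.
have q0 : 0 < q by rewrite divr_gt0.
have qm : q * (r%:R + 1) = m by rewrite divfK // gt_eqF.
clearbody q.
pose delta := q / (8 * (A + 1)).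
have A1 : 0 < 8 * (A + 1) by lra.
have d0 : 0 < delta by rewrite divr_gt0.
have dE : delta * (8 * (A + 1)) = q by rewrite divfK // gt_eqF.
clearbody delta.
have rq : 0 <= r%:R * q by rewrite mulr_ge0 // ltW.
have rd : 0 <= (r%:R * delta) by rewrite mulr_ge0 // ltW.
have rdA : 0 <= (r%:R * delta) * A by rewrite mulr_ge0.
have dA : 0 <= delta * A by rewrite mulr_ge0 // ltW.
exists delta; split => // [|l].
  have : r%:R * q = 8 * (r%:R * delta * A) + 8 * (r%:R * delta) by rewrite -dE; ring.
  lra.
have := ma l; lra.
Qed.

(** A bad edge is at most half a great circle, and the good ones, fewer than [M.+1] in number and
    each shorter than 1 / (M + 1), add up to less than 1. *)
Lemma length_bound (R : realType) (d M K : nat) (x : nat -> 'rV[R]_d.+1) (bad : pred nat)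
    (y := fun i => if (i < M)%N then x i else x 0%N) :
  (0 < M)%N -> (forall i, (i < M)%N -> dot (x i) (x i) = 1) -> bad M.-1 ->
  (forall i, (i < M)%N -> ~~ bad i -> cos (M.+1%:R^-1) < dot (x i) (x i.+1)) ->
  \sum_(i < M) (bad i)%:R <= K%:R :> R ->
  \sum_(i < M) acos (dot (y i) (y i.+1)) < K%:R * pi + 1.
Proof.
move=> M0 xx badM good badK.
have yy i : dot (y i) (y i) = 1 by rewrite /y; case: ifP => iM; rewrite xx.
have Mi0 : (0 : R) < M.+1%:R^-1 by rewrite invr_gt0 ltr0n.
have Mi1 : M.+1%:R^-1 <= pi :> R.
  by rewrite (le_trans _ (pi_ge2 R)) // (@le_trans _ _ 1) ?ler1n // invf_le1 ?ltr0n // ler1n.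
apply: (@le_lt_trans _ _ (\sum_(i < M) ((bad i)%:R * pi + M.+1%:R^-1))).
  apply: ler_sum => i _; have bnd := dot_unit_bound (yy i) (yy i.+1).
  have [bi|gi] := boolP (bad i).
    by rewrite mul1r (le_trans (acos_lepi bnd)) // lerDl ltW.
  rewrite mul0r add0r.
  have iM : (i.+1 < M)%N.
    rewrite ltn_neqAle ltn_ord andbT; apply: contraNneq gi => iE.
    by rewrite -[nat_of_ord i]/(i.+1.-1) iE.
  have := good i (ltn_ord i) gi; have -> : x i = y i by rewrite /y ltn_ord.
  have -> : x i.+1 = y i.+1 by rewrite /y iM.
  rewrite -{1}[dot _ _]acosK ?in_itv //= ltr_cos ?in_itv /=; first exact: ltW.
    by rewrite acos_ge0 // acos_lepi.
  by rewrite Mi1 ltW.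
rewrite big_split /= -mulr_suml sumr_const card_ord.
apply: ler_ltD; first by rewrite ler_wpM2r // pi_ge0.
by rewrite -[_^-1 *+ _]mulr_natl ltr_pdivrMr ?ltr0n // mul1r ltr_nat.
Qed.

(** * Assembly of the design curve *)

Unset Implicit Arguments.

Theorem proposition5p5 (R : realType) (t : nat) (ht : (0 < t)%N) :
  exists Wt : R,
  forall (d : nat) (hd : (2 <= d)%N)
         (sigma : probability (borel_rV R d.+1) R)
         (hsigma : uniform_on_sphere sigma)
         (W : R) (hW : Wt * d%:R ^+ t.-1 <= W),
  exists (gamma : R -> 'rV[R]_d.+1) (w : R -> R),
    [/\ weighted_design_curve t sigma gamma w,
        curve_length gamma = W%:E &
        finite_set [set s | 0 <= s <= 1 /\ ~ (0 < w s)]].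
Proof.
have [C CP] := robust_design R t.
(* At most C (d+1)^(t-1) long edges of length at most pi, with d + 1 <= 2d, and 1 for all the short
   edges. *)
exists (C%:R * 2 ^+ t.-1 * pi + 1) => d d2 sigma us W WW.
have [M [r [Q [al [be [c [bad [[M3 QQ al0] [beM beI albe] [cc cQ interp] mean [badC badM good]]]]]]]]] :=
  CP d sigma d2 us.
have M0 : (0 < M)%N by apply: leq_trans M3.
have [|delta [del0 rdel adel]] := @exists_tolerance R r (\sum_(i < M) al i) (fun l => al (be l)) _ albe.
  by rewrite sumr_ge0.
have {}adel l : 2 * (\sum_(i < M) al i * (2 * delta) + delta) < al (be l) by rewrite -mulr_suml.
have [x [xQ xgen]] := generic_family d2 M3 QQ.
(* What the perturbation has to preserve: the values of the Lagrange functions up to [delta], and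
   the shortness of the good steps. Both hold for large [mu] by continuity. *)
pose E mu := (forall (l : 'I_r) (i : 'I_M), `|c l (x mu i) - c l (Q i)| <= delta) /\
  (forall i : 'I_M, ~~ bad i -> cos (M.+1%:R^-1) < dot (x mu i) (x mu i.+1)).
have nE : \forall mu \near +oo, E mu.
  near=> mu; split; near: mu.
    apply: filter_forall => l; apply: filter_forall => i.
    have cv : c l (x mu i) @[mu --> +oo] --> c l (Q i) by apply: cvg_comp (xQ i) (cc l _).
    by move/cvgrPdistC_le : cv; apply.
  apply: filter_forall => i; have [|gi] := boolP (bad i); first by move=> _; apply: filterE.
  have cv : dot (x mu i) (x mu i.+1) @[mu --> +oo] --> dot (Q i) (Q i.+1) by exact: cvg_dot (xQ i) (xQ i.+1).
  have gt := cvgr_gt _ cv _ (good i gi).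
  by near=> nu => _; near: nu; exact: gt.
have [mu [[closeE goodE] x1 xg]] := xgen E nE.
have badC' : \sum_(i < M) (bad i)%:R <= (C * d.+1 ^ t.-1)%:R :> R by [].
have goodE' i : (i < M)%N -> ~~ bad i -> cos (M.+1%:R^-1) < dot (x mu i) (x mu i.+1).
  by move=> iM; exact: goodE (Ordinal iM).
have := length_bound M0 x1 badM goodE' badC'; set L := (X in X < _) => Lb.
have d0 : (0 < d)%N by apply: leq_trans d2.
have WL : (C * d.+1 ^ t.-1)%:R * pi + 1 <= W.
  apply: le_trans WW; rewrite mulrDl mul1r lerD //; last by rewrite exprn_ege1 // ler1n.
  rewrite mulrAC ler_wpM2r ?pi_ge0 // natrM -mulrA ler_wpM2l // -exprMn natrX.
  by rewrite lerXn2r ?nnegrE ?mulr_ge0 ?ler0n // -natrM ler_nat mul2n -addnn -addn1 leq_add2l.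
have [G [[cG pG GG] [G01 finG [F [fF speedG]] visit]]] := closed_polygon d2 M3 x1 xg (lt_le_trans Lb WL).
have W0 : 0 < W by rewrite (lt_le_trans _ WL) // ltr_wpDl // mulr_ge0 ?pi_ge0.
have /choice[s sP] : forall i, exists s : R, 0 <= s < 1 /\ ((i < M)%N -> G s = x mu i).
  move=> i; have [/visit[s [s01 Gs]]|Mi] := ltnP i M; first by exists s.
  by exists 0; rewrite lexx ltr01.
have cf l : continuous (fun u => c l (G u)).
  by move=> u; apply: (continuous_comp (cG u) (cc l _)).
have sM l i : (i < M)%N -> `|c l (G (s i)) - c l (Q i)| <= delta.
  by move=> iM; rewrite (proj2 (sP i)) //; exact: closeE l (Ordinal iM).
have [w [bw w0 wI]] := @design_weight R W delta M r (fun l u => c l (G u)) s al be (fun l i => c l (Q i))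
  W0 del0 cf (fun i => proj1 (sP i)) al0 beM beI cQ sM rdel adel.
exists G, w; split; last 2 first.
- have [|_] := @mean01_off_finite R (speed G) (fun => W) F (bm_cst W) fF; first exact: speedG.
  rewrite -/(curve_length G) => ->.
  rewrite /mean01 Rintegral_cst //.
  by have /= -> := lebesgue01 R; rewrite mulr1.
- by rewrite (_ : [set _ | _] = set0) //; apply/seteqP; split => // u [_]; rewrite w0.
left; split => //.
- by move=> u _; apply/sphereE.
- by split => //; exact: continuous_subspaceT.
move=> p tp.
have bfw l : bounded_measurable (fun u => c l (G u) * w u * W).
  by apply: bmM (bm_cst _); apply: bmM => //; exact: bm_continuous.
(* On the sphere [p] is a combination of the Lagrange functions, so the integrals provided by
   [design_weight] suffice. *)
pose g u := \sum_l polyfun p (Q (be l)) * (c l (G u) * w u * W).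
have bg : bounded_measurable g by apply: bm_sum => l; apply: bmM => //; exact: bm_cst.
have [|If ->] := mean01_off_finite (f := fun u => polyfun p (G u) * w u * speed G u) bg fF.
  move=> u u01 nF; rewrite speedG // (interp _ _ tp (GG u)) !mulr_suml; apply: eq_bigr => l _; ring.
split; first exact: If.
rewrite sphere_meanE; congr EFin.
rewrite mean01_sum => [|l]; last by apply: bmM => //; exact: bm_cst.
rewrite (mean _ tp).
transitivity (\sum_l polyfun p (Q (be l)) * \sum_(i < M) al i * c l (Q i)).
  by apply: eq_bigr => l _; rewrite mean01Z // wI.
rewrite (eq_bigr (fun i : 'I_M => \sum_l al i * (c l (Q i) * polyfun p (Q (be l))))); last first.
  by move=> i _; rewrite (interp _ _ tp (QQ i)) mulr_sumr.
rewrite exchange_big; apply: eq_bigr => l _; rewrite mulr_sumr; apply: eq_bigr => i _; ring.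
Unshelve. all: by end_near.
Qed.
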